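(* Let $Q(T)=\sum_{i=0}^{120} q_i T^i\in\mathbf{Z}[T]$ be the monic polynomial of degree $120$ whose coefficients $q_0,\ldots,q_{120}$ are the explicit integers listed in the context, and let $P\in\mathbf{Z}[T]$ be the monic polynomial of degree $240$ given by $P(T)=T^{120}Q(T+T^{-1})$. Then the Galois group of the splitting field of $P$ over $\mathbf{Q}$ is isomorphic to $W(\mathbf{E}_8)$, the Weyl group of the exceptional group of type $\mathbf{E}_8$.
   Context: $W(\mathbf{E}_8)$ is the Weyl group of the root system of type $E_8$, a finite group of order $696729600=2^{14}\cdot 3^5\cdot 5^2\cdot 7$. It is the Coxeter group with generators $w_1,\ldots,w_8$ and relations $w_i^2=1$, $(w_iw_j)^{m(i,j)}=1$ for $1\le i<j\le 8$, where $m(i,j)=3$ if $(i,j)\in\{(1,3),(3,4),(2,4),(4,5),(5,6),(6,7),(7,8)\}$ and $m(i,j)=2$ otherwise. The coefficients $q_i$ of $Q(T)=\sum_{i=0}^{120}q_iT^i$ are: $q_{0}=365587894983967922854560421106658794835269162025801581455381270108994772086354097689969$, $q_{1}=-11188764671313743052104852260462353867603756780241598167388311775144605678410262867332448$, $q_{2}=169253696238399029559192135798369681596869020592118579039666548219126339368278708130365896$, $q_{3}=-1687159920262524494571824891028833720039695470637056956223462293372163529290126431304585100$, $q_{4}=12466538870569350428117512482674638738192598391028225510113876433671029848121166234252784168$, $q_{5}=-72826947156697363455035723423426971890324922381314772703337692580409097282009564861222315768$, $q_{6}=350331529672673601609711561533019721386090515420775351136161318553244630344247566318282845504$, $q_{7}=-1427238565615616836874966027280849892931467391947083350631098008579547451949365512165445324548$,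 $q_{8}=5026354438587350042393019188859322619309223067912455590765316222074769006654715395492167534064$, $q_{9}=-15543242692747890030945651958468728793028138424448388052344884541152421476286890160281606087912$, $q_{10}=42727722856586577963125858580310302599252714404522901925297264385654281164703726634073363638112$, $q_{11}=-105456673870095173711703163143669727224697814378273599459423442778596360012854640538260794921080$, $q_{12}=235607817095755199368858190149899878856163978515561431455451403131557914807361950016856603119900$, $q_{13}=-479770149264907609591636867066530148444729317862800608632937138608427032184610743855219428626708$, $q_{14}=895635623173061803600226851312211772312504932418933306086383616156548261949688014524531333153508$, $q_{15}=-1540472555790089754392061652689278932257505758853194366507839523329666453963515188071478275995640$, $q_{16}=2451788710586871745589664228861539890944914421283328064352160762645878635406460765371848464480340$, $q_{17}=-3624640505901638188009697337857954483473385109589930872949558184551987911180781360042790583083604$, $q_{18}=4994024072126951505126399098824620904652453895567294295762673834554854694248727868906577016537540$, $q_{19}=-6431721637672973764253559554028129752608859470080682240640404627541331731173957688036200659035092$, $q_{20}=7763241468623979545008124501105553771540039037756350364261700519310257100760280299151055542732492$, $q_{21}=-8802942880381499388245651070259273872571338870198906824716298766585276914830555824919832373777496$, $q_{22}=9397428905594516743427299464872348062738848222907978714295289389671821494398632421489330984834096$, $q_{23}=-9462921861838231504232648180683566209060687542850222756830572873896415321834823788805352470036944$, $q_{24}=9004042910145318452280462187844950546979429562212010153159452511976316511237893389182144564071816$, $q_{25}=-8108466777447973350625143866020889145905001781484033233303172750662906603502257635040763697120800$, $q_{26}=6920877993691644199503325490868076639226322468228894863452356759758353696538512384603684679212236$,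 $q_{27}=-5606393286650355050632445312392545648077485412935086399427015013222455115423342550668229228526380$, $q_{28}=4315552971543918712292689802749919612866096319783016002162626109826378082792279094813015908629560$, $q_{29}=-3160147292945573961625584424097717920370225757650282483390682408815821565443532117419343460827840$, $q_{30}=2203660581121260808668034624515265900353324373444058449372337614106044024846226145678411752103944$, $q_{31}=-1464744343303019546273900066171788739473025422537466727740192615776481945774661361874676553542888$, $q_{32}=928837747351900139847510911539219291666880836492600960301761612482212279686785348971171633827678$, $q_{33}=-562380987452023460657841067338702972535374341028182139165378619782789496619429231331416465467136$, $q_{34}=325356235824906304914262446976176796571764856456686279807557436317349277524804415206207943829668$, $q_{35}=-179980581397996318804833400684252642822685183748168637880480218232713417673333008007141832612656$, $q_{36}=95259358673342811962577374968024344116759528191118197330901994055953518185301961938058278687152$, $q_{37}=-48268244673830087725415910980532812904398769665363772047167723957702501678922709545345961314952$, $q_{38}=23427392442378901750354958702292727966207504749183723357421289869802194332649685331485983388676$, $q_{39}=-10897163294836081802023740205919221704582045121673085440709523835797116373484015837949721485760$, $q_{40}=4859945481426652393657932982123404648051819351769400595806382044197187788576701075955522665148$, $q_{41}=-2079041289572381880981851137517243250745330223456680067657643451728129396120093304826885539344$, $q_{42}=853451569340348395409517113261975739247889854460920295141494937564435136719739663763259170648$, $q_{43}=-336306101614439964957860525247000005857956841159545332435837005318322034194039653447757128580$, $q_{44}=127254544703467199806219784585607568957868365018715949880037719179469076397221511835490064520$, $q_{45}=-46251344543607872597100973940088670916183046876614132396624422211322670222925432802603348764$, $q_{46}=16151229449214495754070501316928248080301470592125995573153793317058666430416170267465079692$,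 $q_{47}=-5420296230053687740961180866132183229319212804267569609857245172190699563010303045911368944$, $q_{48}=1748523996015819207122503672053973801759807116329056619663716454198769892066785902652554878$, $q_{49}=-542294947655157376138526043814456732351589519118047194151659330168304308215153590486208844$, $q_{50}=161729358620880031971279266977475707554378016762290238000893567282554531020744559074376324$, $q_{51}=-46386918898623721747469881003020417214566850265053511450799223706659896381395790959743804$, $q_{52}=12797051499162896398440721779023796724984325295916014796039628931842465948343894845111380$, $q_{53}=-3396073129112728218339337536714697724329251745742194506364950008794369800942410905152136$, $q_{54}=867027209473064571745438316617176614625159965185956598478937806132721701397948869458900$, $q_{55}=-212962875904766156808053958032907333576950046165625774677667251904787655643757505176324$, $q_{56}=50327885532415893880483155785349071253807731172747773207451521031252671732632230388978$, $q_{57}=-11443438667187908543351570986876579176110747490338119245195350888150296055016975582004$, $q_{58}=2503504763126665005017589126659165629183801291281925243578712171462099771849619254744$, $q_{59}=-526958944944907268493639103677877316954184364418982668079438920193188411899643568508$, $q_{60}=106715051592438328930689239004654253545573721719451360040168657740453189940915192314$, $q_{61}=-20790779910335793865471457635357833163154112951516080880730395764735512013025652796$, $q_{62}=3896541990320087145594716450422460409978287599082283693485952309365925318005644500$, $q_{63}=-702441672053715648053554868151235620650214741238958432207947706491608211081312400$, $q_{64}=121790629393362604544357589123597436252606558743434815262003043923897464121167197$, $q_{65}=-20306355805901050837901846972656773418756565045468863673412540172210337271902340$, $q_{66}=3255350507442216588937835814600680908204323769283956961525023238451439544941760$, $q_{67}=-501690059905683053720524741882157670117822132733245580070161190249583644847028$,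 $q_{68}=74312275258414477271317122327593160444507387370961124773453087824921327894416$, $q_{69}=-10577404455255469741143362965021672227782124046356528509651977109935992639428$, $q_{70}=1446398328284711960698545660047973219044522333438207563556095761539846607256$, $q_{71}=-189965195590509120305163972290005629377791264599483176752468398233763249484$, $q_{72}=23956016062333717865546677021452562824319209365764369018142153751707952028$, $q_{73}=-2899855516264429489706362148867135560476890463566496024776316822467683664$, $q_{74}=336833599313788500559679181776716047210388540402180437654119288339393740$, $q_{75}=-37529836525283747105371855723169247756700129909528157240024250001998788$, $q_{76}=4009530152235809687640827672341358465891595297597478301291898189654876$, $q_{77}=-410569812715360439015853397370594547170545487427635936414500045030652$, $q_{78}=40277795973917435115762646297317343617205272567786230485171910510652$, $q_{79}=-3783768552039089682586618639655876942103322356223597420264279396724$, $q_{80}=340207987956327503878827250457263328265317830300159719894983206382$, $q_{81}=-29261155514270620208017844865051944340304021710386304703117145200$, $q_{82}=2406110405248787166244163214026562342878677865734412916133200336$, $q_{83}=-189038373443757680942334919469355568250711998730640952299841492$, $q_{84}=14181101939087673375192221173276978973988251595771099469911248$, $q_{85}=-1015059691711179211122508131842675818892409168967000131556504$, $q_{86}=69273982784497519473037155287005412956159996851830481504940$, $q_{87}=-4504005163576022050795556544568918073128228705604683414856$, $q_{88}=278744922765563512122592853176105123936966933933756780006$, $q_{89}=-16405810574710923918958669050194823065267996065080494420$, $q_{90}=917373448095043315139701983319126630369060417226308240$, $q_{91}=-48685180731396433963474339952113579549797184903456932$, $q_{92}=2449403736861952764502194313954481630464621913377362$, $q_{93}=-116683889096980060401747351223521809696783299718096$,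 $q_{94}=5256318681823135646376194757383743386905542401984$, $q_{95}=-223594517259941108513934941256272336603486583080$, $q_{96}=8967837569963007481063656618084357384523513289$, $q_{97}=-338566611781299224336234061335519673555729968$, $q_{98}=12010206026853145744238047620715510383030860$, $q_{99}=-399536336273091783248772485529679824619372$, $q_{100}=12437443190985072692004053616601920326304$, $q_{101}=-361454027338752388080364343617032962704$, $q_{102}=9781270532352502601151919455054150468$, $q_{103}=-245758896101673421544480044149574716$, $q_{104}=5714846913247894902773082359642858$, $q_{105}=-122552946275635592994659815458660$, $q_{106}=2413849634493902632445738578404$, $q_{107}=-43467840407415668458306853984$, $q_{108}=711884504814065975117065754$, $q_{109}=-10538669572997700747046736$, $q_{110}=140021126816597308605612$, $q_{111}=-1655565532193307303324$, $q_{112}=17242140511966984109$, $q_{113}=-156184748605164508$, $q_{114}=1211012431626440$, $q_{115}=-7871527038772$, $q_{116}=41688975082$, $q_{117}=-172657460$, $q_{118}=524076$, $q_{119}=-1036$, $q_{120}=1$. *)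

(* Defs.v *)
From HB Require Import structures.
From Stdlib Require Import ZArith.
From mathcomp Require Import all_boot all_order all_algebra all_fingroup.
From mathcomp Require Import all_solvable all_field.
From mathcomp Require Import ring lra zify ssrZ.

Set Implicit Arguments.
Unset Strict Implicit.
Unset Printing Implicit Defensive.

Import Order.TTheory GRing.Theory Num.Theory.
Local Open Scope ring_scope.

(* Entered in binary [Z], because literals of type [int] expand to unary
   naturals. *)
Local Open Scope Z_scope.

Definition Q_coefs : seq Z := [::
   365587894983967922854560421106658794835269162025801581455381270108994772086354097689969;
   -11188764671313743052104852260462353867603756780241598167388311775144605678410262867332448;
   169253696238399029559192135798369681596869020592118579039666548219126339368278708130365896;
   -1687159920262524494571824891028833720039695470637056956223462293372163529290126431304585100;
   12466538870569350428117512482674638738192598391028225510113876433671029848121166234252784168;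
   -72826947156697363455035723423426971890324922381314772703337692580409097282009564861222315768;
   350331529672673601609711561533019721386090515420775351136161318553244630344247566318282845504;
   -1427238565615616836874966027280849892931467391947083350631098008579547451949365512165445324548;
   5026354438587350042393019188859322619309223067912455590765316222074769006654715395492167534064;
   -15543242692747890030945651958468728793028138424448388052344884541152421476286890160281606087912;
   42727722856586577963125858580310302599252714404522901925297264385654281164703726634073363638112;
   -105456673870095173711703163143669727224697814378273599459423442778596360012854640538260794921080;
   235607817095755199368858190149899878856163978515561431455451403131557914807361950016856603119900;
   -479770149264907609591636867066530148444729317862800608632937138608427032184610743855219428626708;
   895635623173061803600226851312211772312504932418933306086383616156548261949688014524531333153508;
   -1540472555790089754392061652689278932257505758853194366507839523329666453963515188071478275995640;
   2451788710586871745589664228861539890944914421283328064352160762645878635406460765371848464480340;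
   -3624640505901638188009697337857954483473385109589930872949558184551987911180781360042790583083604;
   4994024072126951505126399098824620904652453895567294295762673834554854694248727868906577016537540;
   -6431721637672973764253559554028129752608859470080682240640404627541331731173957688036200659035092;
   7763241468623979545008124501105553771540039037756350364261700519310257100760280299151055542732492;
   -8802942880381499388245651070259273872571338870198906824716298766585276914830555824919832373777496;
   9397428905594516743427299464872348062738848222907978714295289389671821494398632421489330984834096;
   -9462921861838231504232648180683566209060687542850222756830572873896415321834823788805352470036944;
   9004042910145318452280462187844950546979429562212010153159452511976316511237893389182144564071816;
   -8108466777447973350625143866020889145905001781484033233303172750662906603502257635040763697120800;
   6920877993691644199503325490868076639226322468228894863452356759758353696538512384603684679212236;
   -5606393286650355050632445312392545648077485412935086399427015013222455115423342550668229228526380;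
   4315552971543918712292689802749919612866096319783016002162626109826378082792279094813015908629560;
   -3160147292945573961625584424097717920370225757650282483390682408815821565443532117419343460827840;
   2203660581121260808668034624515265900353324373444058449372337614106044024846226145678411752103944;
   -1464744343303019546273900066171788739473025422537466727740192615776481945774661361874676553542888;
   928837747351900139847510911539219291666880836492600960301761612482212279686785348971171633827678;
   -562380987452023460657841067338702972535374341028182139165378619782789496619429231331416465467136;
   325356235824906304914262446976176796571764856456686279807557436317349277524804415206207943829668;
   -179980581397996318804833400684252642822685183748168637880480218232713417673333008007141832612656;
   95259358673342811962577374968024344116759528191118197330901994055953518185301961938058278687152;
   -48268244673830087725415910980532812904398769665363772047167723957702501678922709545345961314952;
   23427392442378901750354958702292727966207504749183723357421289869802194332649685331485983388676;
   -10897163294836081802023740205919221704582045121673085440709523835797116373484015837949721485760;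
   4859945481426652393657932982123404648051819351769400595806382044197187788576701075955522665148;
   -2079041289572381880981851137517243250745330223456680067657643451728129396120093304826885539344;
   853451569340348395409517113261975739247889854460920295141494937564435136719739663763259170648;
   -336306101614439964957860525247000005857956841159545332435837005318322034194039653447757128580;
   127254544703467199806219784585607568957868365018715949880037719179469076397221511835490064520;
   -46251344543607872597100973940088670916183046876614132396624422211322670222925432802603348764;
   16151229449214495754070501316928248080301470592125995573153793317058666430416170267465079692;
   -5420296230053687740961180866132183229319212804267569609857245172190699563010303045911368944;
   1748523996015819207122503672053973801759807116329056619663716454198769892066785902652554878;
   -542294947655157376138526043814456732351589519118047194151659330168304308215153590486208844;
   161729358620880031971279266977475707554378016762290238000893567282554531020744559074376324;
   -46386918898623721747469881003020417214566850265053511450799223706659896381395790959743804;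
   12797051499162896398440721779023796724984325295916014796039628931842465948343894845111380;
   -3396073129112728218339337536714697724329251745742194506364950008794369800942410905152136;
   867027209473064571745438316617176614625159965185956598478937806132721701397948869458900;
   -212962875904766156808053958032907333576950046165625774677667251904787655643757505176324;
   50327885532415893880483155785349071253807731172747773207451521031252671732632230388978;
   -11443438667187908543351570986876579176110747490338119245195350888150296055016975582004;
   2503504763126665005017589126659165629183801291281925243578712171462099771849619254744;
   -526958944944907268493639103677877316954184364418982668079438920193188411899643568508;
   106715051592438328930689239004654253545573721719451360040168657740453189940915192314;
   -20790779910335793865471457635357833163154112951516080880730395764735512013025652796;
   3896541990320087145594716450422460409978287599082283693485952309365925318005644500;
   -702441672053715648053554868151235620650214741238958432207947706491608211081312400;
   121790629393362604544357589123597436252606558743434815262003043923897464121167197;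
   -20306355805901050837901846972656773418756565045468863673412540172210337271902340;
   3255350507442216588937835814600680908204323769283956961525023238451439544941760;
   -501690059905683053720524741882157670117822132733245580070161190249583644847028;
   74312275258414477271317122327593160444507387370961124773453087824921327894416;
   -10577404455255469741143362965021672227782124046356528509651977109935992639428;
   1446398328284711960698545660047973219044522333438207563556095761539846607256;
   -189965195590509120305163972290005629377791264599483176752468398233763249484;
   23956016062333717865546677021452562824319209365764369018142153751707952028;
   -2899855516264429489706362148867135560476890463566496024776316822467683664;
   336833599313788500559679181776716047210388540402180437654119288339393740;
   -37529836525283747105371855723169247756700129909528157240024250001998788;
   4009530152235809687640827672341358465891595297597478301291898189654876;
   -410569812715360439015853397370594547170545487427635936414500045030652;
   40277795973917435115762646297317343617205272567786230485171910510652;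
   -3783768552039089682586618639655876942103322356223597420264279396724;
   340207987956327503878827250457263328265317830300159719894983206382;
   -29261155514270620208017844865051944340304021710386304703117145200;
   2406110405248787166244163214026562342878677865734412916133200336;
   -189038373443757680942334919469355568250711998730640952299841492;
   14181101939087673375192221173276978973988251595771099469911248;
   -1015059691711179211122508131842675818892409168967000131556504;
   69273982784497519473037155287005412956159996851830481504940;
   -4504005163576022050795556544568918073128228705604683414856;
   278744922765563512122592853176105123936966933933756780006;
   -16405810574710923918958669050194823065267996065080494420;
   917373448095043315139701983319126630369060417226308240;
   -48685180731396433963474339952113579549797184903456932;
   2449403736861952764502194313954481630464621913377362;
   -116683889096980060401747351223521809696783299718096;
   5256318681823135646376194757383743386905542401984;
   -223594517259941108513934941256272336603486583080;
   8967837569963007481063656618084357384523513289;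
   -338566611781299224336234061335519673555729968;
   12010206026853145744238047620715510383030860;
   -399536336273091783248772485529679824619372;
   12437443190985072692004053616601920326304;
   -361454027338752388080364343617032962704;
   9781270532352502601151919455054150468;
   -245758896101673421544480044149574716;
   5714846913247894902773082359642858;
   -122552946275635592994659815458660;
   2413849634493902632445738578404;
   -43467840407415668458306853984;
   711884504814065975117065754;
   -10538669572997700747046736;
   140021126816597308605612;
   -1655565532193307303324;
   17242140511966984109;
   -156184748605164508;
   1211012431626440;
   -7871527038772;
   41688975082;
   -172657460;
   524076;
   -1036;
   1
].

Local Close Scope Z_scope.

Definition coefQ (i : nat) : int := int_of_Z (nth Z0 Q_coefs i).

Definition E8polyQ : {poly int} := \poly_(i < 121) coefQ i.

(* T^120 Q(T + T^-1), with denominators cleared term by term: see [E8polyP_def]. *)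
Definition E8polyP : {poly int} :=
  \sum_(i < 121) coefQ i *: ('X^(120 - i) * ('X^2 + 1) ^+ i).

Lemma size_E8polyQ : size E8polyQ = 121.
Proof. by rewrite /E8polyQ size_poly_eq. Qed.

Lemma monic_E8polyQ : E8polyQ \is monic.
Proof. by rewrite monicE lead_coefE size_E8polyQ coef_poly. Qed.

(* The identity P(T) = T^120 Q(T + T^-1), in the field of fractions of Z[T]. *)
Lemma E8polyP_def (T := tofrac ('X : {poly int})) :
  tofrac E8polyP =
    T ^+ 120 * (map_poly (@tofrac {poly int} \o polyC) E8polyQ).[T + T^-1].
Proof.
have T0 : T != 0 by rewrite tofrac_eq0 polyX_eq0.
rewrite /E8polyP /E8polyQ poly_def !raddf_sum /= horner_sum.
rewrite mulr_sumr; apply: eq_bigr => i _ /=.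
rewrite -!mul_polyC !rmorphM /= ?rmorphM /= map_polyC /= map_polyXn hornerCM hornerXn.
rewrite !rmorphXn rmorphD rmorph1 rmorphXn /= -/T.
have -> : T ^+ 2 + 1 = T * (T + T^-1) by rewrite mulrDr divff // expr2.
rewrite exprMn (mulrA (T ^+ _) (T ^+ i)) -exprD subnK; last by rewrite -ltnS.
by rewrite mulrCA.
Qed.

Lemma E8polyP_lead : size E8polyP = 241 /\ E8polyP \is monic.
Proof.
have mX : ('X^2 + 1 : {poly int}) \is monic.
  by rewrite monicE lead_coefDl ?lead_coefXn // size_polyXn size_poly1.
have sX : size ('X^2 + 1 : {poly int}) = 3.
  by rewrite size_polyDl size_polyXn // size_poly1.
have sXn i : size (('X^2 + 1 : {poly int}) ^+ i) = (2 * i)%N.+1.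
  rewrite -(prednK (n := size _)) ?size_exp ?sX //.
  by rewrite lt0n size_poly_eq0 monic_neq0 // monic_exp.
rewrite /E8polyP big_ord_recr /= subnn mul1r.
have -> : coefQ 120 = 1 by [].
rewrite scale1r addrC.
have sr : (size (\sum_(i < 120) coefQ i *: ('X^(120 - i) * ('X^2 + 1) ^+ i))%R
            < size (('X^2 + 1 : {poly int}) ^+ 120)%R)%N.
  rewrite sXn; apply: leq_ltn_trans (size_sum _ _ _) _.
  rewrite ltnS; apply/bigmax_leqP => i _.
  apply: leq_trans (size_scale_leq _ _) _.
  rewrite mulrC size_mulXn ?sXn; last by rewrite monic_neq0 // monic_exp.
  by have := ltn_ord i; lia.
split; first by rewrite size_polyDl // sXn.
by rewrite monicE lead_coefDl // -monicE monic_exp.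
Qed.

Definition dotv (u v : 'rV[rat]_8) : rat := \sum_i u 0 i * v 0 i.

(* The E8 lattice in standard coordinates: the coordinates are all in Z or all
   in Z + 1/2, and their sum is even. *)
Definition E8_lattice : pred 'rV[rat]_8 := fun v =>
  ([forall i, v 0 i \is a Num.int] || [forall i, v 0 i - 2^-1 \is a Num.int])
  && ((\sum_i v 0 i) / 2 \is a Num.int).

Definition is_E8_root (v : 'rV[rat]_8) := E8_lattice v && (dotv v v == 2).

(* Coordinates of roots lie in {-1, -1/2, 0, 1/2, 1}, so the roots can be listed
   by filtering a finite set; [mem_E8_roots] shows that none is lost. *)
Definition E8_roots : seq 'rV[rat]_8 :=
  [seq v <- [seq \row_i (((c : {ffun 'I_8 -> 'I_5}) i)%:R / 2 - 1)
            | c : {ffun 'I_8 -> 'I_5}] | is_E8_root v].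

Lemma E8_latticeP (v : 'rV[rat]_8) :
  reflect ((exists2 e : rat, e = 0 \/ e = 2^-1 & forall i, v 0 i - e \is a Num.int)
           /\ (\sum_i v 0 i) / 2 \is a Num.int) (E8_lattice v).
Proof.
apply: (iffP andP) => -[h ?]; split=> //.
  case/orP: h => /forallP h; last by exists 2^-1; [right | ].
  by exists 0; [left | move=> i; rewrite subr0].
case: h => e [] -> h; apply/orP; [left | right]; apply/forallP => i //.
by rewrite -[v 0 i]subr0.
Qed.

Lemma half_int (e : rat) : 2 * e \is a Num.int ->
  exists2 f : rat, f = 0 \/ f = 2^-1 & e - f \is a Num.int.
Proof.
case/intrP => z ez.
have [k [b zk]] : exists k : int, exists b : bool, z = 2 * k + b%:Z.
  by exists (z %/ 2)%Z, ((z %% 2)%Z == 1); lia.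
have {}ez : e = k%:~R + b%:R / 2.
  have -> : e = (2 * e) / 2 by field.
  by rewrite ez zk rmorphD rmorphM /= natz; field.
exists (b%:R / 2).
  by case: (b); [right; rewrite mul1r | left; rewrite mul0r].
by rewrite ez addrK intr_int.
Qed.

Lemma dotvBl u v w : dotv (u - v) w = dotv u w - dotv v w.
Proof. by rewrite /dotv -sumrB; apply: eq_bigr => i _; rewrite !mxE mulrBl. Qed.

Lemma dotvZl k v w : dotv (k *: v) w = k * dotv v w.
Proof. by rewrite /dotv mulr_sumr; apply: eq_bigr => i _; rewrite !mxE mulrA. Qed.

Lemma dotvC u v : dotv u v = dotv v u.
Proof. by apply: eq_bigr => i _; rewrite mulrC. Qed.

Lemma dotv_int u v : E8_lattice u -> E8_lattice v -> dotv u v \is a Num.int.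
Proof.
case/E8_latticeP => [[a a2 ua] su] /E8_latticeP[[b b2 vb] sv].
have hs (c s : rat) : c = 0 \/ c = 2^-1 -> s / 2 \is a Num.int -> c * s \is a Num.int.
  by case=> ->; rewrite ?mul0r ?rpred0 // mulrC.
have -> : dotv u v = \sum_i (u 0 i - a) * (v 0 i - b) + a * (\sum_i v 0 i)
                    + b * (\sum_i u 0 i) - a * b * 8.
  rewrite !mulr_sumr.
  have -> : a * b * 8 = \sum_(i < 8) a * b by rewrite sumr_const card_ord mulr_natr.
  rewrite -!big_split -sumrB; apply: eq_bigr => i _ /=; ring.
apply: rpredB.
  apply: rpredD; last exact: hs.
  apply: rpredD; last exact: hs.
  by apply: rpred_sum => i _; apply: rpredM.
case: a2 b2 => -> [] ->; rewrite ?mulr0 ?mul0r ?rpred0 //.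
Qed.

Lemma reflection_lattice u v (k : rat) : k \is a Num.int ->
  E8_lattice u -> E8_lattice v -> E8_lattice (u - k *: v).
Proof.
move=> kZ /E8_latticeP[[a a2 ua] su] /E8_latticeP[[b b2 vb] sv].
apply/E8_latticeP; split; last first.
  have -> : (\sum_i (u - k *: v) 0 i) / 2 = (\sum_i u 0 i) / 2 - k * ((\sum_i v 0 i) / 2).
    rewrite mulrA mulr_sumr -mulrBl -sumrB; congr (_ / _).
    by apply: eq_bigr => i _; rewrite !mxE.
  by rewrite rpredB // rpredM.
have h2 (c : rat) : c = 0 \/ c = 2^-1 -> 2 * c \is a Num.int.
  by case=> ->; rewrite ?mulr0 ?rpred0 // divff // rpred1.
have [f f2 fZ] : exists2 f : rat, f = 0 \/ f = 2^-1 & (a - k * b) - f \is a Num.int.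
  apply: half_int; rewrite mulrBr mulrCA rpredB ?h2 // rpredM ?h2 //.
exists f => // i; rewrite !mxE.
have -> : u 0 i - k * v 0 i - f = (u 0 i - a) - k * (v 0 i - b) + ((a - k * b) - f) by ring.
by rewrite rpredD // rpredB // rpredM.
Qed.

Lemma reflection_root a b : is_E8_root a -> is_E8_root b ->
  is_E8_root (b - dotv a b *: a).
Proof.
case/andP=> La /eqP na /andP[Lb /eqP nb].
rewrite /is_E8_root reflection_lattice ?dotv_int //=; apply/eqP.
rewrite dotvBl dotvZl ![dotv _ (b - _)]dotvC !dotvBl !dotvZl na nb (dotvC b a); ring.
Qed.

Lemma mem_E8_roots v : (v \in E8_roots) = is_E8_root v.
Proof.
rewrite mem_filter andb_idr // => /andP[/E8_latticeP[[e e2 ve] _] /eqP nv].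
have vz i : 2 * v 0 i \is a Num.int.
  have -> : 2 * v 0 i = 2 * (v 0 i - e) + 2 * e by ring.
  apply: rpredD; first exact: rpredM.
  by case: e2 => ->; rewrite ?mulr0 ?rpred0 // divff // rpred1.
have vle i : (2 * v 0 i) ^+ 2 <= 8.
  suff : v 0 i ^+ 2 <= 2 by move=> h; rewrite exprMn; lra.
  rewrite -nv /dotv (bigD1 i) //= -expr2 lerDl sumr_ge0 // => j _.
  by rewrite -expr2 sqr_ge0.
pose z i := Num.floor (2 * v 0 i).
have zE i : (z i)%:~R = 2 * v 0 i by apply/eqP; rewrite -intrEfloor.
have zb i : -2 <= z i <= 2.
  by move: (vle i); rewrite -zE -rmorphXn /= (ler_int _ _ 8) expr2 => h; nia.
apply/imageP; exists [ffun i => inord (absz (z i + 2)%R)] => //.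
apply/rowP => i; rewrite !mxE ffunE inordK; last by move: (zb i); lia.
have -> : (absz (z i + 2)%R)%:R = 2 * v 0 i + 2 :> rat.
  rewrite -zE -[RHS](rmorphD _ (z i) 2) /= -[LHS]/((Posz _)%:~R).
  by congr (_%:~R); move: (zb i); lia.
by field.
Qed.

Definition E8_root : finType := seq_sub E8_roots.

Lemma E8_rootP (a : E8_root) : is_E8_root (val a).
Proof. rewrite -mem_E8_roots; exact: ssvalP. Qed.

(* Since (a,a) = 2, the reflection b - 2 (a,b)/(a,a) a is b - (a,b) a. *)
Lemma reflect_subproof (a b : E8_root) :
  val b - dotv (val a) (val b) *: val a \in E8_roots.
Proof. by rewrite mem_E8_roots reflection_root ?E8_rootP. Qed.

Definition reflect_root (a b : E8_root) : E8_root :=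
  SeqSub (reflect_subproof a b).

Lemma reflect_root_inj a : injective (reflect_root a).
Proof.
apply: (can_inj (g := reflect_root a)) => b; apply: val_inj => /=.
have /andP[_ /eqP na] := E8_rootP a.
rewrite (dotvC _ (_ - _)) dotvBl dotvZl na (dotvC _ (val a)).
rewrite -addrA -opprD -scalerDl; set x := dotv _ _.
have -> : x + (x - x * 2) = 0 by ring.
by rewrite scale0r subr0.
Qed.

Definition reflection (a : E8_root) : {perm E8_root} := perm (@reflect_root_inj a).

(* The Weyl group acts faithfully on the roots, which span Q^8, so it is taken as
   the group of permutations of the roots generated by all the reflections. *)
Definition WE8 : {group {perm E8_root}} :=
  <<[set reflection a | a : E8_root]>>%G.

(* Main.v *)
(** The E8 root lattice enters through a labelling of the 240 roots of P by the roots
    of E8 such that z_a z_b = z_c forces a + b = c, and z_a z_b = z_(a+b) whenever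
    a + b is a root. Elements of the Galois group then act as isometries of the root
    system, and these all lie in W(E8).

    Modulo p1 = 27813337 the roots of P are explicit elements of the field with p1^2
    elements, which gives the labels and the first implication; the Frobenius element
    there is minus a reflection. The factorizations of Q modulo 7, 11 and 37 make the
    group transitive on the 120 pairs {a, -a}, so it contains all the elements -s_b;
    since -1 is a product of eight reflections, it contains every reflection.

    For the second implication, an explicit automorphism m of the Lie algebra of type
    E8 satisfies Q(m + m^-1) v = 0 for some v, so every root of P is an eigenvalue of
    m. Brackets of eigenvectors are eigenvectors, and one of them is nonzero modulo
    61: hence one relation z z' = z'' holds. The graph on the 120 pairs formed by such
    relations is Galois invariant, so regular of some degree at most 56, and the
    factorizations modulo 37 and 47 restrict this degree to 56. *)

Require Import Defs.
From HB Require Import structures.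
From Stdlib Require Import ZArith Classical FunctionalExtensionality.
From mathcomp Require Import all_boot all_order all_algebra all_fingroup.
From mathcomp Require Import all_solvable all_field.
From mathcomp Require Import mpoly ring lra zify ssrZ.

Set Implicit Arguments.
Unset Strict Implicit.
Unset Printing Implicit Defensive.

Import Order.TTheory GRing.Theory Num.Theory.
Local Open Scope ring_scope.

(** * Places and Frobenius elements *)

Section Specialization.
Variables (n : nat).
Local Notation A := {mpoly int[n]}.
Local Notation At := {mpoly {poly int}[n]}.

(** Relations between the roots of P pass from characteristic 0 to characteristic p, never back. So
    the place at p1 can only show that z_a z_b = z_c forces a + b = c; the converse has to be built
    in characteristic 0. There the Lie algebra supplies a quantity that is nonzero modulo 61, and
    being nonzero does lift. The characteristic polynomial of m is not computed: the eigenvectors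
    are polynomials in m and m^-1 applied to v, and the invariant form shows that the eigenvalue of
    a bracket is a root of P once the bracket pairs nontrivially with v. A place is not a prime
    ideal here, but a numbering of the roots modulo p under which every integral polynomial relation
    between the roots survives. Reduction may identify roots, so Frobenius elements permute indices,
    not residues. At p1 the Frobenius element is an involution, which is why the quadratic extension
    of the prime field contains all the roots. *)

Definition evz (R : comNzRingType) (w : 'I_n -> R) : A -> R := mmap intr w.
HB.instance Definition _ (R : comNzRingType) (w : 'I_n -> R) :=
  GRing.RMorphism.on (evz w).

Lemma evzX (R : comNzRingType) (w : 'I_n -> R) i : evz w 'X_i = w i.
Proof. by rewrite /evz mmapX mmap1U. Qed.

Definition evt (R : comNzRingType) (w : 'I_n -> R) : At -> {poly R} :=
  mmap (map_poly intr) (fun i => (w i)%:P).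
HB.instance Definition _ (R : comNzRingType) (w : 'I_n -> R) :=
  GRing.RMorphism.on (evt w).

Lemma evt_perm (R : comNzRingType) (w : 'I_n -> R) (s : 'S_n) (h : At) :
  evt w (msym s h) = evt (w \o s) h.
Proof.
rewrite /msym /mmap rmorph_sum; apply: eq_bigr => m _.
rewrite rmorphM /= /evt mmapC /=; congr (_ * _).
rewrite /mmap1 rmorph_prod; apply: eq_bigr => i _.
by rewrite rmorphXn /= mmapX mmap1U.
Qed.

Lemma evt_lift (R : comNzRingType) (w : 'I_n -> R) (k : nat) (h : A) :
  evt w (('X^k)%:MP * map_mpoly polyC h) = 'X^k * (evz w h)%:P.
Proof.
rewrite rmorphM /= /evt mmapC /= map_polyXn; congr (_ * _).
rewrite {1}(mpolyE h) (raddf_sum (map_mpoly polyC)) (raddf_sum (evt w)) /= /evz /mmap rmorph_sum.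
apply: eq_bigr => m _; rewrite map_mpolyZ map_mpolyX /evt mmapZ mmapX /= map_polyC /=.
rewrite rmorphM /mmap1 rmorph_prod; congr (_ * _).
by apply: eq_bigr => i _; rewrite rmorphXn.
Qed.

Lemma evt_mesym (R : idomainType) (w : 'I_n -> R) (P : {poly int}) (k : 'I_n.+1) :
  map_poly intr P = \prod_i ('X - (w i)%:P) ->
  evt w (mesym n {poly int} k) = ((-1) ^+ k * P`_(n - k))%:~R%:P.
Proof.
move=> PE; pose ws := [tuple w i | i < n].
have wE : tnth ws =1 w by move=> i; rewrite tnth_mktuple.
have := mroots_coeff ws k.
have -> : \prod_(c <- ws) ('X - c%:P) = map_poly intr P.
  by rewrite big_tuple PE; apply: eq_bigr => i _; rewrite wE.
rewrite coef_map /= => /(congr1 (fun x => (-1) ^+ k * x)).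
rewrite mulrA -exprMn mulrNN mulr1 expr1n mul1r.
rewrite rmorphM rmorphXn /= rmorphN rmorph1 => ->.
rewrite !mesymE raddf_sum /= (raddf_sum (meval (tnth ws))) raddf_sum /=.
apply: eq_bigr => h _.
rewrite [in RHS]/meval mmapX /evt mmapX /mmap1 rmorph_prod /=.
by apply: eq_bigr => i _; rewrite rmorphXn /= wE.
Qed.

(** Elementary symmetric polynomials become coefficients of P up to sign, so the value is the image
    of one integer polynomial in one variable, the same for every field and every numbering of the
    roots. *)
Lemma evt_symmetric (R : idomainType) (w : 'I_n -> R) (P : {poly int}) (t : At) :
  map_poly intr P = \prod_i ('X - (w i)%:P) ->
  evt w (comp_mpoly [tuple mesym n {poly int} k.+1 | k < n] t)
  = map_poly intr (meval (fun k : 'I_n => ((-1) ^+ k.+1 * P`_(n - k.+1))%:P) t).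
Proof.
move=> PE; rewrite /comp_mpoly /meval /mmap !rmorph_sum; apply: eq_bigr => m _.
rewrite !rmorphM /= /evt mmapC; congr (_ * _).
rewrite /mmap1 !rmorph_prod; apply: eq_bigr => i _.
rewrite !rmorphXn /= tnth_mktuple map_polyC; congr (_ ^+ _).
exact: (evt_mesym (lift ord0 i) PE).
Qed.

(* If no labelling s works, pick for each s a relation h_s that it violates and let
   H be the sum of the h_s t^(rank s). The product of all permutations of H is
   symmetric, so its values at z and at zb are images of one integer polynomial in t.
   It vanishes at z and not at zb. *)
Lemma specialization_exists (L F : fieldType) (P : {poly int})
    (z : 'I_n -> L) (zb : 'I_n -> F) :
  injective (intr : int -> L) ->
  map_poly intr P = \prod_i ('X - (z i)%:P) ->
  map_poly intr P = \prod_i ('X - (zb i)%:P) ->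
  exists s : 'S_n, forall h : A, evz z h = 0 -> evz (zb \o s) h = 0.
Proof.
move=> injZ Pz Pzb; apply: NNPP => noS.
have /fin_all_exists[h hP] (s : 'S_n) :
    exists h : A, evz z h = 0 /\ evz (zb \o s) h <> 0.
  apply: NNPP => noh; apply: noS; exists s => h hz.
  by apply: NNPP => hn; apply: noh; exists h.
pose H : At := \sum_s ('X^(enum_rank s))%:MP * map_mpoly polyC (h s).
have HE (R : comNzRingType) (w : 'I_n -> R) :
    evt w H = \sum_s 'X^(enum_rank s) * (evz w (h s))%:P.
  by rewrite rmorph_sum; apply: eq_bigr => s _; rewrite -evt_lift.
pose N : At := \prod_s msym s H.
have /sym_fundamental[t [tN _]] : N \is symmetric.
  apply/issymP => s; rewrite rmorph_prod /= [RHS](reindex_inj (mulIg s)) /=.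
  by apply: eq_bigr => s' _; rewrite msymMm.
have NE (R : comNzRingType) (w : 'I_n -> R) :
    evt w N = \prod_s evt (w \o (s : 'S_n)) H.
  by rewrite rmorph_prod; apply: eq_bigr => s _; rewrite -evt_perm.
have N0 : evt z N = 0.
  rewrite NE (bigD1 1%g) //= -evt_perm msym1m HE big1 ?mul0r // => s _.
  by rewrite (hP s).1 mulr0.
have : evt zb N != 0.
  rewrite NE prodf_seq_neq0; apply/allP => s _ /=.
  (* The coefficient at [enum_rank s] isolates the value of [h s] at [zb \o s], which is nonzero by
     choice. *)
  apply/negP => /eqP /(congr1 (fun p : {poly F} => p`_(enum_rank s))).
  rewrite HE coef0 coef_sum (bigD1 s) //= coefXnM ltnn subnn coefC /=.
  rewrite big1 ?addr0; first exact: (hP s).2.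
  move=> s' ns; rewrite coefXnM coefC.
  case: ltnP => // le; rewrite subn_eq0 leqNgt ltn_neqAle le.
  rewrite andbT; case: eqP => //= /ord_inj /enum_rank_inj e.
  by rewrite e eqxx in ns.
move: N0; rewrite -tN (evt_symmetric _ Pz) (evt_symmetric _ Pzb).
(* Since Z embeds in L, the integer polynomial itself vanishes, hence so does its image over F. *)
move=> N0; have -> : meval (fun k : 'I_n => ((-1) ^+ k.+1 * P`_(n - k.+1))%:P) t = 0.
  by apply: (map_inj_poly injZ) => //; rewrite N0 rmorph0.
by rewrite rmorph0 eqxx.
Qed.

End Specialization.

Lemma rat_splitting_galois (L : splittingFieldType rat) : galois 1 {:L}.
Proof.
apply/and3P; split; [exact: sub1v | | exact: normalFieldf].
apply/separableP => y _; apply: pcharf0_separable.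
move=> q; rewrite (pchar_lalg L) [RHS]inE; apply/negbTE/negP.
by case/andP=> /prime_gt0; case: q => // q _; rewrite Num.Theory.pnatr_eq0.
Qed.

Section Frobenius.
Variables (L : splittingFieldType rat) (F : fieldType) (p n : nat).
Hypothesis charF : p \in [pchar F].
Variables (P : {poly int}) (z : 'I_n -> L) (zb : 'I_n -> F).
Hypothesis Pz : map_poly intr P = \prod_i ('X - (z i)%:P).
Hypothesis zzb : forall h, evz z h = 0 -> evz zb h = 0.

Lemma gal_root (s : gal_of {:L}) i : s \in 'Gal({:L} / 1)%g ->
  exists j, s (z i) = z j.
Proof.
move=> sG; have : root (map_poly intr P) (s (z i)).
  have -> : map_poly intr P = map_poly s (map_poly intr P).
    by rewrite -map_poly_comp; apply: eq_map_poly => x /=; rewrite rmorph_int.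
  by apply: rmorph_root; rewrite Pz /root horner_prod (bigD1 i) //= hornerXsubC subrr mul0r.
rewrite Pz /root horner_prod prodf_seq_eq0 => /hasP[j _ /=].
by rewrite hornerXsubC subr_eq0 => /eqP; exists j.
Qed.

(** The value at z is a rational number a / b in lowest terms. The relation b c = a is integral, so
    it survives in F; p cannot divide b, since it would then divide a as well; hence the value at
    [zb] lies in the prime field. *)
Lemma rational_value (c : {mpoly int[n]}) :
  (forall s, s \in 'Gal({:L} / 1)%g -> s (evz z c) = evz z c) ->
  evz zb c ^+ p = evz zb c.
Proof.
move=> cfix.
have : evz z c \in fixedField 'Gal({:L} / 1)%g.
  by apply/fixedFieldP; rewrite ?memvf.
have /galois_fixedField -> := rat_splitting_galois L; case/vlineP=> k kE.
have dL : (denq k)%:~R * evz z c = (numq k)%:~R.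
  rewrite kE -!(rmorph_int (in_alg L)) /= -scalerAl mul1r scalerA.
  by rewrite -[X in _ * X](divq_num_den k) mulrCA divff ?mulr1 // intr_eq0 denq_eq0.
have /eqP : evz zb ((denq k)%:~R * c - (numq k)%:~R) = 0.
  by apply: zzb; rewrite rmorphB rmorphM !rmorph_int dL subrr.
rewrite rmorphB rmorphM !rmorph_int subr_eq0 => /eqP dF.
have intp (m : int) : (m%:~R : F) ^+ p = m%:~R.
  by rewrite -(pFrobenius_autE charF) rmorph_int.
have intF (m : int) : ((m%:~R : F) == 0) = (p %| `|m|)%N.
  rewrite (dvdn_pcharf charF); case: m => m //=.
  by rewrite NegzE rmorphN oppr_eq0.
have d0 : ((denq k)%:~R : F) != 0.
  apply/negP => d0; move: (dF); rewrite (eqP d0) mul0r => /esym/eqP.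
  move: d0; rewrite !intF => pd pn.
  have := coprime_num_den k; rewrite /coprime => /eqP g1.
  have : (p %| gcdn `|numq k| `|denq k|)%N by rewrite dvdn_gcd pn pd.
  rewrite g1 dvdn1 => /eqP p1; have := pcharf_prime charF; by rewrite p1.
apply: (mulfI d0); rewrite -{1}(intp (denq k)) -exprMn dF; exact: intp.
Qed.

(* The product over the Galois group of X - sum_i s(z_i) t^i has rational
   coefficients, so its reduction is fixed by the Frobenius map of F; the linear
   factors of both sides then correspond. *)
Lemma frobenius_lift : exists2 s : gal_of {:L}, s \in 'Gal({:L} / 1)%g &
  forall i j, s (z i) = z j -> zb i ^+ p = zb j.
Proof.
pose G := 'Gal({:L} / 1)%g.
have /fin_all_exists2[r _ rP] (si : gal_of {:L} * 'I_n) :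
    exists2 j, true & si.1 \in G -> si.1 (z si.2) = z j.
  case: (boolP (si.1 \in G)) => [sG | _]; last by exists si.2.
  by have [j ?] := gal_root si.2 sG; exists j.
have zE i j : z i = z j -> zb i = zb j.
  move=> ij; apply/eqP; rewrite -subr_eq0 -!(evzX zb) -rmorphB; apply/eqP.
  by apply: zzb; rewrite rmorphB /= !evzX ij subrr.
(* One polynomial packs the whole tuple of conjugates under s, so that a match of linear factors is
   a match at all indices at once. *)
pose a s : {poly {mpoly int[n]}} := \sum_(i < n) 'X^i * ('X_(r (s, i)))%:P.
pose T : {poly {poly {mpoly int[n]}}} := \prod_(s in G) ('X - (a s)%:P).
have TE (R : comNzRingType) (w : {rmorphism {mpoly int[n]} -> R}) :
    map_poly (map_poly w) T
    = \prod_(s in G) ('X - (\sum_(i < n) 'X^i * (w 'X_(r (s, i)))%:P)%:P).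
  rewrite rmorph_prod; apply: eq_bigr => s _.
  rewrite rmorphB /= map_polyX map_polyC /= rmorph_sum; congr ('X - _%:P).
  by apply: eq_bigr => i _; rewrite rmorphM /= map_polyXn map_polyC.
have Tfix i j : evz zb T`_i`_j ^+ p = evz zb T`_i`_j.
  apply: rational_value => t tG.
  suff E : map_poly (map_poly (t \o evz z)) T = map_poly (map_poly (evz z)) T.
    have := congr1 (fun q : {poly {poly L}} => q`_i`_j) E.
    by rewrite !coef_map.
  rewrite !TE [RHS](reindex_inj (mulIg t)) /=.
  apply: eq_big => [s | s sG]; first by rewrite groupMr.
  congr ('X - _%:P); apply: eq_bigr => i' _; congr ('X^_ * _%:P) => /=.
  rewrite !evzX -(rP (s, i')) // -(rP ((s * t)%g, i')) /= ?groupM //.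
  by rewrite galM ?memvf.
have E : map_poly (map_poly (pFrobenius_aut charF \o evz zb)) T
         = map_poly (map_poly (evz zb)) T.
  apply/polyP => i; rewrite !coef_map /=; apply/polyP => j; rewrite !coef_map /=.
  by rewrite pFrobenius_autE Tfix.
pose x : {poly F} := \sum_(i < n) 'X^i * (zb i ^+ p)%:P.
(* On the side twisted by Frobenius the factor of s = 1 vanishes at x; hence some factor of the
   other side vanishes there too, and its s is the element sought. *)
have : (map_poly (map_poly (evz zb)) T).[x] == 0.
  rewrite -E TE horner_prod (bigD1 1%g) ?group1 //= hornerXsubC.
  rewrite [X in X * _](_ : _ = 0) ?mul0r //; apply/eqP; rewrite subr_eq0; apply/eqP.
  apply: eq_bigr => i _; rewrite /= evzX pFrobenius_autE; congr (_ * (_ ^+ _)%:P).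
  by apply: zE; rewrite -(rP (1%g, i)) /= ?group1 ?gal_id.
rewrite TE horner_prod prodf_seq_eq0 => /hasP[s _ /andP[sG]].
rewrite hornerXsubC subr_eq0 => /eqP xE; exists s => // i j sij.
have -> : zb j = zb (r (s, i)) by apply: zE; rewrite -sij -(rP (s, i)).
have cf (f : 'I_n -> F) : (\sum_(i < n) 'X^i * (f i)%:P)`_i = f i.
  rewrite coef_sum (bigD1 i) //= coefMC coefXn eqxx mul1r big1 ?addr0 // => k ki.
  by rewrite coefMC coefXn eq_sym (inj_eq val_inj) (negbTE ki) mul0r.
have := congr1 (fun q : {poly F} => q`_i) xE.
by rewrite !cf /= evzX.
Qed.

End Frobenius.

(** * The roots of E8 *)

Definition zr {R : pzRingType} (c : Z) : R := (int_of_Z c)%:~R.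
HB.instance Definition _ (R : pzRingType) :=
  GRing.RMorphism.copy (@zr R) (intr \o int_of_Z).

Lemma zrD (R : pzRingType) a b : zr (Z.add a b) = zr a + zr b :> R.
Proof. exact: (rmorphD (@zr R)). Qed.
Lemma zrM (R : pzRingType) a b : zr (Z.mul a b) = zr a * zr b :> R.
Proof. exact: (rmorphM (@zr R)). Qed.
Lemma zrN (R : pzRingType) a : zr (Z.opp a) = - zr a :> R.
Proof. exact: (rmorphN (@zr R)). Qed.
Lemma zrB (R : pzRingType) a b : zr (Z.sub a b) = zr a - zr b :> R.
Proof. by rewrite /Z.sub zrD zrN. Qed.
Lemma zr0 (R : pzRingType) : zr Z0 = 0 :> R. Proof. by []. Qed.
Lemma zr1 (R : pzRingType) : zr (Zpos xH) = 1 :> R. Proof. by []. Qed.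

Local Open Scope Z_scope.

Definition addl (x y : seq Z) : seq Z := [seq Z.add p.1 p.2 | p <- zip x y].
Definition oppl : seq Z -> seq Z := map Z.opp.
Definition scalel (c : Z) : seq Z -> seq Z := map (Z.mul c).
Definition dotl (x y : seq Z) : Z :=
  foldr (fun p s => Z.add (Z.mul p.1 p.2) s) Z0 (zip x y).

(* Bourbaki's simple roots, with all coordinates doubled. *)
Definition simple2 : seq (seq Z) :=
  [:: [:: 1; -1; -1; -1; -1; -1; -1; 1]; [:: 2; 2; 0; 0; 0; 0; 0; 0];
      [:: -2; 2; 0; 0; 0; 0; 0; 0]; [:: 0; -2; 2; 0; 0; 0; 0; 0];
      [:: 0; 0; -2; 2; 0; 0; 0; 0]; [:: 0; 0; 0; -2; 2; 0; 0; 0];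
      [:: 0; 0; 0; 0; -2; 2; 0; 0]; [:: 0; 0; 0; 0; 0; -2; 2; 0]].

Local Close Scope Z_scope.

(* The pair (b, i) at position k says that positive root number 8 + k is the sum of
   positive root number b and simple root number i. *)
Definition root_steps : seq (nat * nat) := [::
   (2, 0); (3, 1); (3, 2); (4, 3); (5, 4); (6, 5); (7, 6); (10, 0); (10, 1); (11,
   1); (11, 2); (12, 3); (13, 4); (14, 5); (16, 0); (18, 0); (18, 1); (19, 1);
   (19, 2); (20, 3); (21, 4); (24, 0); (26, 0); (24, 3); (26, 1); (27, 1); (27,
   2); (28, 3); (31, 0); (32, 0); (34, 0); (32, 3); (34, 1); (35, 1); (35, 2);
   (36, 2); (39, 0); (40, 0); (42, 0); (39, 4); (40, 3); (42, 1); (44, 2); (47,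
   0); (48, 0); (49, 0); (48, 4); (49, 3); (51, 2); (52, 2); (54, 0); (55, 0);
   (54, 5); (55, 4); (56, 3); (58, 2); (59, 2); (60, 0); (61, 0); (61, 5); (62,
   1); (63, 3); (65, 2); (66, 2); (67, 0); (67, 6); (69, 1); (70, 3); (71, 3);
   (72, 2); (73, 0); (75, 1); (76, 1); (75, 4); (77, 3); (78, 2); (81, 1); (82,
   1); (82, 4); (83, 3); (84, 3); (86, 1); (87, 1); (87, 4); (88, 2); (89, 3);
   (91, 1); (91, 5); (92, 0); (93, 2); (94, 3); (95, 1); (97, 0); (98, 2); (99,
   3); (101, 0); (102, 2); (102, 4); (104, 0); (105, 2); (107, 0); (107, 3);
   (109, 0); (109, 1); (111, 0); (110, 2); (113, 1); (114, 3); (115, 4); (116,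
   5); (117, 6); (118, 7)]%N.

(** Generic, because the values of the roots of P modulo p1 are later generated along the same steps
    as the coordinates; this keeps the two lists aligned. *)
Definition grow (T U : Type) (t0 : T) (u0 : U) (op : T -> U -> T) (us : seq U)
    (xs : seq T) (st : seq (nat * nat)) : seq T :=
  foldl (fun acc e => rcons acc (op (nth t0 acc e.1) (nth u0 us e.2))) xs st.

Definition simple_coords : seq (seq Z) :=
  [seq [seq if i == j then Zpos xH else Z0 | j <- iota 0 8] | i <- iota 0 8].

Definition pos_roots : seq (seq Z) :=
  Eval vm_compute in grow [::] [::] addl simple_coords simple_coords root_steps.
Definition roots : seq (seq Z) := Eval vm_compute in pos_roots ++ map oppl pos_roots.

Definition dbl (n : seq Z) : seq Z :=
  foldr (fun p s => addl (scalel p.1 p.2) s) (nseq 8 Z0) (zip n simple2).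
Definition roots2 : seq (seq Z) := Eval vm_compute in map dbl roots.

Definition vec2 (d : seq Z) : 'rV[rat]_8 := \row_j (zr (nth Z0 d j) / 2).

Lemma dotv_vec2 d e : size d = 8 -> size e = 8 ->
  dotv (vec2 d) (vec2 e) = zr (dotl d e) / 4.
Proof.
case: d => [|d0[|d1[|d2[|d3[|d4[|d5[|d6[|d7[|? ?]]]]]]]]] //= _.
case: e => [|e0[|e1[|e2[|e3[|e4[|e5[|e6[|e7[|? ?]]]]]]]]] //= _.
by rewrite /dotv !big_ord_recl big_ord0 !mxE /= /dotl /= !zrD !zrM zr0; field.
Qed.

Lemma vec2D d e : size d = 8 -> size e = 8 -> vec2 (addl d e) = vec2 d + vec2 e.
Proof.
move=> sd se; apply/rowP => j; rewrite !mxE /addl (nth_map (Z0, Z0)); last first.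
  by rewrite size_zip sd se.
by rewrite nth_zip ?sd ?se //= zrD mulrDl.
Qed.

Lemma vec2N d : size d = 8 -> vec2 (oppl d) = - vec2 d.
Proof.
move=> sd; apply/rowP => j; rewrite !mxE /oppl (nth_map Z0) ?sd //.
by rewrite zrN mulNr.
Qed.

Lemma zr_rat_inj : injective (@zr rat).
Proof. by move=> a b /(intr_inj (R := rat)) /(can_inj int_of_ZK). Qed.

Lemma vec2_inj d e : size d = 8 -> size e = 8 -> vec2 d = vec2 e -> d = e.
Proof.
move=> sd se /rowP h; apply: (@eq_from_nth _ Z0); rewrite ?sd ?se // => i i8.
have := h (Ordinal i8); rewrite !mxE /= => /(congr1 ( *%R^~ 2)).
by rewrite !divfK // => /zr_rat_inj.
Qed.

(* Doubled coordinates of a root: all of one parity, square length 8, and a sum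
   divisible by 4. *)
Definition root2b (d : seq Z) : bool :=
  [&& size d == 8%N, all Z.even d || all Z.odd d, Z.eqb (dotl d d) 8
    & Z.eqb (Z.modulo (foldr Z.add Z0 d) 4) 0].

Lemma zr_intP (R : archiNumDomainType) c : (zr c : R) \is a Num.int.
Proof. exact: intr_int. Qed.

Lemma root2b_root d : root2b d -> is_E8_root (vec2 d).
Proof.
case/and4P=> /eqP sd par /Z.eqb_eq n8 /Z.eqb_eq s4.
have -> : is_E8_root (vec2 d) = E8_lattice (vec2 d).
  by rewrite /is_E8_root dotv_vec2 // n8 andb_idr.
have sumE : \sum_i vec2 d 0 i = zr (foldr Z.add Z0 d) / 2.
  case: d sd {par n8 s4} => [|d0[|d1[|d2[|d3[|d4[|d5[|d6[|d7[|? ?]]]]]]]]] //= _.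
  by rewrite !big_ord_recl big_ord0 !mxE /= !zrD zr0; field.
apply/andP; split; last first.
  move/Z.eqb_eq: s4 => /Z.eqb_eq /Z.mod_divide[//| c cE].
  rewrite sumE cE zrM (_ : zr c * zr _ / 2 / 2 = zr c); first exact: zr_intP.
  by rewrite [X in _ * X / _ / _](_ : _ = 4) //; field.
case/orP: par => /allP par; apply/orP; [left | right]; apply/forallP => i.
all: have := par _ (mem_nth Z0 (s := d) (n := i) _); rewrite sd => /(_ (ltn_ord i)); rewrite mxE.
- move=> /Z.even_spec[c ->]; rewrite zrM.
  have -> : zr 2 * zr c / 2 = zr c :> rat by rewrite (_ : zr 2 = 2) //; field.
  exact: zr_intP.
- move=> /Z.odd_spec[c ->]; rewrite zrD zrM.
  have -> : (zr 2 * zr c + zr 1) / 2 - 2^-1 = zr c :> rat.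
    by rewrite (_ : zr 2 = 2) // zr1; field.
  exact: zr_intP.
Qed.

Fixpoint cube (T : Type) (s : seq T) (n : nat) : seq (seq T) :=
  if n is n'.+1 then [seq x :: l | x <- s, l <- cube s n'] else [:: [::]].

Lemma mem_cube (T : eqType) (s : seq T) n (l : seq T) :
  size l = n -> all (mem s) l -> l \in cube s n.
Proof.
elim: n l => [|n IHn] [|x l] //= [sl] /andP[xs ls].
by apply/allpairsP; exists (x, l); rewrite xs IHn.
Qed.

(** Doubled coordinates are at most 2 in absolute value and of one parity, so the 3^8 even and 2^8
    odd vectors include every candidate. *)
Lemma roots2_complete :
  all (fun d => root2b d ==> (d \in roots2))
      (cube [:: Zneg 2; Z0; Zpos 2] 8 ++ cube [:: Zneg 1; Zpos 1] 8)
  && all root2b roots2 && uniq roots2 && uniq roots.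
Proof. by vm_compute. Qed.

Lemma zr_nat (R : pzRingType) k : zr (Z.of_nat k) = k%:R :> R.
Proof. by rewrite /zr (_ : int_of_Z _ = k%:Z) //; lia. Qed.

Lemma int_zrP (x : rat) : x \is a Num.int -> exists c, x = zr c.
Proof.
by case/intrP => m ->; exists (Z_of_int m); rewrite /zr Z_of_intK.
Qed.

Lemma E8_root_coords (v : 'rV[rat]_8) : is_E8_root v ->
  exists2 d, d \in roots2 & v = vec2 d.
Proof.
move=> rv; have : v \in E8_roots by rewrite mem_E8_roots.
rewrite mem_filter rv /= => /imageP[c _ vE].
pose f i : Z := Z.sub (Z.of_nat (c i)) (Zpos 2).
pose d := [seq f i | i <- enum 'I_8].
have sd : size d = 8 by rewrite size_map size_enum_ord.
have dn (i : 'I_8) : nth Z0 d i = f i.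
  by rewrite (nth_map i) ?size_enum_ord ?nth_ord_enum.
have vd : v = vec2 d.
  rewrite vE; apply/rowP => i; rewrite !mxE dn /f /Z.sub zrD zr_nat mulrDl.
  by congr (_ + _).
have dI x : x \in d -> exists i, x = f i.
  by case/mapP => i _ ->; exists i.
have halfE (i : 'I_8) : vec2 d 0 i = zr (f i) / 2 by rewrite mxE dn.
exists d => //; move: rv; rewrite vd => /andP[/andP[par sum] nrm].
have par2 : all Z.even d || all Z.odd d.
  case/orP: par => /forallP par; apply/orP; [left | right]; apply/allP => x /dI[i ->].
  - have := par i; rewrite halfE => /int_zrP[b bE].
    have /zr_rat_inj -> : zr (f i) = zr (Z.mul 2 b) :> rat.
      by rewrite zrM -bE (_ : zr 2 = 2) //; field.
    by apply/Z.even_spec; exists b.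
  - have := par i; rewrite halfE => /int_zrP[b bE].
    have /zr_rat_inj -> : zr (f i) = zr (Z.add (Z.mul 2 b) 1) :> rat.
      by rewrite zrD zrM -bE (_ : zr 2 = 2) // zr1; field.
    by apply/Z.odd_spec; exists b.
have rd : root2b d.
  rewrite /root2b sd par2 /=; apply/andP; split; apply/Z.eqb_eq.
    apply: zr_rat_inj; move: nrm; rewrite dotv_vec2 // => /eqP e.
    by rewrite -[LHS](divfK (_ : 4 != 0)) // e.
  apply/Z.mod_divide => //; case/int_zrP: sum => b bE; exists b; apply: zr_rat_inj.
  rewrite zrM -bE.
  have -> : \sum_i vec2 d 0 i = zr (foldr Z.add Z0 d) / 2.
    case: (d) sd => [|d0[|d1[|d2[|d3[|d4[|d5[|d6[|d7[|? ?]]]]]]]]] //= _.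
    by rewrite !big_ord_recl big_ord0 !mxE /= !zrD zr0; field.
  by rewrite (_ : zr 4 = 4) //; field.
case/andP: roots2_complete => /andP[/andP[/allP cmp _] _] _.
suff : d \in cube [:: Zneg 2; Z0; Zpos 2] 8 ++ cube [:: Zneg 1; Zpos 1] 8.
  by move/cmp; rewrite rd.
have fb i : (Z.leb (Zneg 2) (f i)) && (Z.leb (f i) 2).
  by have := ltn_ord (c i); rewrite /f; lia.
rewrite mem_cat; case/orP: par2 => /allP par2; apply/orP; [left | right];
  apply: mem_cube => //; apply/allP => x xd; have := par2 _ xd; have [i ->] := dI _ xd;
  have /andP[/Z.leb_le lo /Z.leb_le hi] := fb i; move: (f i) lo hi => y lo hi.
- case/Z.even_spec => b bE.
  by have [->|[->|->]] : y = Zneg 2 \/ y = Z0 \/ y = Zpos 2 by lia.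
- case/Z.odd_spec => b bE.
  by have [->|->] : y = Zneg 1 \/ y = Zpos 1 by lia.
Qed.

(** * Isometries of the root system *)

Lemma size_roots2 d : d \in roots2 -> size d = 8.
Proof.
case/andP: roots2_complete => /andP[/andP[_ /allP h] _] _ /h.
by case/and4P=> /eqP.
Qed.

Lemma roots2_root d : d \in roots2 -> exists a : E8_root, val a = vec2 d.
Proof.
move=> dr; case/andP: roots2_complete => /andP[/andP[_ /allP h] _] _.
have v : vec2 d \in E8_roots by rewrite mem_E8_roots root2b_root ?h.
by exists (SeqSub v).
Qed.

Lemma root_roots2 (a : E8_root) : exists2 d, d \in roots2 & val a = vec2 d.
Proof. exact: E8_root_coords (E8_rootP a). Qed.

Lemma dot_roots2 (a b : E8_root) d e : d \in roots2 -> e \in roots2 ->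
  val a = vec2 d -> val b = vec2 e -> dotv (val a) (val b) = zr (dotl d e) / 4.
Proof. by move=> dr er -> ->; rewrite dotv_vec2 ?size_roots2. Qed.

Lemma dot_roots2_eq (a b a' b' : E8_root) d e d' e' :
  d \in roots2 -> e \in roots2 -> d' \in roots2 -> e' \in roots2 ->
  val a = vec2 d -> val b = vec2 e -> val a' = vec2 d' -> val b' = vec2 e' ->
  (dotl d e = dotl d' e') <-> (dotv (val a) (val b) = dotv (val a') (val b')).
Proof.
move=> dr er dr' er' va vb va' vb'.
rewrite (dot_roots2 dr er va vb) (dot_roots2 dr' er' va' vb').
split=> [-> // | /(congr1 ( *%R^~ 4))]; rewrite !divfK //; exact: zr_rat_inj.
Qed.

Lemma dotvDl u v w : dotv (u + v) w = dotv u w + dotv v w.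
Proof. by rewrite /dotv -big_split; apply: eq_bigr => i _; rewrite !mxE mulrDl. Qed.

Lemma dotvNl u w : dotv (- u) w = - dotv u w.
Proof. by rewrite -scaleN1r dotvZl mulN1r. Qed.

Lemma dotvv_eq0 u : dotv u u = 0 -> u = 0.
Proof.
move=> /eqP; rewrite psumr_eq0 => [/allP h | i _]; last exact: sqr_ge0.
apply/rowP => i; have := h i (mem_index_enum _); rewrite -expr2 sqrf_eq0 => /eqP ->.
by rewrite mxE.
Qed.

Lemma root_norm (a : E8_root) : dotv (val a) (val a) = 2.
Proof. by case/andP: (E8_rootP a) => _ /eqP. Qed.

Lemma root_dot_inj (a b : E8_root) :
  (forall c : E8_root, dotv (val a) (val c) = dotv (val b) (val c)) -> a = b.
Proof.
move=> h; apply: val_inj; apply/eqP; rewrite -subr_eq0; apply/eqP/dotvv_eq0.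
have := h a; have := h b; set u := val a; set v := val b => huv hvu.
by rewrite dotvBl ![dotv _ (_ - _)]dotvC !dotvBl hvu (dotvC v u) huv; ring.
Qed.

Lemma reflectE (a b : E8_root) :
  val (reflection a b) = val b - dotv (val a) (val b) *: val a.
Proof. by rewrite permE. Qed.

Definition isometries : {set {perm E8_root}} :=
  [set f : {perm E8_root} | [forall a, forall b,
     dotv (val (f a)) (val (f b)) == dotv (val a) (val b)]].

Lemma isometryP (f : {perm E8_root}) :
  reflect (forall a b, dotv (val (f a)) (val (f b)) = dotv (val a) (val b))
          (f \in isometries).
Proof.
rewrite inE; apply: (iffP forallP) => [h a b | h a].
  by apply/eqP; apply: (forallP (h a)).
by apply/forallP => b; rewrite h.
Qed.

Lemma isometries_group : group_set isometries.
Proof.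
apply/group_setP; split=> [|f g /isometryP hf /isometryP hg].
  by apply/isometryP => a b; rewrite !perm1.
by apply/isometryP => a b; rewrite !permM hg hf.
Qed.
Canonical isometry_group := Group isometries_group.

Lemma reflection_isometry a : reflection a \in isometries.
Proof.
apply/isometryP => b c; rewrite !reflectE dotvBl dotvZl ![dotv _ (_ - _)]dotvC.
rewrite !dotvBl !dotvZl root_norm (dotvC (val c) (val b)) (dotvC (val c) (val a)); ring.
Qed.

Lemma WE8_isometries : (WE8 \subset isometries).
Proof.
rewrite gen_subG; apply/subsetP => _ /imsetP[a _ ->]; exact: reflection_isometry.
Qed.

Lemma isometry_reflection (f : {perm E8_root}) a : f \in isometries ->
  (reflection a ^ f)%g = reflection (f a).
Proof.
move=> /isometryP hf; apply/permP => b; rewrite -[b](permKV f) permJ.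
set b' := (f^-1)%g b; apply: root_dot_inj => c; rewrite -[c](permKV f) hf.
by rewrite !reflectE !dotvBl !dotvZl !hf.
Qed.

Section Transitivity.
Variables (fixed : seq (seq Z)) (t : seq Z).

(** Isometries fixing [fixed] send t into [candidates]. The search from t follows pairs with inner
    product 1, which is 4 in doubled coordinates. *)
Definition candidates :=
  [seq d <- roots2 | all (fun s => Z.eqb (dotl d s) (dotl t s)) fixed].
Definition reachable n :=
  iter n (fun l => [seq d <- candidates |
                    (d \in l) || has (fun e => Z.eqb (dotl d e) 4) l]) [:: t].

Hypotheses (fr : {subset fixed <= roots2}) (tr : t \in roots2).

(* If (a, a') = 1 then a - a' is a root whose reflection maps a to a' and fixes
   the roots that have the same inner products with a and a'. *)
Lemma reachable_conj n d (a b : E8_root) :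
  d \in reachable n -> val a = vec2 d -> val b = vec2 t ->
  d \in candidates /\ exists2 w, w \in WE8 &
    w a = b /\ forall (c : E8_root) s, s \in fixed -> val c = vec2 s -> w c = c.
Proof.
have tc : t \in candidates by rewrite mem_filter tr andbT; apply/allP => s _; exact: Z.eqb_refl.
have cr e : e \in candidates -> e \in roots2 by rewrite mem_filter => /andP[].
elim: n d a => [|n IHn] d a.
  rewrite inE => /eqP -> va vb; split=> //; exists 1%g; rewrite ?group1 //.
  by split=> [|c s _ _]; rewrite perm1 //; apply: val_inj; rewrite va vb.
rewrite [reachable _]/= mem_filter => /andP[/orP[dl _ | /hasP[e el /Z.eqb_eq de] dc]] va vb.
  exact: IHn dl va vb.
split=> //; have [a' va'] : exists a' : E8_root, val a' = vec2 e.
  case: (n) el => [|m]; first by rewrite inE => /eqP ->; exists b.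
  by rewrite [reachable _]/= mem_filter => /andP[_ /cr]; exact: roots2_root.
have [ec [w wW [wa' wfix]]] := IHn e a' el va' vb.
have aa' : dotv (val a) (val a') = 1.
  by rewrite (dot_roots2 (cr _ dc) (cr _ ec) va va') de.
pose r := reflection a' a.
have rE : val r = val a - val a' by rewrite reflectE dotvC aa' scale1r.
exists (reflection r * w)%g.
  by rewrite groupM //; apply: mem_gen; apply: imset_f.
have candP (f : seq Z) s : f \in candidates -> s \in fixed -> dotl f s = dotl t s.
  by rewrite mem_filter => /andP[/allP h _] /h /Z.eqb_eq.
split=> [|c s sf vc]; rewrite permM.
  suff -> : reflection r a = a' by [].
  apply: val_inj; rewrite reflectE rE dotvBl root_norm (dotvC (val a')) aa'.
  by rewrite (_ : 2 - 1 = 1 :> rat) // scale1r subKr.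
suff -> : reflection r c = c by exact: wfix sf vc.
apply: val_inj; rewrite reflectE rE dotvBl.
suff -> : dotv (val a) (val c) = dotv (val a') (val c) by rewrite subrr scale0r subr0.
apply/(dot_roots2_eq (cr _ dc) (fr sf) (cr _ ec) (fr sf) va vc va' vc).
by rewrite (candP d) ?(candP e).
Qed.

End Transitivity.

(* Removing nodes from the end of the long arm gives E8 > E7 > E6 > D5 > A4 ... *)
Definition flag : seq (seq Z) := [seq nth [::] roots2 i | i <- [:: 7; 6; 5; 4; 3; 1; 2; 0]].

(** Six search steps reach all candidates at every stage, so the stabilizer in W of a prefix of the
    flag is transitive on the possible images of the next root. The uniqueness test says that inner
    products with the flag determine a root. *)
Lemma flag_transitive :
  all (fun k => all (mem (reachable (take k flag) (nth [::] flag k) 6))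
                    (candidates (take k flag) (nth [::] flag k))) (iota 0 8)
  && uniq [seq [seq dotl d s | s <- flag] | d <- roots2]
  && all (mem roots2) flag.
Proof. by vm_compute. Qed.

Lemma size_flag : size flag = 8. Proof. by []. Qed.

Opaque roots2 flag.

Lemma map_uniq_inj (T U : eqType) (f : T -> U) (s : seq T) :
  uniq (map f s) -> {in s &, injective f}.
Proof.
elim: s => //= x s IHs /andP[fx us] y z; rewrite !inE.
case/predU1P=> [-> | ys] /predU1P[-> | zs] //; last exact: IHs.
- by move=> e; rewrite e map_f in fx.
- by move=> e; rewrite -e map_f in fx.
Qed.

Lemma isometry_fix_flag (f : {perm E8_root}) : f \in isometries ->
  (forall (c : E8_root) s, s \in flag -> val c = vec2 s -> f c = c) -> f = 1%g.
Proof.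
move=> /isometryP hf fix_flag; apply/permP => a; rewrite perm1.
case/andP: flag_transitive => /andP[_ uq] /allP flr.
have [d dr va] := root_roots2 a; have [e er vfa] := root_roots2 (f a).
have sc := flr.
apply: val_inj; rewrite va vfa; congr vec2.
have ii : {in roots2 &, injective (fun d => [seq dotl d s | s <- flag])}.
  exact: map_uniq_inj.
apply: (ii _ _ er dr).
apply/eq_in_map => s sf.
have [c vc] := roots2_root (sc _ sf).
apply/(dot_roots2_eq er (sc _ sf) dr (sc _ sf) vfa vc va vc).
by rewrite -{1}(fix_flag c s sf vc) hf.
Qed.

(** The Dynkin diagram of E8 has no symmetry, so W is the full isometry group. The proof multiplies
    f by elements of W that make it fix one more root of the flag each time. *)
Lemma isometries_WE8 : isometries \subset WE8.
Proof.
case/andP: flag_transitive => /andP[/allP tra uq] /allP flr.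
have isom_mul f w : f \in isometries -> w \in WE8 -> (f * w)%g \in isometries.
  move=> fi /(subsetP WE8_isometries); exact: (@groupM _ isometry_group).
apply/subsetP => f fi.
have prefix k : (k <= 8)%N -> exists2 w, w \in WE8 & forall (c : E8_root) s,
    s \in take k flag -> val c = vec2 s -> (f * w)%g c = c.
  elim: k => [|k IHk] k8; first by exists 1%g; rewrite ?group1.
  have [w wW wfix] := IHk (ltnW k8).
  pose t := nth [::] flag k.
  have tr : t \in roots2 by apply: flr; apply: mem_nth.
  have fr : {subset take k flag <= roots2} by move=> s /mem_take /flr.
  have [b vb] := roots2_root tr; have [d dr vd] := root_roots2 ((f * w)%g b).
  have fwi := isom_mul _ _ fi wW.
  have dc : d \in candidates (take k flag) t.
    rewrite mem_filter dr andbT; apply/allP => s sf; apply/Z.eqb_eq.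
    have [c vc] := roots2_root (fr _ sf).
    apply/(dot_roots2_eq dr (fr _ sf) tr (fr _ sf) vd vc vb vc).
    by rewrite -{1}(wfix c s sf vc) (isometryP _ fwi).
  have /allP reach := tra k (etrans (mem_iota 0 8 k) k8).
  have dre : d \in reachable (take k flag) t 6 by apply: reach.
  have [_ [w' w'W [w'd w'fix]]] := reachable_conj fr tr dre vd vb.
  exists (w * w')%g; first exact: groupM.
  have kf : (k < size flag)%N by rewrite size_flag.
  move=> c s; rewrite (take_nth [::] kf) mem_rcons inE => /predU1P[-> | sf] vc.
    have -> : c = b by apply: val_inj; rewrite vc vb.
    by rewrite mulgA permM.
  by rewrite mulgA permM (wfix c s sf vc) (w'fix c s sf vc).
have [w wW wfix] := prefix 8 isT.
have : (f * w)%g = 1%g.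
  exact: isometry_fix_flag (isom_mul _ _ fi wW) wfix.
by move/(canRL (mulgK w)) ->; rewrite mul1g groupV.
Qed.

(** * Sparse bilinear algebra *)

(** Tables and computed vectors are binary tries indexed by [positive]; the vectors of the
    statements are functions on all of [positive], and [dom_table] ensures that the tables are empty
    beyond the dimension. *)
Inductive ptree (Y : Type) := PE | PN of ptree Y & Y & ptree Y.
Arguments PE {Y}.

Section Ptree.
Variables (Y : Type) (y0 : Y).

Fixpoint pget (t : ptree Y) (k : positive) : Y :=
  match t, k with
  | PE, _ => y0
  | PN _ v _, xH => v
  | PN l _ _, xO k' => pget l k'
  | PN _ _ r, xI k' => pget r k'
  end.

Fixpoint pupd (t : ptree Y) (k : positive) (g : Y -> Y) : ptree Y :=
  match t, k with
  | PE, xH => PN PE (g y0) PE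
  | PE, xO k' => PN (pupd PE k' g) y0 PE
  | PE, xI k' => PN PE y0 (pupd PE k' g)
  | PN l v r, xH => PN l (g v) r
  | PN l v r, xO k' => PN (pupd l k' g) v r
  | PN l v r, xI k' => PN l v (pupd r k' g)
  end.

Fixpoint pall (P : positive -> Y -> bool) (t : ptree Y) : bool :=
  match t with
  | PE => true
  | PN l v r => [&& P xH v, pall (fun k => P (xO k)) l & pall (fun k => P (xI k)) r]
  end.

Fixpoint psum (R : nmodType) (F : positive -> Y -> R) (t : ptree Y) : R :=
  match t with
  | PE => 0
  | PN l v r => F xH v + psum (fun k => F (xO k)) l + psum (fun k => F (xI k)) r
  end.

Lemma pget_upd t k g j :
  pget (pupd t k g) j = if Pos.eqb j k then g (pget t k) else pget t j.
Proof.
elim: k t j => [k IH|k IH|] [|l v r] [j|j|] //=; rewrite ?IH //.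
all: by case: (k) => [?|?|]; case: (j).
Qed.

Lemma pallP (P : positive -> Y -> bool) t : (forall k, P k y0) -> pall P t -> forall k, P k (pget t k).
Proof.
elim: t P => [|l IHl v r IHr] P P0 /=; first by move=> _ k; apply: P0.
case/and3P=> Pv Pl Pr [k|k|] //=.
- exact: (IHr (fun k => P (xI k)) (fun k => P0 (xI k))).
- exact: (IHl (fun k => P (xO k)) (fun k => P0 (xO k))).
Qed.

Lemma psum_upd (R : nmodType) F (dl : positive -> R) (t : ptree Y) k g :
  (forall k, F k y0 = 0) -> (forall y, F k (g y) = F k y + dl k) ->
  psum F (pupd t k g) = psum F t + dl k.
Proof.
elim: k t F dl => [k IH|k IH|] [|l v r] F dl F0 Fg /=.
- by rewrite (IH PE (fun k => F (xI k)) (fun k => dl (xI k))) //= F0 addr0 !add0r.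
- by rewrite (IH r (fun k => F (xI k)) (fun k => dl (xI k))) // !addrA.
- by rewrite (IH PE (fun k => F (xO k)) (fun k => dl (xO k))) //= F0 addr0 !add0r.
- by rewrite (IH l (fun k => F (xO k)) (fun k => dl (xO k))) // !addrA addrAC.
- by rewrite Fg F0 !addr0.
- by rewrite Fg -!addrA; congr (_ + _); rewrite addrCA; congr (_ + _); rewrite addrC.
Qed.

End Ptree.

Definition term1 := (positive * Z)%type.
Definition term2 := (positive * positive * Z)%type.
Definition sparse := ptree (seq term1).
Definition sparse2 := ptree (seq term2).

Section Forms.
Variable R : comNzRingType.
Local Notation V := (positive -> R).

Definition lform (l : seq term1) (x : V) : R := \sum_(e <- l) zr e.2 * x e.1.
Definition bform (l : seq term2) (x y : V) : R :=
  \sum_(e <- l) zr e.2 * (x e.1.1 * y e.1.2).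

Lemma lform_cat l l' x : lform (l ++ l') x = lform l x + lform l' x.
Proof. by rewrite /lform big_cat. Qed.
Lemma bform_cat l l' x y : bform (l ++ l') x y = bform l x y + bform l' x y.
Proof. by rewrite /bform big_cat. Qed.

Definition scale1 (c : Z) (l : seq term1) : seq term1 := [seq (e.1, Z.mul c e.2) | e <- l].
Definition scale2 (c : Z) (l : seq term2) : seq term2 := [seq (e.1, Z.mul c e.2) | e <- l].

Lemma lform_scale c l x : lform (scale1 c l) x = zr c * lform l x.
Proof.
by rewrite /lform big_map mulr_sumr; apply: eq_bigr => e _; rewrite zrM mulrA.
Qed.
Lemma bform_scale c l x y : bform (scale2 c l) x y = zr c * bform l x y.
Proof.
by rewrite /bform big_map mulr_sumr; apply: eq_bigr => e _; rewrite zrM mulrA.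
Qed.

(** Collecting the coefficients of equal indices normalizes a form, so an identity between integer
    forms is tested once and then holds over every commutative ring. *)
Definition zero1 (l : seq term1) : bool :=
  pall (fun _ c => Z.eqb c Z0)
    (foldr (fun e t => pupd Z0 t e.1 (Z.add e.2)) PE l).

Definition zero2 (l : seq term2) : bool :=
  pall (fun _ t => pall (fun _ c => Z.eqb c Z0) t)
    (foldr (fun e t => pupd PE t e.1.1 (fun t' => pupd Z0 t' e.1.2 (Z.add e.2))) PE l).

Lemma psum_zero (F : positive -> Z -> R) t : (forall k, F k Z0 = 0) ->
  pall (fun _ c => Z.eqb c Z0) t -> psum F t = 0.
Proof.
elim: t F => [|l IHl v r IHr] F F0 //= /and3P[/Z.eqb_eq -> Pl Pr].
by rewrite F0 IHl // IHr // !addr0.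
Qed.

Lemma zero1P l x : zero1 l -> lform l x = 0.
Proof.
pose F k c : R := zr c * x k; have F0 k : F k Z0 = 0 by rewrite /F zr0 mul0r.
move/(psum_zero F0) <-; rewrite /lform; elim: l => [|e l IH] /=; first by rewrite big_nil.
rewrite big_cons IH (psum_upd (dl := fun k => zr e.2 * x k)) 1?addrC // => c.
by rewrite /F zrD mulrDl addrC.
Qed.

Lemma zero2P l x y : zero2 l -> bform l x y = 0.
Proof.
pose F a k c : R := zr c * (x a * y k).
have F0 a k : F a k Z0 = 0 by rewrite /F zr0 mul0r.
pose G a t := psum (F a) t.
have Gz t : pall (fun _ t => pall (fun _ c => Z.eqb c Z0) t) t -> forall H : positive -> positive,
    psum (fun k => G (H k)) t = 0.
  elim: t => [|u IHu v r IHr] //= /and3P[Pv Pl Pr] H.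
  rewrite (IHu Pl (fun k => H (xO k))) (IHr Pr (fun k => H (xI k))).
  by rewrite !addr0 /G psum_zero.
move/Gz => /(_ id) <-; rewrite /bform; elim: l => [|e l IH] /=; first by rewrite big_nil.
rewrite big_cons IH (psum_upd (dl := fun k => zr e.2 * (x k * y e.1.2))) 1?addrC // => t.
rewrite /G (psum_upd (dl := fun k => zr e.2 * (x e.1.1 * y k))) // => c.
by rewrite /F zrD mulrDl addrC.
Qed.

Definition dapp (D : sparse) (x : V) : V := fun k => lform (pget [::] D k) x.
Definition brk (T : sparse2) (x y : V) : V := fun k => bform (pget [::] T k) x y.

End Forms.

Section Linearity.
Variable R : comNzRingType.
Local Notation V := (positive -> R).

Definition lcomb (a : R) (x y : V) : V := fun k => a * x k + y k.

Lemma lform_lcomb l a x y : lform l (lcomb a x y) = a * lform l x + lform l y.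
Proof.
by rewrite /lform mulr_sumr -big_split; apply: eq_bigr => e _; rewrite /lcomb /=; ring.
Qed.
Lemma bform_lcombl l a x y z : bform l (lcomb a x y) z = a * bform l x z + bform l y z.
Proof.
by rewrite /bform mulr_sumr -big_split; apply: eq_bigr => e _; rewrite /lcomb /=; ring.
Qed.
Lemma bform_lcombr l a x y z : bform l z (lcomb a x y) = a * bform l z x + bform l z y.
Proof.
by rewrite /bform mulr_sumr -big_split; apply: eq_bigr => e _; rewrite /lcomb /=; ring.
Qed.

Definition vscale (a : R) (x : V) : V := fun k => a * x k.

Lemma bform_vscalel l a x z : bform l (vscale a x) z = a * bform l x z.
Proof.
by rewrite /bform mulr_sumr; apply: eq_bigr => e _; rewrite /vscale /=; ring.
Qed.
Lemma bform_vscaler l a x z : bform l z (vscale a x) = a * bform l z x.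
Proof.
by rewrite /bform mulr_sumr; apply: eq_bigr => e _; rewrite /vscale /=; ring.
Qed.

(** Elementary matrices: a word in them is inverted by reversing it and negating the coefficients,
    so m^-1 needs no linear algebra. *)
Definition sapp (o : term2) (x : V) : V :=
  fun p => if Pos.eqb p o.1.1 then x p + zr o.2 * x o.1.2 else x p.
Definition wapp (w : seq term2) (x : V) : V := foldr sapp x w.

Lemma wapp_cat w w' x : wapp (w ++ w') x = wapp w (wapp w' x).
Proof. by rewrite /wapp foldr_cat. Qed.

Lemma wapp_lcomb w a x y : wapp w (lcomb a x y) = lcomb a (wapp w x) (wapp w y).
Proof.
elim: w => //= o w ->; apply: functional_extensionality => k.
by rewrite /sapp /lcomb; case: Pos.eqb => //; ring.
Qed.

Lemma wapp_vscale w a x : wapp w (vscale a x) = vscale a (wapp w x).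
Proof.
elim: w => //= o w ->; apply: functional_extensionality => k.
by rewrite /sapp /vscale; case: Pos.eqb => //; ring.
Qed.

End Linearity.

Definition elem_op (o : term2) := ~~ Pos.eqb o.1.1 o.1.2.
Definition inv_op (o : term2) : term2 := (o.1, Z.opp o.2).
Definition inv_word (w : seq term2) := rev (map inv_op w).

Lemma inv_wordK w : inv_word (inv_word w) = w.
Proof.
rewrite /inv_word map_rev revK -map_comp -[RHS]map_id; apply: eq_map => -[i c].
by rewrite /inv_op /= Z.opp_involutive.
Qed.

Lemma inv_word_elem w : all elem_op w -> all elem_op (inv_word w).
Proof. by rewrite all_rev all_map. Qed.

Lemma wapp_inv (R : comNzRingType) w (x : positive -> R) :
  all elem_op w -> wapp w (wapp (inv_word w) x) = x.
Proof.
elim/last_ind: w x => //= w o IHw x; rewrite all_rcons => /andP[oo ow].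
rewrite /inv_word map_rcons rev_rcons -cats1 wapp_cat /=.
rewrite (_ : sapp o _ = wapp (inv_word w) x) ?IHw //.
apply: functional_extensionality => k; rewrite /sapp /inv_op /= zrN.
rewrite /elem_op Pos.eqb_sym in oo.
by case: (Pos.eqb k) => //; rewrite (negbTE oo) mulNr subrK.
Qed.

Fixpoint sform (w : seq term2) (k : positive) : seq term1 :=
  if w is o :: w' then
    if Pos.eqb k o.1.1 then sform w' k ++ scale1 o.2 (sform w' o.1.2) else sform w' k
  else [:: (k, Zpos 1)].

Lemma sformP (R : comNzRingType) w k (x : positive -> R) :
  lform (sform w k) x = wapp w x k.
Proof.
elim: w k => [|o w IHw] k /=; first by rewrite /lform big_seq1 /= zr1 mul1r.
by rewrite /sapp; case: (Pos.eqb k) => //; rewrite lform_cat lform_scale !IHw.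
Qed.

Section Tables.
Variable n : nat.

Definition dom : seq positive := map Pos.of_succ_nat (iota 0 n).
Definition in_dom (k : positive) := Z.leb (Zpos k) (Z.of_nat n).
Definition dom_table (T : Type) (t : ptree (seq T)) := pall (fun k v => in_dom k || nilp v) t.

Lemma all_domP (P : positive -> bool) k : all P dom -> in_dom k -> P k.
Proof.
rewrite /dom all_map /in_dom => /allP h /Z.leb_le kn.
have -> : k = Pos.of_succ_nat (Pos.to_nat k).-1 by lia.
by apply: h; rewrite mem_iota; lia.
Qed.

Lemma dom_tableP (T : Type) (t : ptree (seq T)) k :
  dom_table t -> ~~ in_dom k -> pget [::] t k = [::].
Proof.
move=> dt nk; have := pallP (y0 := [::]) (fun k => orbT (in_dom k)) dt k.
by rewrite (negbTE nk) /=; case: (pget _ _ _).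
Qed.

Definition comp_form (D : sparse) (l : seq term1) : seq term1 :=
  flatten [seq scale1 e.2 (pget [::] D e.1) | e <- l].

Lemma comp_formP (R : comNzRingType) D l (x : positive -> R) :
  lform (comp_form D l) x = lform l (dapp D x).
Proof.
rewrite /comp_form; elim: l => [|e l IHl]; first by rewrite /lform !big_nil.
by rewrite /= lform_cat IHl lform_scale [in RHS]/lform big_cons.
Qed.

Definition comp_bform (T : sparse2) (l : seq term1) : seq term2 :=
  flatten [seq scale2 e.2 (pget [::] T e.1) | e <- l].

Lemma comp_bformP (R : comNzRingType) T l (x y : positive -> R) :
  bform (comp_bform T l) x y = lform l (brk T x y).
Proof.
rewrite /comp_bform; elim: l => [|e l IHl]; first by rewrite /lform /bform !big_nil.
by rewrite /= bform_cat IHl bform_scale [in RHS]/lform big_cons.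
Qed.

Definition left_form (D : sparse) (l : seq term2) : seq term2 :=
  flatten [seq [seq (f.1, e.1.2, Z.mul e.2 f.2) | f <- pget [::] D e.1.1] | e <- l].
Definition right_form (D : sparse) (l : seq term2) : seq term2 :=
  flatten [seq [seq (e.1.1, f.1, Z.mul e.2 f.2) | f <- pget [::] D e.1.2] | e <- l].

Lemma left_formP (R : comNzRingType) D l (x y : positive -> R) :
  bform (left_form D l) x y = bform l (dapp D x) y.
Proof.
rewrite /left_form; elim: l => [|e l IHl]; first by rewrite /bform !big_nil.
rewrite /= bform_cat IHl [in RHS]/bform big_cons; congr (_ + _).
rewrite /bform big_map /dapp /lform mulr_suml mulr_sumr; apply: eq_bigr => f _ /=.
by rewrite zrM; ring.
Qed.

Lemma right_formP (R : comNzRingType) D l (x y : positive -> R) :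
  bform (right_form D l) x y = bform l x (dapp D y).
Proof.
rewrite /right_form; elim: l => [|e l IHl]; first by rewrite /bform !big_nil.
rewrite /= bform_cat IHl [in RHS]/bform big_cons; congr (_ + _).
rewrite /bform big_map /dapp /lform !mulr_sumr; apply: eq_bigr => f _ /=.
by rewrite zrM; ring.
Qed.

(** Coordinate k of 2 w - 2 - 2 D - D^2, where w stands for exp(D): the series stops at D^2 / 2
    because D^3 = 0, and doubling avoids the denominator. *)
Definition exp_terms (D : sparse) (w : seq term2) (k : positive) : seq term1 :=
  let Dk := pget [::] D k in
  scale1 (Zpos 2) (sform w k) ++ (k, Zneg 2) :: scale1 (Zneg 2) Dk
  ++ scale1 (Zneg 1) (comp_form D Dk).
Definition exp_check D w := all elem_op w && dom_table D
  && all (fun o : term2 => in_dom o.1.1) w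
  && all (fun k => zero1 (exp_terms D w k)) dom.

Definition cube_check D :=
  all (fun k => zero1 (comp_form D (comp_form D (pget [::] D k)))) dom.

Definition der_terms (D : sparse) (T : sparse2) (k : positive) : seq term2 :=
  let Tk := pget [::] T k in
  scale2 (Zneg 1) (comp_bform T (pget [::] D k)) ++ left_form D Tk ++ right_form D Tk.
Definition der_check D T := all (fun k => zero2 (der_terms D T k)) dom.

Definition skew_check D (K : seq term2) := zero2 (left_form D K ++ right_form D K).

Section Soundness.
Variables (R : comNzRingType) (D : sparse) (T : sparse2) (K : seq term2) (w : seq term2).
Local Notation V := (positive -> R).
Implicit Types x y : V.
Hypothesis exp_ok : exp_check D w.

Lemma exp_checkP x k :
  2 * wapp w x k = 2 * x k + 2 * dapp D x k + dapp D (dapp D x) k.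
Proof.
case/andP: exp_ok => /andP[/andP[_ dD] wt] chk.
case dk : (in_dom k).
  have /(@zero1P R _ x) := all_domP chk dk.
  rewrite lform_cat lform_scale sformP /lform big_cons -/(lform _ _) -/(lform _ _) lform_cat.
  rewrite !lform_scale comp_formP /= -/(dapp D x k) -/(dapp D (dapp D x) k).
  rewrite (_ : zr (Zpos 2) = 2) // (_ : zr (Zneg 2) = -2) // (_ : zr (Zneg 1) = -1) // => e.
  by apply/eqP; rewrite -subr_eq0 -e; apply/eqP; ring.
rewrite -sformP /dapp !(dom_tableP dD) ?dk // /lform !big_nil !addr0.
have -> : sform w k = [:: (k, Zpos 1)].
  elim: (w) wt => //= o w' IH /andP[ok /IH ->].
  by case: Pos.eqb_spec => // ke; rewrite ke ok in dk.
by rewrite big_seq1 /= zr1 mul1r mulr0 addr0.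
Qed.

Hypothesis cube_ok : cube_check D.
Hypothesis der_ok : der_check D T.
Hypothesis skew_ok : skew_check D K.

Lemma dapp_lcomb a x y : dapp D (lcomb a x y) = lcomb a (dapp D x) (dapp D y).
Proof. by apply: functional_extensionality => k; exact: lform_lcomb. Qed.

Lemma cube_checkP x : dapp D (dapp D (dapp D x)) = fun _ => 0.
Proof.
apply: functional_extensionality => k; case/andP: exp_ok => /andP[/andP[_ dD] _] _.
case dk : (in_dom k); last by rewrite /dapp (dom_tableP dD) ?dk // /lform big_nil.
have /(@zero1P R _ x) := all_domP cube_ok dk.
by rewrite !comp_formP.
Qed.

Hypothesis T_dom : dom_table T.

Lemma der_checkP x y k :
  dapp D (brk T x y) k = brk T (dapp D x) y k + brk T x (dapp D y) k.
Proof.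
case/andP: exp_ok => /andP[/andP[_ dD] _] _.
case dk : (in_dom k); last first.
  by rewrite /dapp /brk !(dom_tableP dD) ?(dom_tableP T_dom) ?dk // /lform /bform !big_nil addr0.
have /(@zero2P R _ x y) := all_domP der_ok dk.
rewrite !bform_cat bform_scale comp_bformP left_formP right_formP (_ : zr (Zneg 1) = -1) //.
by rewrite mulN1r addrC => /subr0_eq.
Qed.

Lemma skew_checkP x y : bform K (dapp D x) y = - bform K x (dapp D y).
Proof.
have /(@zero2P R _ x y) := skew_ok.
by rewrite bform_cat left_formP right_formP => /eqP; rewrite addr_eq0 => /eqP.
Qed.

End Soundness.
End Tables.

Section Exponential.
Variables (n : nat) (R : fieldType) (D : sparse) (T : sparse2) (K w : seq term2).
Hypotheses (two : (2 : R) != 0) (three : (3 : R) != 0).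
Hypotheses (exp_ok : exp_check n D w) (cube_ok : cube_check n D)
  (T_dom : dom_table n T) (der_ok : der_check n D T) (skew_ok : skew_check D K).
Local Notation V := (positive -> R).
Implicit Types x y : V.
Local Notation "'d' x" := (dapp D x) (at level 8, x at level 8).

Lemma exp_vector x : vscale 2 (wapp w x) = lcomb 2 x (lcomb 2 (d x) (d (d x))).
Proof.
apply: functional_extensionality => k.
by rewrite /vscale /lcomb (exp_checkP exp_ok) addrA.
Qed.

Let br (i j : nat) x y := brk T (iter i (dapp D) x) (iter j (dapp D) y).

Let derE i j x y : d (br i j x y) = lcomb 1 (br i.+1 j x y) (br i j.+1 x y).
Proof.
apply: functional_extensionality => k.
by rewrite /lcomb mul1r (der_checkP exp_ok der_ok T_dom).
Qed.

Let zero_vec x : x = (fun _ => 0) -> forall l y, bform l x y = 0.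
Proof. by move=> -> l y; rewrite /bform big1 // => e _; rewrite mul0r mulr0. Qed.

Let zero_vecr x : x = (fun _ => 0) -> forall l y, bform l y x = 0.
Proof. by move=> -> l y; rewrite /bform big1 // => e _; rewrite !mulr0. Qed.

Let br3l i j x y k : br i.+3 j x y k = 0.
Proof. apply: zero_vec; exact: (cube_checkP exp_ok cube_ok). Qed.

Let br3r i j x y k : br i j.+3 x y k = 0.
Proof. apply: zero_vecr; exact: (cube_checkP exp_ok cube_ok). Qed.

(* exp(D) is an automorphism because D is a derivation with D^3 = 0: the terms
   [D^i x, D^j y] with i + j > 2 vanish, as D^3 and D^4 kill [x, y]. *)
Lemma exp_brk x y : wapp w (brk T x y) = brk T (wapp w x) (wapp w y).
Proof.
have e00 : brk T x y = br 0 0 x y by [].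
have d1 : d (br 0 0 x y) = lcomb 1 (br 1 0 x y) (br 0 1 x y) by exact: derE.
have d2 : d (d (br 0 0 x y))
    = lcomb 1 (lcomb 1 (br 2 0 x y) (br 1 1 x y)) (lcomb 1 (br 1 1 x y) (br 0 2 x y)).
  by rewrite d1 dapp_lcomb !derE.
have d3 : d (lcomb 1 (br 2 1 x y) (br 1 2 x y)) = fun _ => 0.
  suff -> : lcomb 1 (br 2 1 x y) (br 1 2 x y) = fun _ => 0.
    by apply: functional_extensionality => k; rewrite /dapp /lform big1 // => e _; rewrite mulr0.
  apply: functional_extensionality => k; apply: (mulfI three); rewrite mulr0.
  have := congr1 (fun f => f k) (cube_checkP exp_ok cube_ok (br 0 0 x y)).
  rewrite d2 !dapp_lcomb !derE /lcomb br3l br3r => e; rewrite -[RHS]e; ring.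
(* D^3 [x, y] = 3 ([D^2 x, D y] + [D x, D^2 y]), the other terms containing D^3. Applying D once
   more leaves 2 [D^2 x, D^2 y]. *)
have c12 k : br 2 1 x y k + br 1 2 x y k = 0.
  apply: (mulfI three); rewrite mulr0.
  have := congr1 (fun f => f k) (cube_checkP exp_ok cube_ok (br 0 0 x y)).
  rewrite d2 !dapp_lcomb !derE /lcomb br3l br3r => e; rewrite -[RHS]e; ring.
have c22 k : br 2 2 x y k = 0.
  apply: (mulfI two); rewrite mulr0.
  have := congr1 (fun f => f k) d3; rewrite dapp_lcomb !derE /lcomb br3l br3r => e.
  by rewrite -[RHS]e; ring.
apply: functional_extensionality => k.
apply: (mulfI two); apply: (mulfI two).
have -> : 2 * (2 * brk T (wapp w x) (wapp w y) k)
    = brk T (vscale 2 (wapp w x)) (vscale 2 (wapp w y)) k.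
  by rewrite /brk bform_vscalel bform_vscaler.
rewrite (exp_checkP exp_ok) !exp_vector e00 d2 d1 /brk.
rewrite !(bform_lcombl, bform_lcombr) /lcomb.
have := c22 k; have := c12 k => /eqP; rewrite addr_eq0 => /eqP.
by rewrite /br /brk /= => -> ->; ring.
Qed.

(** Skewness moves exp(D) across the form as exp(-D), which cancels the other exponential; the terms
    with D^3 vanish. *)
Lemma exp_form x y : bform K (wapp w x) (wapp w y) = bform K x y.
Proof.
have sk := skew_checkP (R := R) skew_ok.
have sk2 (u v : V) : bform K (d (d u)) v = bform K u (d (d v)) by rewrite !sk opprK.
apply: (mulfI two); apply: (mulfI two).
have -> : 2 * (2 * bform K (wapp w x) (wapp w y))
    = bform K (vscale 2 (wapp w x)) (vscale 2 (wapp w y)).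
  by rewrite bform_vscalel bform_vscaler.
rewrite !exp_vector !(bform_lcombl, bform_lcombr) !sk.
by rewrite !(zero_vecr (cube_checkP exp_ok cube_ok _)); ring.
Qed.

End Exponential.

(** * The Lie algebra of type E8 *)

Section Tables.
Local Open Scope Z_scope.

(* The sign cocycle of the bracket is eps(a, b) = (-1)^B(a, b), for the bilinear form
   B with this (transposed) matrix in the basis of simple roots. *)
Definition eps_matrix : seq (seq Z) :=
  [:: [:: 1; 0; 0; 0; 0; 0; 0; 0]; [:: 0; 1; 0; 0; 0; 0; 0; 0];
      [:: 1; 0; 1; 0; 0; 0; 0; 0]; [:: 0; 1; 1; 1; 0; 0; 0; 0];
      [:: 0; 0; 0; 1; 1; 0; 0; 0]; [:: 0; 0; 0; 0; 1; 1; 0; 0];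
      [:: 0; 0; 0; 0; 0; 1; 1; 0]; [:: 0; 0; 0; 0; 0; 0; 1; 1]].

(* The weights separate the 240 roots from each other and from the sums of two roots
   that are not roots. *)
Definition hash (n : seq Z) : Z := dotl [:: 1101; 4663; 6943; 6573; 6257; 517; 2090; 966] n.
Definition hash_key (h : Z) : positive := Z.to_pos (h + 300000).

Record root_datum := RootDatum {
  rd_index : positive; rd_coords : seq Z; rd_hash : Z; rd_eps : seq Z; rd_ips : seq Z }.

Definition cartan : seq (seq Z) :=
  [seq [seq Z.div (dotl s t) 4 | t <- simple2] | s <- simple2].

Definition root_data : seq root_datum :=
  [seq RootDatum (Pos.of_succ_nat p.1) p.2 (hash p.2) [seq dotl r p.2 | r <- eps_matrix]
                 [seq dotl r p.2 | r <- cartan]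
  | p <- zip (iota 0 240) roots].

Definition root_table : ptree Z :=
  foldr (fun d t => pupd 0 t (hash_key (rd_hash d)) (fun _ => Zpos (rd_index d))) PE root_data.

Definition cartan_indices : seq positive :=
  [:: 241; 242; 243; 244; 245; 246; 247; 248]%positive.

Definition sign (b : bool) : Z := if b then -1 else 1.

(** The Frenkel-Kac bracket: [e_a, e_b] = eps(a, b) e_(a+b), and [e_a, e_(-a)] = eps(a, -a) h_a = -
    h_a, with h_a expanded in the simple coroots. The Jacobi identity enters only through
    [der_check], for the sixteen operators in [letters]. *)
Definition root_brackets (a b : root_datum) : seq (positive * term2) :=
  let s := rd_hash a + rd_hash b in
  if Z.eqb s 0 then
    let e := sign (Z.odd (dotl (rd_eps a) (rd_coords b))) in
    [seq (p.1, (rd_index a, rd_index b, e * p.2))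
    | p <- zip cartan_indices (rd_coords a) & ~~ Z.eqb p.2 0]
  else if pget 0 root_table (hash_key s) is Zpos k then
    [:: (k, (rd_index a, rd_index b, sign (Z.odd (dotl (rd_eps a) (rd_coords b)))))]
  else [::].

(** The brackets [h_i, e_a] = (alpha_i, a) e_a, in both orders. *)
Definition cartan_brackets (a : root_datum) : seq (positive * term2) :=
  flatten [seq [:: (rd_index a, (p.1, rd_index a, p.2));
                   (rd_index a, (rd_index a, p.1, - p.2))]
          | p <- zip cartan_indices (rd_ips a) & ~~ Z.eqb p.2 0].

Definition e8_bracket : sparse2 :=
  foldr (fun e t => pupd [::] t e.1 (cons e.2)) PE
    (flatten [seq cartan_brackets a ++ flatten [seq root_brackets a b | b <- root_data]
             | a <- root_data]).

Fixpoint pmap_tree (A B : Type) (f : A -> B) (t : ptree A) : ptree B :=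
  if t is PN l v r then PN (pmap_tree f l) (f v) (pmap_tree f r) else PE.

Fixpoint pelems (A : Type) (h : positive -> positive) (t : ptree A) : seq (positive * A) :=
  if t is PN l v r then
    (h xH, v) :: pelems (fun k => h (xO k)) l ++ pelems (fun k => h (xI k)) r
  else [::].

Definition adjoint (i : positive) (t : Z) : sparse :=
  pmap_tree (fun l => [seq (e.1.2, t * e.2) | e <- l & Pos.eqb e.1.1 i]) e8_bracket.

(* exp(D) as a product of elementary operations: the coordinate i depends on the
   old values of the others, hence is updated first (at the end of the word). *)
Definition exp_word (i : positive) (D : sparse) : seq term2 :=
  let Di := pget [::] D i in
  let D2 := comp_form D Di in
  flatten [seq if Pos.eqb p.1 i then [::] else [seq (p.1, e.1, e.2) | e <- p.2]
          | p <- pelems id D]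
  ++ [seq (i, e.1, e.2) | e <- Di]
  (* [D2] involves only the coordinate of the opposite root, in several terms to be added up.
     Halving is exact: the square of ad e_a sends e_(-a) to 2 e_a. *)
  ++ (if D2 is e :: _ then [:: (i, e.1, Z.div (foldr (fun e s => e.2 + s) 0 D2) 2)]
      else [::]).

(* The automorphism m is the product of the exp(ad e_b), b simple, and of the
   exp(-ad e_(-b)); coordinates 1 to 120 belong to the positive roots, and 121 to 240
   to their opposites. *)
Definition letters : seq (positive * Z) :=
  [seq (Pos.of_succ_nat i, 1) | i <- iota 0 8]
  ++ [seq (Pos.of_succ_nat i, -1) | i <- iota 120 8].

(** The invariant form: (e_a, e_(-a)) = -1 for this choice of signs, and the Cartan matrix on the
    h_i. The opposite of a root has its index shifted by 120. *)
Definition e8_form : seq term2 :=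
  [seq (Pos.of_succ_nat i, Pos.of_succ_nat ((i + 120) %% 240)%N, -1) | i <- iota 0 240]
  ++ flatten [seq [seq (p.1, q.1, q.2) | q <- zip cartan_indices p.2 & ~~ Z.eqb q.2 0]
             | p <- zip cartan_indices cartan].

Definition letter_check (e : positive * Z) : bool :=
  let D := adjoint e.1 e.2 in
  [&& exp_check 248 D (exp_word e.1 D), cube_check 248 D, der_check 248 D e8_bracket
    & skew_check D e8_form].

End Tables.

Local Close Scope Z_scope.

(** * Eigenvectors *)

Section Trees.
Local Open Scope Z_scope.

Definition tapp (o : term2) (t : ptree Z) : ptree Z :=
  pupd 0 t o.1.1 (fun v => v + o.2 * pget 0 t o.1.2).
Definition twapp (w : seq term2) (t : ptree Z) : ptree Z := foldr tapp t w.

Fixpoint tcomb (a : Z) (t t' : ptree Z) : ptree Z :=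
  match t, t' with
  | PE, _ => t'
  | PN l v r, PE => PN (tcomb a l PE) (a * v) (tcomb a r PE)
  | PN l v r, PN l' v' r' => PN (tcomb a l l') (a * v + v') (tcomb a r r')
  end.

(* The test is always true; it makes call-by-need evaluation compute t at once. *)
Definition forcing (A : Type) (t : ptree Z) (k : ptree Z -> A) : A :=
  if pall (fun _ v => Z.eqb v v) t then k t else k t.

(* Powers of s - krylov_shift instead of powers of s = m + m^-1 make the integers about
   half as long, as Q has smaller coefficients in T - 3 than in T. *)
Definition krylov_shift : Z := 3.

Fixpoint addp (a b : seq Z) : seq Z :=
  match a, b with
  | [::], _ => b
  | _, [::] => a
  | x :: a', y :: b' => x + y :: addp a' b'
  end.
Definition taylor (cs : seq Z) : seq Z :=
  foldr (fun c r => addp (c :: r) (map (Z.mul krylov_shift) r)) [::] cs.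
Definition Q_taylor : seq Z := Eval vm_compute in taylor Q_coefs.

Variables (red : Z -> Z) (M N : seq term2) (v0 : ptree Z).

Definition tred := pmap_tree red.

(** One Horner step: h becomes c v0 + (s - [krylov_shift]) h with s = m + m^-1. The map [red] is the
    identity for the computation over Z, and reduction for the one modulo 61. *)
Definition tstep (c : Z) (h : ptree Z) : ptree Z :=
  tred (tcomb c v0 (tcomb (- krylov_shift) h (tcomb 1 (twapp M h) (twapp N h)))).

Definition thead (cs : seq Z) : ptree Z :=
  foldr (fun c h => forcing (tstep c h) id) PE cs.

Definition tlist (cs : seq Z) : seq (ptree Z) :=
  foldr (fun c hs => forcing (tstep c (head PE hs)) (fun h => h :: hs)) [::] cs.

Definition tuvec (y : Z) (hs : seq (ptree Z)) : ptree Z :=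
  foldr (fun h u => forcing (tred (tcomb y u h)) id) PE hs.

Definition tevec (z' y : Z) (hs : seq (ptree Z)) : ptree Z :=
  let u := tuvec (y - krylov_shift) (behead hs) in tred (tcomb (- z') u (twapp M u)).

Definition tbform (T : sparse2) (K : seq term2) (v x y : ptree Z) : Z :=
  foldr (fun e s =>
    let c := pget 0 v e.1.1 in
    if Z.eqb c 0 then s else
      e.2 * (c * foldr (fun f s => f.2 * (pget 0 x f.1.1 * pget 0 y f.1.2) + s) 0
                       (pget [::] T e.1.2)) + s) 0 K.

End Trees.

Definition exp_words (l : seq (positive * Z)) : seq term2 :=
  flatten [seq exp_word e.1 (adjoint e.1 e.2) | e <- l].
Definition Mword : seq term2 := exp_words letters.
Definition Nword : seq term2 := inv_word Mword.
(* (m - 1) e_a for the first simple root a. *)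
Definition krylov0 : ptree Z :=
  tcomb (Zneg 1) (PN PE (Zpos 1) PE) (twapp Mword (PN PE (Zpos 1) PE)).
Definition mod61 (c : Z) := Z.modulo c 61.
(** The vector v lies in the image of m - 1, which kills the vectors fixed by m: on those, Q(m +
    m^-1) would be the scalar Q(2). *)
Definition krylov_check : bool :=
  pall (fun _ v => Z.eqb v Z0) (thead id Mword Nword krylov0 Q_taylor).
(* 49 = 5^-1 and 57 = 15^-1 modulo 61; 54 and 11 are the roots 5 + 5^-1 and 15 + 15^-1
   of Q modulo 61. *)
Definition relation_check : bool :=
  let hs := tlist mod61 Mword Nword krylov0 Q_taylor in
  ~~ Z.eqb (mod61 (tbform e8_bracket e8_form krylov0
       (tevec mod61 Mword (Zpos 49) (Zpos 54) hs) (tevec mod61 Mword (Zpos 57) (Zpos 11) hs)))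
     Z0.

Local Close Scope Z_scope.

Section Krylov.
Variables (R : comNzRingType) (M N : seq term2).
Local Notation V := (positive -> R).

Definition vzero : V := fun _ => 0.
Definition smap (x : V) : V := lcomb 1 (wapp M x) (wapp N x).
Definition hvs (cs : seq Z) (v : V) : seq V :=
  foldr (fun c hs => let h := head vzero hs in
     lcomb (zr c) v (lcomb (- zr krylov_shift) h (smap h)) :: hs) [::] cs.
Definition uvec (y : R) (hs : seq V) : V := foldr (fun h u => lcomb y u h) vzero hs.
Definition evec (z' y : R) (hs : seq V) : V :=
  let u := uvec (y - zr krylov_shift) (behead hs) in lcomb (- z') u (wapp M u).
Definition hornerl (y : R) (cs : seq Z) : R := foldr (fun c r => zr c + y * r) 0 cs.

Lemma smap_lcomb a x y : smap (lcomb a x y) = lcomb a (smap x) (smap y).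
Proof.
rewrite /smap !wapp_lcomb; apply: functional_extensionality => k; rewrite /lcomb; ring.
Qed.

Lemma lform0 l : lform l vzero = 0 :> R.
Proof. by rewrite /lform big1 // => e _; rewrite mulr0. Qed.

Lemma wapp0 w : wapp w vzero = vzero.
Proof.
apply: functional_extensionality => k; rewrite -sformP; exact: lform0.
Qed.

Lemma uvecE y hs : uvec y hs = lcomb y (uvec y (behead hs)) (head vzero hs).
Proof.
case: hs => [|h hs] //=; apply: functional_extensionality => k.
by rewrite /lcomb mulr0 addr0.
Qed.

(* With H_k = sum_(j >= k) c_j s^(j-k) v, the telescoping identity is
   (s - y) (sum_k y^k H_(k+1)) = C(s) v - C(y) v; here with s and y both shifted. *)
Lemma uvec_telescope y cs v k (hs := hvs cs v) :
  smap (uvec (y - zr krylov_shift) (behead hs)) k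
  = y * uvec (y - zr krylov_shift) (behead hs) k + head vzero hs k
    - hornerl (y - zr krylov_shift) cs * v k.
Proof.
rewrite {}/hs; elim: cs k => [|c cs IHc] k /=.
  by rewrite /smap !wapp0 /lcomb /vzero !mulr0 mul0r subr0 !addr0.
rewrite uvecE smap_lcomb /lcomb IHc; ring.
Qed.

Lemma uvec_eigen y cs v (hs := hvs cs v) :
  head vzero hs = vzero -> hornerl (y - zr krylov_shift) cs = 0 ->
  smap (uvec (y - zr krylov_shift) (behead hs))
  = vscale y (uvec (y - zr krylov_shift) (behead hs)).
Proof.
move=> h0 c0; apply: functional_extensionality => k.
by rewrite uvec_telescope -/hs h0 c0 mul0r subr0 addr0.
Qed.

Hypothesis MN : forall x : V, wapp M (wapp N x) = x.

(* (m^2 - y m + 1) u = (m - z) (m - z') u when y = z + z' and z z' = 1. *)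
Lemma evec_eigen z z' cs v (hs := hvs cs v) : z * z' = 1 ->
  head vzero hs = vzero -> hornerl (z + z' - zr krylov_shift) cs = 0 ->
  wapp M (evec z' (z + z') hs) = vscale z (evec z' (z + z') hs).
Proof.
move=> zz' h0 c0; have := uvec_eigen h0 c0; rewrite -/hs /evec.
set u := uvec _ _ => /(congr1 (wapp M)).
rewrite /smap !wapp_lcomb MN wapp_vscale => e.
apply: functional_extensionality => k; have := congr1 (fun f => f k) e.
rewrite /lcomb /vscale mul1r => ek.
have -> : wapp M (wapp M u) k = (z + z') * wapp M u k - u k by rewrite -ek addrK.
by rewrite -[u k in LHS]mul1r -zz'; ring.
Qed.

Variable K : seq term2.
Hypothesis NM : forall x : V, wapp N (wapp M x) = x.
Hypothesis inv : forall x y : V, bform K (wapp M x) (wapp M y) = bform K x y.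

Lemma eigen_inv l l' (x : V) : l * l' = 1 ->
  wapp M x = vscale l x -> wapp N x = vscale l' x.
Proof.
move=> ll' e; have := NM x; rewrite e wapp_vscale => {2}<-.
apply: functional_extensionality => k.
by rewrite /vscale mulrA (mulrC l') ll' mul1r.
Qed.

(* The form is invariant, so s = m + m^-1 is self-adjoint and C(s) v = 0 forces
   C(l + 1/l) (v, x) = 0 for an eigenvector x of m. *)
Lemma dual_horner l l' (x v : V) cs : l * l' = 1 -> wapp M x = vscale l x ->
  bform K (head vzero (hvs cs v)) x = hornerl (l + l' - zr krylov_shift) cs * bform K v x.
Proof.
move=> ll' e; have e' := eigen_inv ll' e.
elim: cs => [|c cs IHc] /=; first by rewrite mul0r /bform big1 // => f _; rewrite mul0r mulr0.
rewrite /smap !bform_lcombl; set h := head _ _ in IHc *.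
have -> : bform K (wapp M h) x = l' * bform K h x.
  by rewrite -[x in LHS]MN inv e' bform_vscaler.
have -> : bform K (wapp N h) x = l * bform K h x.
  by rewrite -inv MN e bform_vscaler.
rewrite IHc; ring.
Qed.

End Krylov.

Section Naturality.
Variables (R S : comNzRingType) (f : {rmorphism R -> S}).
Local Notation V := (positive -> R).

Lemma zr_rmorph c : f (zr c) = zr c.
Proof. exact: rmorph_int. Qed.

Lemma map_lform l (x : V) : f (lform l x) = lform l (f \o x).
Proof.
by rewrite /lform rmorph_sum; apply: eq_bigr => e _; rewrite rmorphM /= zr_rmorph.
Qed.

Lemma map_bform l (x y : V) : f (bform l x y) = bform l (f \o x) (f \o y).
Proof.
by rewrite /bform rmorph_sum; apply: eq_bigr => e _; rewrite !rmorphM /= zr_rmorph.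
Qed.

Lemma map_wapp w (x : V) : f \o wapp w x = wapp w (f \o x).
Proof.
by apply: functional_extensionality => k; rewrite /= -!sformP map_lform.
Qed.

Lemma map_brk T (x y : V) : f \o brk T x y = brk T (f \o x) (f \o y).
Proof. by apply: functional_extensionality => k; rewrite /= /brk map_bform. Qed.

Lemma map_lcomb a (x y : V) : f \o lcomb a x y = lcomb (f a) (f \o x) (f \o y).
Proof. by apply: functional_extensionality => k; rewrite /= rmorphD rmorphM. Qed.

Lemma map_vzero : f \o vzero R = vzero S.
Proof. by apply: functional_extensionality => k; rewrite /= rmorph0. Qed.

Lemma map_hvs M N cs (v : V) :
  map (comp f) (hvs M N cs v) = hvs M N cs (f \o v).
Proof.
elim: cs => //= c cs IH; rewrite !map_lcomb rmorphN !zr_rmorph -IH; congr (lcomb _ _ _ :: _).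
rewrite rmorph1 !map_wapp /smap.
by case: (hvs _ _ _ _) => //=; rewrite map_vzero.
Qed.

Lemma map_uvec y (hs : seq V) : f \o uvec y hs = uvec (f y) (map (comp f) hs).
Proof. by elim: hs => [|h hs IH] /=; rewrite ?map_vzero // map_lcomb IH. Qed.

Lemma map_evec M z' y (hs : seq V) :
  f \o evec M z' y hs = evec M (f z') (f y) (map (comp f) hs).
Proof. by rewrite /evec map_lcomb rmorphN map_wapp map_uvec behead_map rmorphB zr_rmorph. Qed.

End Naturality.

Section TreeSemantics.
Variables (R : comNzRingType) (red : Z -> Z).
Hypothesis redP : forall c, zr (red c) = zr c :> R.
Hypothesis red0 : red Z0 = Z0.

Definition tvec (t : ptree Z) : positive -> R := fun k => zr (pget Z0 t k).

Lemma tvec_app o t : tvec (tapp o t) = sapp o (tvec t).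
Proof.
apply: functional_extensionality => k; rewrite /tvec pget_upd /sapp.
by case: Pos.eqb_spec => // ->; rewrite zrD zrM.
Qed.

Lemma tvec_wapp w t : tvec (twapp w t) = wapp w (tvec t).
Proof. by elim: w => //= o w <-; rewrite tvec_app. Qed.

Lemma tvec_comb a t t' : tvec (tcomb a t t') = lcomb (zr a) (tvec t) (tvec t').
Proof.
apply: functional_extensionality => k; rewrite /tvec /lcomb.
elim: t t' k => [|l IHl v r IHr] t' k /=; first by rewrite zr0 mulr0 add0r.
have E u : pget Z0 PE u = Z0 by case: u.
case: t' => [|l' v' r']; case: k => [k|k|] /=; rewrite ?IHl ?IHr ?E ?zrD ?zrM ?zr0 ?addr0 //.
Qed.

Lemma tvec_red t : tvec (tred red t) = tvec t.
Proof.
apply: functional_extensionality => k; rewrite /tvec.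
by elim: t k => [|l IHl v r IHr] [k|k|] //=.
Qed.

Lemma forcingE (A : Type) t (k : ptree Z -> A) : forcing t k = k t.
Proof. by rewrite /forcing; case: ifP. Qed.

Variables (M N : seq term2) (v0 : ptree Z).

Lemma tvec_step c h :
  tvec (tstep red M N v0 c h) = lcomb (zr c) (tvec v0)
      (lcomb (- zr krylov_shift) (tvec h) (smap M N (tvec h))).
Proof. by rewrite /tstep tvec_red !tvec_comb !tvec_wapp zrN. Qed.

Lemma tvec_PE : tvec PE = vzero R.
Proof. by apply: functional_extensionality => -[k|k|]. Qed.

Lemma tvec_list cs :
  map tvec (tlist red M N v0 cs) = hvs M N cs (tvec v0).
Proof.
elim: cs => //= c cs IH; rewrite forcingE /= tvec_step -IH.
by case: (tlist _ _ _ _ _) => //=; rewrite tvec_PE.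
Qed.

Lemma thead_list cs : thead red M N v0 cs = head PE (tlist red M N v0 cs).
Proof. by elim: cs => //= c cs ->; rewrite !forcingE. Qed.

Lemma tvec_head cs :
  tvec (thead red M N v0 cs) = head (vzero R) (hvs M N cs (tvec v0)).
Proof.
by rewrite -tvec_list thead_list; case: (tlist _ _ _ _ _) => //=; rewrite tvec_PE.
Qed.

Lemma tvec_uvec y hs : tvec (tuvec red y hs) = uvec (zr y) (map tvec hs).
Proof.
elim: hs => [|h hs IH] /=; first exact: tvec_PE.
by rewrite forcingE /= tvec_red tvec_comb IH.
Qed.

Lemma tvec_evec z' y hs :
  tvec (tevec red M z' y hs) = evec M (zr z') (zr y) (map tvec hs).
Proof.
by rewrite /tevec tvec_red tvec_comb tvec_wapp tvec_uvec -behead_map zrN zrB.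
Qed.

Lemma tbformP T K v x y :
  zr (tbform T K v x y) = bform K (tvec v) (brk T (tvec x) (tvec y)) :> R.
Proof.
rewrite /tbform /bform; elim: K => [|e K IH]; first by rewrite big_nil zr0.
rewrite big_cons -IH /=.
set c := pget Z0 v e.1.1; set s := foldr _ _ _; set q := foldr _ _ (pget _ T _).
have -> : brk T (tvec x) (tvec y) e.1.2 = zr q.
  rewrite /brk /bform {}/q; elim: (pget _ T _) => [|g l IHl]; first by rewrite big_nil zr0.
  by rewrite big_cons IHl /= zrD !zrM.
have -> : tvec v e.1.1 = zr c by [].
case: Z.eqb_spec => [-> | _]; first by rewrite zr0 mul0r mulr0 add0r.
by rewrite zrD !zrM.
Qed.

End TreeSemantics.

(** * The automorphism m and the polynomial Q *)

Lemma letters_check : dom_table 248 e8_bracket && all letter_check letters.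
Proof. by vm_compute. Qed.

Lemma krylov_ok : krylov_check.
Proof. by vm_compute. Qed.

Lemma relation_ok : relation_check.
Proof. by vm_compute. Qed.

Opaque e8_bracket e8_form adjoint exp_word letters krylov0 Q_coefs Q_taylor.

Section Automorphism.
Variable R : fieldType.
Hypotheses (two : (2 : R) != 0) (three : (3 : R) != 0).
Local Notation V := (positive -> R).

Lemma exp_words_cons e l :
  exp_words (e :: l) = exp_word e.1 (adjoint e.1 e.2) ++ exp_words l.
Proof. by []. Qed.

Lemma letter_checkP e : letter_check e ->
  [/\ exp_check 248 (adjoint e.1 e.2) (exp_word e.1 (adjoint e.1 e.2)),
      cube_check 248 (adjoint e.1 e.2), der_check 248 (adjoint e.1 e.2) e8_bracket
    & skew_check (adjoint e.1 e.2) e8_form].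
Proof. by move/and4P => h; exact: h. Qed.

Lemma Mword_brk (x y : V) :
  wapp Mword (brk e8_bracket x y) = brk e8_bracket (wapp Mword x) (wapp Mword y).
Proof.
case/andP: letters_check => dT; rewrite /Mword; elim: (letters) => [//|e l IH].
case/andP => /letter_checkP[ec cc dc _] /IH {}IH.
rewrite exp_words_cons; move: (exp_word _ _) ec => w ec.
by rewrite !wapp_cat IH (exp_brk two three ec cc dT dc).
Qed.

Lemma Mword_form (x y : V) :
  bform e8_form (wapp Mword x) (wapp Mword y) = bform e8_form x y.
Proof.
case/andP: letters_check => _; rewrite /Mword.
elim: (letters) x y => [//|e l IH] x y /andP[/letter_checkP[ec cc _ sc] /IH {}IH].
rewrite exp_words_cons; move: (exp_word _ _) ec => w ec.
by rewrite !wapp_cat (exp_form two ec cc sc) IH.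
Qed.

Lemma Mword_elem : all elem_op Mword.
Proof.
case/andP: letters_check => _; rewrite /Mword.
elim: (letters) => [//|e l IH /andP[/letter_checkP[ec _ _ _] /IH {}IH]].
rewrite exp_words_cons; move: (exp_word _ _) ec => w ec; rewrite all_cat IH andbT.
by case/andP: ec => /andP[/andP[-> _] _] _.
Qed.

Lemma Mword_inv (x : V) : wapp Mword (wapp Nword x) = x.
Proof. exact: wapp_inv Mword_elem. Qed.

Lemma Nword_inv (x : V) : wapp Nword (wapp Mword x) = x.
Proof.
by rewrite -{1}(inv_wordK Mword); apply: wapp_inv; apply: inv_word_elem Mword_elem.
Qed.

End Automorphism.

Lemma E8Q_horner (K : comNzRingType) (y : K) :
  (map_poly intr E8polyQ).[y] = \sum_(i < 121) (coefQ i)%:~R * y ^+ i.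
Proof.
have -> : map_poly intr E8polyQ = \poly_(i < 121) (coefQ i)%:~R :> {poly K}.
  apply/polyP => i; rewrite coef_map /E8polyQ !coef_poly /=.
  by case: ifP => // _; rewrite rmorph0.
exact: horner_poly.
Qed.

Lemma hornerlE (K : comNzRingType) (y : K) cs :
  hornerl y cs = \sum_(i < size cs) zr (nth Z0 cs i) * y ^+ i.
Proof.
elim: cs => [|c cs IH] /=; first by rewrite big_ord0.
rewrite big_ord_recl /= mulr1 IH mulr_sumr; congr (_ + _).
by apply: eq_bigr => i _; rewrite exprS mulrCA.
Qed.

Lemma E8Q_hornerl (K : comNzRingType) (y : K) :
  (map_poly intr E8polyQ).[y] = hornerl y Q_coefs.
Proof. by rewrite E8Q_horner hornerlE. Qed.

Lemma hornerl_addp (K : comNzRingType) (y : K) a b :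
  hornerl y (addp a b) = hornerl y a + hornerl y b.
Proof.
elim: a b => [|c a IH] [|d b] /=; rewrite ?add0r ?addr0 //.
by rewrite IH zrD; ring.
Qed.

Lemma hornerl_taylor (K : comNzRingType) (y : K) :
  hornerl (y - zr krylov_shift) Q_taylor = hornerl y Q_coefs.
Proof.
have -> : Q_taylor = taylor Q_coefs by vm_compute.
elim: Q_coefs => [//|c cs IH].
rewrite -[taylor _]/(addp (c :: taylor cs) (map (Z.mul krylov_shift) (taylor cs))).
rewrite hornerl_addp [hornerl _ (c :: cs)]/= -IH.
have hz d a (x : K) : hornerl x (map (Z.mul d) a) = zr d * hornerl x a.
  by elim: a => [|e a IHa] /=; rewrite ?mulr0 // IHa zrM; ring.
by rewrite hz /=; ring.
Qed.

Lemma E8P_hornerE (K : comNzRingType) (x : K) : (map_poly intr E8polyP).[x]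
  = \sum_(i < 121) (coefQ i)%:~R * (x ^+ (120 - i) * (x ^+ 2 + 1) ^+ i).
Proof.
rewrite /E8polyP rmorph_sum horner_sum; apply: eq_bigr => i _ /=.
rewrite map_polyZ hornerZ; congr (_ * _).
rewrite rmorphM /= map_polyXn hornerM hornerXn; congr (_ * _).
rewrite rmorphXn /= horner_exp; congr (_ ^+ _).
by rewrite rmorphD rmorph1 /= map_polyXn hornerD hornerXn hornerC.
Qed.

Lemma E8P_horner (K : fieldType) (x : K) : x != 0 ->
  (map_poly intr E8polyP).[x] = x ^+ 120 * (map_poly intr E8polyQ).[x + x^-1].
Proof.
move=> x0; rewrite E8Q_horner E8P_hornerE mulr_sumr; apply: eq_bigr => i _.
have -> : x ^+ 2 + 1 = x * (x + x^-1) by rewrite mulrDr divff // expr2.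
have -> : x ^+ 120 = x ^+ (120 - i) * x ^+ i by rewrite -exprD subnK // -ltnS.
by rewrite exprMn mulrCA -!mulrA; congr (_ * _); rewrite mulrCA.
Qed.

Lemma E8P_0 (K : fieldType) : (map_poly intr E8polyP).[0 : K] = 1.
Proof.
rewrite E8P_hornerE big_ord_recr /= big1 ?add0r => [|i _].
  by rewrite subnn expr0 expr0n add0r expr1n !mulr1.
by rewrite expr0n subn_eq0 leqNgt (ltn_ord i) mul0r mulr0.
Qed.

Lemma E8P_root (K : fieldType) (x : K) :
  root (map_poly intr E8polyP) x = (x != 0) && root (map_poly intr E8polyQ) (x + x^-1).
Proof.
rewrite /root; have [-> | x0] := eqVneq x 0; first by rewrite E8P_0 oner_eq0.
by rewrite E8P_horner // mulf_eq0 expf_eq0 (negbTE x0).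
Qed.

Lemma E8P_rootV (K : fieldType) (x : K) :
  root (map_poly intr E8polyP) x -> root (map_poly intr E8polyP) x^-1.
Proof. by rewrite !E8P_root invr_eq0 invrK addrC. Qed.

Lemma thead_zero (R : comNzRingType) M N t cs :
  pall (fun _ v => Z.eqb v Z0) (thead id M N t cs) ->
  head (vzero R) (hvs M N cs (tvec R t)) = vzero R.
Proof.
move=> h; rewrite -(tvec_head (red := id)) //; apply: functional_extensionality => k.
rewrite /tvec; have := pallP (y0 := Z0) (fun _ => erefl) h k.
by move=> /Z.eqb_eq ->.
Qed.

(** * One multiplicative relation in characteristic 0 *)

Lemma brk_eigen (R : comNzRingType) M T (x y : positive -> R) a b :
  (forall u v : positive -> R, wapp M (brk T u v) = brk T (wapp M u) (wapp M v)) ->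
  wapp M x = vscale a x -> wapp M y = vscale b y ->
  wapp M (brk T x y) = vscale (a * b) (brk T x y).
Proof.
move=> hM ex ey; rewrite hM ex ey; apply: functional_extensionality => k.
by rewrite /brk bform_vscalel bform_vscaler /vscale mulrA.
Qed.

(** Defined over any commutative ring, so that it can be formed with the variables of a polynomial
    ring as eigenvalues: its values in characteristic 0 and modulo 61 are then two specializations
    of one integer polynomial. *)
Definition pairing (R : comNzRingType) (M N K : seq term2) (T : sparse2) (cs : seq Z)
    (t : ptree Z) (a a' b b' : R) : R :=
  let hs := hvs M N cs (tvec R t) in
  bform K (tvec R t) (brk T (evec M a' (a + a') hs) (evec M b' (b + b') hs)).

Lemma map_pairing (R S : comNzRingType) (f : {rmorphism R -> S}) M N K T cs t a a' b b' :
  f (pairing M N K T cs t a a' b b') = pairing M N K T cs t (f a) (f a') (f b) (f b').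
Proof.
have ft : f \o tvec R t = tvec S t.
  by apply: functional_extensionality => k; rewrite /= zr_rmorph.
by rewrite /pairing map_bform map_brk !map_evec map_hvs !rmorphD ft.
Qed.

Lemma evz_pairing n (R : comNzRingType) (w : 'I_n -> R) M N K T cs t i i' j j' :
  evz w (pairing M N K T cs t 'X_i 'X_i' 'X_j 'X_j')
  = pairing M N K T cs t (w i) (w i') (w j) (w j').
Proof. by rewrite (map_pairing (evz w)) /= !evzX. Qed.

Lemma zr_mod (F : fieldType) p c : p \in [pchar F] -> zr (Z.modulo c (Z.of_nat p)) = zr c :> F.
Proof.
move=> pF; have p0 : Z.of_nat p <> Z0 by have := prime_gt0 (pcharf_prime pF); lia.
by rewrite {2}(Z.div_mod c _ p0) zrD zrM zr_nat (pcharf0 pF) mul0r add0r.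
Qed.

Section OneRelation.
Variables (L F : fieldType) (n : nat) (z : 'I_n -> L) (zb : 'I_n -> F).
Hypotheses (charL : [pchar L] =i pred0) (charF : 61 \in [pchar F]).
Hypothesis Pz : map_poly intr E8polyP = \prod_i ('X - (z i)%:P).
Hypothesis Pzb : map_poly intr E8polyP = \prod_i ('X - (zb i)%:P).
Hypothesis zzb : forall h : {mpoly int[n]}, evz z h = 0 -> evz zb h = 0.

Let root_index (K : fieldType) (w : 'I_n -> K) x :
  map_poly intr E8polyP = \prod_i ('X - (w i)%:P) ->
  root (map_poly intr E8polyP) x -> exists i, x = w i.
Proof.
move=> ->; rewrite /root horner_prod prodf_seq_eq0 => /hasP[i _ /=].
by rewrite hornerXsubC subr_eq0 => /eqP; exists i.
Qed.

Let root_z i : root (map_poly intr E8polyP) (z i).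
Proof. by rewrite Pz /root horner_prod (bigD1 i) //= hornerXsubC subrr mul0r. Qed.

(* Eigenvectors v_z, v_w of m for the eigenvalues reducing to 5 and 15 modulo 61
   have a nonzero bracket, which is an eigenvector of m for z w. *)
Lemma one_relation : exists i j, root (map_poly intr E8polyP) (z i * z j).
Proof.
have mod61P c : zr (mod61 c) = zr c :> F by exact: (zr_mod c charF).
have z61 (a b : Z) : mod61 (Z.sub a b) = Z0 -> zr a = zr b :> F.
  by move=> /(congr1 (@zr F)); rewrite mod61P /Z.sub zrD zrN => /subr0_eq.
have mod61_neq0 c : ~~ Z.eqb (mod61 c) Z0 -> zr (mod61 c) != 0 :> F.
  have := Z.mod_pos_bound c 61 (erefl _); rewrite -/(mod61 c).
  move: (mod61 c) => m [m0 m61] /negbTE/Z.eqb_neq m1.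
  have -> : m = Z.of_nat (Z.to_nat m) by lia.
  by rewrite zr_nat -(dvdn_pcharf charF) gtnNdvd //; lia.
have inv5 : zr 5 * zr 49 = 1 :> F by rewrite -zrM -zr1; apply: z61.
have inv15 : zr 15 * zr 57 = 1 :> F by rewrite -zrM -zr1; apply: z61.
have zinv (i : 'I_n) : exists i', z i * z i' = 1.
  have [i' i'E] := root_index Pz (E8P_rootV (root_z i)); exists i'.
  by rewrite -i'E divff //; have := root_z i; rewrite E8P_root => /andP[].
have zbinv i i' : z i * z i' = 1 -> zb i * zb i' = 1.
  move=> e; apply/eqP; rewrite -subr_eq0; apply/eqP.
  have := zzb (h := 'X_i * 'X_i' - 1); rewrite !rmorphB !rmorphM !rmorph1 /= !evzX.
  by apply; rewrite e subrr.
(* A residue a with inverse a' and Q(a + a') = 0 modulo 61 is the reduction of some root of P, whose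
   inverse then reduces to a'. *)
have lift (a a' : Z) : zr a * zr a' = 1 :> F ->
    hornerl (zr (Z.add a a') : F) Q_coefs = 0 ->
    exists i i', [/\ z i * z i' = 1, zb i = zr a & zb i' = zr a'].
  move=> aa' h; have a0 : (zr a : F) != 0.
    by apply/negP => /eqP a0; move/eqP: aa'; rewrite a0 mul0r eq_sym oner_eq0.
  have aV : (zr a)^-1 = zr a' :> F by rewrite -[RHS]mul1r -(mulVf a0) -mulrA aa' mulr1.
  have [|i iE] := root_index (x := zr a) Pzb.
    by rewrite E8P_root a0 aV -zrD /root E8Q_hornerl h eqxx.
  have [i' ii'] := zinv i; exists i, i'; split=> //.
  by rewrite -aV iE -[RHS](mulr1) -(zbinv _ _ ii') mulKf // -iE.
have hornerlZ (K : comNzRingType) c cs : hornerl (zr c : K) cs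
    = zr (foldr (fun d r => Z.add d (Z.mul c r)) Z0 cs).
  by elim: cs => [|d cs IH] //=; rewrite IH zrD zrM.
have [i [i' [ii' zi zi']]] : exists i i', [/\ z i * z i' = 1, zb i = zr 5 & zb i' = zr 49].
  apply: lift => //; rewrite hornerlZ -(zr0 F); apply: z61.
  by vm_compute.
have [j [j' [jj' zj zj']]] : exists i i', [/\ z i * z i' = 1, zb i = zr 15 & zb i' = zr 57].
  apply: lift => //; rewrite hornerlZ -(zr0 F); apply: z61.
  by vm_compute.
exists i, j.
pose val (R : comNzRingType) (a a' b b' : R) :=
  pairing Mword Nword e8_form e8_bracket Q_taylor krylov0 a a' b b'.
have valF : val F (zb i) (zb i') (zb j) (zb j') != 0.
  rewrite zi zi' zj zj' /val /pairing.
  have -> : zr 5 + zr 49 = zr 54 :> F by rewrite -zrD.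
  have -> : zr 15 + zr 57 = zr 11 :> F by rewrite -zrD; apply: z61.
  rewrite -!(tvec_list mod61P) -!(tvec_evec mod61P) // -tbformP -mod61P.
  apply: mod61_neq0; exact: relation_ok.
(* A vanishing pairing in L would be an integral relation between the roots and would persist modulo
   61. *)
have valL : val L (z i) (z i') (z j) (z j') != 0.
  apply: contra valF => /eqP e; apply/eqP.
  rewrite /val -evz_pairing; apply: zzb; rewrite evz_pairing; exact: e.
pose v0 := tvec L krylov0; pose hs := hvs Mword Nword Q_taylor v0.
have h0 : head (vzero L) hs = vzero L by apply: thead_zero; exact: krylov_ok.
have char0 q : (q.+1%:R : L) != 0.
  by apply/negP => /(natf0_pchar (ltn0Sn q))[p]; rewrite charL.
have MN := @Mword_inv L; have NM := @Nword_inv L.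
have Q0 k k' : z k * z k' = 1 -> hornerl (z k + z k' - zr krylov_shift) Q_taylor = 0.
  move=> kk'; have := root_z k; rewrite E8P_root => /andP[k0].
  have -> : (z k)^-1 = z k' by rewrite -[RHS]mul1r -(mulVf k0) -mulrA kk' mulr1.
  by rewrite hornerl_taylor /root E8Q_hornerl => /eqP.
have ei := evec_eigen MN ii' h0 (Q0 _ _ ii').
have ej := evec_eigen MN jj' h0 (Q0 _ _ jj').
have ex := brk_eigen (Mword_brk (char0 1%N) (char0 2%N)) ei ej.
have ll' : z i * z j * (z i' * z j') = 1 by rewrite mulrACA ii' jj' mulr1.
have inv := Mword_form (char0 1%N).
have := dual_horner MN NM inv v0 Q_taylor ll' ex.
rewrite -/hs h0 {1}/bform big1 => [|e _]; last by rewrite mul0r mulr0.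
move/esym/eqP; rewrite mulf_eq0 (negbTE valL) orbF hornerl_taylor => Ql.
rewrite E8P_root; have l0 : z i * z j != 0.
  by apply/negP => /eqP l0; move/eqP: ll'; rewrite l0 mul0r eq_sym oner_eq0.
have -> : (z i * z j)^-1 = z i' * z j'.
  by rewrite -[RHS]mul1r -(mulVf l0) -mulrA ll' mulr1.
by rewrite l0 /root E8Q_hornerl.
Qed.

End OneRelation.

(** * Factorizations of Q modulo small primes *)

Section ModularPolys.
Variables (p : Z).
Local Open Scope Z_scope.

(* Polynomials modulo a monic f of degree d are lists of length d; f is given by
   its d low coefficients. *)
Definition md (c : Z) := Z.modulo c p.
Definition padd (a b : seq Z) : seq Z := [seq md (e.1 + e.2) | e <- zip a b].
Definition pscale (c : Z) (a : seq Z) : seq Z := [seq md (c * x) | x <- a].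
Definition pmulX (f a : seq Z) : seq Z :=
  if a is x :: s then
    let t := last x s in [seq md (e.1 - t * e.2) | e <- zip (0 :: belast x s) f]
  else [::].
Definition pzero (f : seq Z) : seq Z := nseq (size f) 0.
Definition pone (f : seq Z) : seq Z := md 1 :: nseq (size f).-1 0.
Definition pmul (f a b : seq Z) : seq Z :=
  foldr (fun c r =>
    if r is x :: s then
      let t := last x s in
      [seq md (c * e.1 + (e.2.1 - t * e.2.2)) | e <- zip b (zip (0 :: belast x s) f)]
    else [::]) (pzero f) a.
Fixpoint ppow (f a : seq Z) (e : positive) : seq Z :=
  match e with
  | xH => a
  | xO e' => let s := ppow f a e' in pmul f s s
  | xI e' => let s := ppow f a e' in pmul f a (pmul f s s)
  end.
(* The Frobenius map sends sum_i c_i y^i to sum_i c_i (y^p)^i for c_i in F_p. *)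
Fixpoint ppowers (f b t : seq Z) (n : nat) : seq (seq Z) :=
  if n is n'.+1 then t :: ppowers f b (pmul f b t) n' else [::].
Definition ptable (f : seq Z) : seq (seq Z) :=
  ppowers f (ppow f (pmulX f (pone f)) (Z.to_pos p)) (pone f) (size f).
Definition pfrob (f : seq Z) (tab : seq (seq Z)) (k : nat) : seq Z :=
  iter k (fun a => foldr (fun e r => padd (pscale e.1 e.2) r) (pzero f) (zip a tab))
       (pmulX f (pone f)).

Fixpoint addfull (a b : seq Z) : seq Z :=
  match a, b with
  | [::], _ => b
  | _, [::] => a
  | x :: a', y :: b' => md (x + y) :: addfull a' b'
  end.
Definition mulfull (a b : seq Z) : seq Z :=
  foldr (fun c r => addfull (pscale c b) (0 :: r)) [::] a.

End ModularPolys.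

(* A factor is monic, with low coefficients f_low. Its roots y satisfy y^(p^N) = y for
   the period N, but y^(p^e) <> y for the excluded exponents e, as f_inverse is an
   inverse of the product of the y^(p^e) - y modulo the factor. *)
Record factor := Factor {
  f_low : seq Z; f_period : nat; f_excluded : seq nat; f_inverse : seq Z }.

Definition factor_code g := (f_low g, f_period g, f_excluded g, f_inverse g).
Lemma factor_codeK :
  cancel factor_code (fun c => Factor c.1.1.1 c.1.1.2 c.1.2 c.2).
Proof. by case. Qed.
HB.instance Definition _ := Equality.copy factor (can_type factor_codeK).

Definition excluded_product (p : Z) (f : seq Z) (es : seq nat) : seq Z :=
  let tab := ptable p f in
  foldr (fun e r => pmul p f (padd p (pfrob p f tab e)
                                  (pscale p (Zneg 1) (pfrob p f tab 0))) r)
        (pone p f) es.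

Definition factor_check (p : Z) (g : factor) : bool :=
  let f := f_low g in
  let tab := ptable p f in
  [&& (0 < size f)%N,
      pfrob p f tab (f_period g) == pfrob p f tab 0,
      size (f_inverse g) == size f
    & pmul p f (excluded_product p f (f_excluded g)) (f_inverse g) == pone p f].

Definition monic_list (g : factor) : seq Z := rcons (f_low g) (Zpos 1).

Definition product (p : Z) (gs : seq factor) : seq Z :=
  foldr (fun g r => mulfull p (monic_list g) r) [:: Zpos 1] gs.

(** Irreducibility of the factors is not tested: [f_period] and [f_excluded] alone restrict the
    lengths of the Frobenius cycles on their roots. *)
Definition prime_check (p : Z) (gs : seq factor) : bool :=
  all (factor_check p) gs
  && (product p gs == [seq md p c | c <- Q_coefs]).

Local Open Scope Z_scope.
Definition factors7 : seq factor :=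
  [:: Factor [:: 1; 5; 1; 2] 8%N [:: 2%N] [:: 1; 2; 4; 5];
      Factor [:: 5; 3; 3; 5] 8%N [:: 2%N] [:: 2; 3; 2; 2];
      Factor [:: 1; 3; 3; 4; 1; 3; 0; 1] 8%N [:: 2%N] [:: 3; 4; 2; 0; 6; 6; 2; 6];
      Factor [:: 3; 4; 0; 6; 3; 5; 4; 1] 8%N [:: 2%N] [:: 6; 5; 6; 0; 4; 2; 4; 2];
      Factor [:: 3; 4; 3; 6; 1; 6; 6; 1] 8%N [:: 2%N] [:: 0; 3; 3; 0; 1; 5; 1; 0];
      Factor [:: 4; 4; 6; 3; 3; 5; 0; 5] 8%N [:: 2%N] [:: 3; 0; 6; 2; 4; 4; 3; 3];
      Factor [:: 6; 2; 6; 6; 1; 5; 1; 6] 8%N [:: 2%N] [:: 1; 0; 2; 6; 5; 0; 0; 6];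
      Factor [:: 2; 2; 1; 2; 5; 6; 0; 5] 8%N [:: 2%N] [:: 6; 2; 4; 2; 5; 4; 0; 3];
      Factor [:: 2; 3; 4; 3; 0; 5; 5; 4] 8%N [:: 2%N] [:: 0; 1; 5; 3; 6; 1; 6; 5];
      Factor [:: 3; 5; 0; 4; 0; 1; 6; 6] 8%N [:: 2%N] [:: 0; 3; 4; 6; 6; 3; 3; 4];
      Factor [:: 3; 1; 4; 6; 1; 2; 6; 2] 8%N [:: 2%N] [:: 4; 4; 4; 3; 1; 3; 1; 6];
      Factor [:: 1; 5; 3; 4; 0; 0; 3; 1] 8%N [:: 2%N] [:: 6; 1; 5; 6; 0; 6; 5; 3];
      Factor [:: 5; 6; 2; 0; 5; 5; 6; 0] 8%N [:: 2%N] [:: 0; 3; 5; 0; 5; 1; 6; 5];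
      Factor [:: 1; 6; 2; 4; 4; 3; 5; 5] 8%N [:: 2%N] [:: 0; 1; 0; 0; 1; 5; 1; 3];
      Factor [:: 2; 1; 0; 5; 4; 4; 3; 2] 8%N [:: 2%N] [:: 5; 0; 6; 2; 6; 5; 3; 6];
      Factor [:: 4; 3; 4; 3; 1; 0; 5; 3] 8%N [:: 2%N] [:: 5; 5; 4; 5; 4; 2; 2; 2]].

Definition factors11 : seq factor :=
  [:: Factor [:: 5; 9; 6; 10; 9; 9; 10; 1; 7; 3; 5; 10; 5; 7; 8] 15%N [:: 3%N; 5%N] [:: 3;
        4; 9; 9; 8; 8; 8; 1; 6; 0; 0; 1; 5; 9; 3];
      Factor [:: 2; 6; 9; 8; 10; 5; 6; 7; 7; 1; 6; 0; 7; 9; 6] 15%N [:: 3%N; 5%N] [:: 10; 5;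
        3; 3; 9; 10; 1; 6; 0; 2; 6; 7; 4; 1; 9];
      Factor [:: 3; 0; 8; 5; 0; 6; 7; 7; 8; 5; 1; 0; 5; 10; 9] 15%N [:: 3%N; 5%N] [:: 9; 5;
        3; 8; 0; 4; 3; 2; 3; 7; 3; 1; 10; 3; 8];
      Factor [:: 4; 1; 5; 8; 7; 8; 8; 5; 1; 2; 0; 5; 1; 4; 2] 15%N [:: 3%N; 5%N] [:: 7; 10;
        10; 1; 2; 6; 8; 8; 2; 8; 8; 5; 7; 10; 10];
      Factor [:: 1; 1; 10; 8; 8; 0; 3; 7; 10; 4; 8; 0; 5; 1; 4] 15%N [:: 3%N; 5%N] [:: 10;
        4; 5; 9; 0; 7; 5; 1; 2; 8; 8; 3; 0; 7; 2];
      Factor [:: 10; 6; 8; 6; 7; 3; 0; 0; 8; 1; 1; 3; 3; 2; 2] 15%N [:: 3%N; 5%N] [:: 7; 9;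
        6; 10; 8; 9; 10; 4; 7; 0; 6; 0; 5; 2; 8];
      Factor [:: 8; 5; 5; 10; 9; 10; 1; 6; 8; 4; 7; 3; 0; 10; 3] 15%N [:: 3%N; 5%N] [:: 10;
        4; 8; 4; 0; 8; 9; 0; 9; 10; 1; 8; 3; 1; 3];
      Factor [:: 10; 6; 0; 6; 10; 3; 4; 9; 6; 0; 4; 9; 6; 9; 8] 15%N [:: 3%N; 5%N] [:: 10;
        7; 6; 7; 0; 9; 2; 4; 6; 2; 10; 4; 5; 6; 9]].

Definition factors37 : seq factor :=
  [:: Factor [:: 36] 1%N [::] [:: 1];
      Factor [:: 29; 22; 23; 11; 14; 23; 19] 7%N [:: 1%N] [:: 21; 36; 1; 8; 33; 4; 14];
      Factor [:: 26; 32; 16; 35; 4; 13; 33] 7%N [:: 1%N] [:: 10; 28; 1; 36; 19; 28; 8];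
      Factor [:: 20; 11; 23; 3; 13; 10; 11] 7%N [:: 1%N] [:: 31; 18; 26; 13; 25; 4; 17];
      Factor [:: 4; 29; 33; 28; 17; 5; 10] 7%N [:: 1%N] [:: 15; 15; 12; 27; 4; 10; 34];
      Factor [:: 17; 14; 3; 29; 25; 11; 20] 7%N [:: 1%N] [:: 0; 3; 25; 3; 27; 34; 11];
      Factor [:: 18; 29; 30; 9; 10; 3; 17] 7%N [:: 1%N] [:: 36; 0; 0; 9; 31; 34; 27];
      Factor [:: 3; 10; 32; 0; 18; 18; 16] 7%N [:: 1%N] [:: 30; 20; 35; 10; 5; 29; 15];
      Factor [:: 28; 22; 2; 17; 4; 26; 4] 7%N [:: 1%N] [:: 32; 18; 8; 0; 13; 21; 13];
      Factor [:: 1; 29; 1; 19; 29; 1; 32] 7%N [:: 1%N] [:: 13; 15; 16; 26; 5; 26; 2];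
      Factor [:: 14; 26; 13; 7; 16; 18; 28] 7%N [:: 1%N] [:: 21; 9; 22; 18; 25; 26; 17];
      Factor [:: 20; 29; 3; 10; 29; 24; 31] 7%N [:: 1%N] [:: 14; 10; 25; 26; 33; 22; 11];
      Factor [:: 5; 23; 27; 4; 22; 19; 24] 7%N [:: 1%N] [:: 29; 24; 29; 11; 20; 12; 2];
      Factor [:: 8; 25; 9; 17; 24; 29; 3] 7%N [:: 1%N] [:: 0; 4; 29; 18; 11; 0; 27];
      Factor [:: 25; 1; 2; 4; 10; 25; 13] 7%N [:: 1%N] [:: 13; 27; 15; 11; 0; 25; 36];
      Factor [:: 22; 22; 28; 18; 18; 35; 33] 7%N [:: 1%N] [:: 16; 14; 5; 1; 25; 5; 23];
      Factor [:: 20; 15; 18; 18; 6; 16; 0] 7%N [:: 1%N] [:: 29; 12; 25; 26; 31; 16; 3];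
      Factor [:: 16; 16; 34; 33; 30; 29; 3] 7%N [:: 1%N] [:: 34; 26; 16; 14; 8; 28; 28]].

Definition factors47 : seq factor :=
  [:: Factor [:: 24] 1%N [::] [:: 1];
      Factor [:: 16; 43] 2%N [:: 1%N] [:: 43; 2];
      Factor [:: 24; 28; 1; 6; 35; 37; 11; 10; 12] 9%N [:: 3%N] [:: 43; 33; 40; 5; 37; 31;
        29; 31; 15];
      Factor [:: 12; 10; 19; 36; 13; 6; 5; 10; 16] 9%N [:: 3%N] [:: 17; 3; 46; 4; 16; 19;
        35; 38; 31];
      Factor [:: 20; 41; 7; 19; 13; 21; 5; 6; 19] 9%N [:: 3%N] [:: 22; 6; 35; 44; 40; 10; 4;
        34; 5];
      Factor [:: 19; 46; 38; 3; 45; 18; 33; 10; 17] 9%N [:: 3%N] [:: 14; 17; 21; 21; 23; 9;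
        36; 13; 7];
      Factor [:: 8; 11; 34; 39; 29; 4; 21; 44; 0] 9%N [:: 3%N] [:: 6; 29; 21; 46; 13; 31;
        11; 23; 24];
      Factor [:: 26; 4; 3; 26; 38; 42; 38; 3; 39] 9%N [:: 3%N] [:: 14; 5; 3; 39; 32; 38; 21;
        7; 24];
      Factor [:: 35; 29; 8; 17; 1; 46; 19; 20; 8] 9%N [:: 3%N] [:: 2; 33; 13; 16; 38; 5; 8;
        26; 29];
      Factor [:: 23; 26; 10; 7; 28; 12; 44; 35; 9; 6; 7; 44; 5; 38; 43; 39; 4; 15] 18%N [::
        6%N] [:: 44; 34; 16; 37; 11; 41; 45; 25; 28; 22; 46; 40; 9; 4; 38; 0; 13; 15];
      Factor [:: 31; 34; 40; 21; 9; 3; 3; 21; 12; 25; 12; 31; 2; 2; 30; 10; 40; 41] 18%N [::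
        6%N] [:: 4; 26; 39; 36; 40; 41; 9; 6; 17; 39; 6; 8; 27; 30; 43; 6; 6; 39];
      Factor [:: 36; 42; 16; 27; 17; 4; 38; 2; 8; 22; 7; 23; 29; 35; 38; 7; 31; 46] 18%N [::
        6%N] [:: 34; 2; 15; 6; 46; 4; 5; 35; 15; 22; 8; 27; 41; 39; 39; 18; 24; 32]].

Local Close Scope Z_scope.

Lemma map_hornerl (R S : comNzRingType) (f : {rmorphism R -> S}) y a :
  f (hornerl y a) = hornerl (f y) a.
Proof.
elim: a => [|c a IH] /=; first by rewrite rmorph0.
by rewrite rmorphD rmorphM IH /= zr_rmorph.
Qed.

Section ModularRing.
Variables (R : comNzRingType) (p : nat).
Hypothesis charR : p \in [pchar R].
Let q : Z := Z.of_nat p.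

Lemma zr_md c : zr (md q c) = zr c :> R.
Proof.
have p0 : q <> Z0 by have := prime_gt0 (pcharf_prime charR); rewrite /q; lia.
by rewrite {2}(Z.div_mod c _ p0) zrD zrM zr_nat (pcharf0 charR) mul0r add0r.
Qed.

Lemma hornerl_padd (y : R) a b : size a = size b ->
  hornerl y (padd q a b) = hornerl y a + hornerl y b.
Proof.
elim: a b => [|c a IH] [|d b] //=; first by rewrite addr0.
by case=> /IH e; rewrite -/(padd q a b) e zr_md zrD; ring.
Qed.

Lemma hornerl_pscale (y : R) c a : hornerl y (pscale q c a) = zr c * hornerl y a.
Proof.
by elim: a => [|d a IH] /=; rewrite ?mulr0 // IH zr_md zrM; ring.
Qed.

Lemma hornerl_rcons (y : R) a c :
  hornerl y (rcons a c) = hornerl y a + zr c * y ^+ size a.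
Proof.
by elim: a => [|d a IH] /=; rewrite ?mulr0 ?mulr1 ?addr0 ?add0r // IH exprS; ring.
Qed.

Lemma hornerl_addfull (y : R) a b :
  hornerl y (addfull q a b) = hornerl y a + hornerl y b.
Proof.
elim: a b => [|c a IH] [|d b] /=; rewrite ?add0r ?addr0 //.
by rewrite IH zr_md zrD; ring.
Qed.

Lemma hornerl_mulfull (y : R) a b :
  hornerl y (mulfull q a b) = hornerl y a * hornerl y b.
Proof.
elim: a => [|c a IH]; first by rewrite mul0r.
by rewrite /mulfull /= -/(mulfull q a b) hornerl_addfull hornerl_pscale /= IH zr0; ring.
Qed.

Lemma hornerl_zeros (y : R) n : hornerl y (nseq n Z0) = 0.
Proof. by elim: n => //= n ->; rewrite mulr0 addr0. Qed.

Lemma hornerl_md (y : R) a : hornerl y [seq md q c | c <- a] = hornerl y a.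
Proof. by elim: a => //= c a ->; rewrite zr_md. Qed.

Definition factor_eval (y : R) g := hornerl y (f_low g) + y ^+ size (f_low g).

Lemma prime_checkP gs : prime_check q gs -> forall y : R,
  hornerl y Q_coefs = \prod_(g <- gs) factor_eval y g.
Proof.
case/andP=> _ /eqP e y; rewrite -hornerl_md -e /product.
elim: gs {e} => [|g gs IH] /=; first by rewrite big_nil mulr0 addr0 zr1.
by rewrite hornerl_mulfull IH big_cons /monic_list hornerl_rcons zr1 mul1r.
Qed.

End ModularRing.

Section ModularSemantics.
Variables (F : fieldType) (p : nat).
Hypothesis charF : p \in [pchar F].
Let q : Z := Z.of_nat p.

Let zmd c : zr (md q c) = zr c :> F.
Proof. exact: zr_md. Qed.

Lemma hornerl_zip3 (y : F) c t b l f : size b = size f -> size l = size f ->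
  hornerl y [seq md q (Z.add (Z.mul c e.1) (Z.sub e.2.1 (Z.mul t e.2.2)))
            | e <- zip b (zip l f)]
  = zr c * hornerl y b + (hornerl y l - zr t * hornerl y f).
Proof.
elim: b l f => [|d b IH] [|g l] [|h k] //=; first by move=> _ _; ring.
by case=> sb [sl]; rewrite (IH l k sb sl) zmd !(zrD, zrB, zrM); ring.
Qed.

Lemma hornerl_zip2 (y : F) t l f : size l = size f ->
  hornerl y [seq md q (Z.sub e.1 (Z.mul t e.2)) | e <- zip l f]
  = hornerl y l - zr t * hornerl y f.
Proof.
elim: l f => [|g l IH] [|h k] //=; first by move=> _; ring.
by case=> sl; rewrite (IH k sl) zmd !(zrB, zrM); ring.
Qed.

Lemma pmul_cons f c a b : pmul q f (c :: a) b =
  if pmul q f a b is x :: s then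
    [seq md q (Z.add (Z.mul c e.1) (Z.sub e.2.1 (Z.mul (last x s) e.2.2)))
    | e <- zip b (zip (Z0 :: belast x s) f)]
  else [::].
Proof. by []. Qed.

Section Root.
Variables (y : F) (f : seq Z).
Hypotheses (f_gt0 : (0 < size f)%N) (fy : hornerl y f + y ^+ size f = 0).

Let shift_size x s : size (x :: s) = size f -> size (Z0 :: belast x s) = size f.
Proof. by rewrite /= size_belast. Qed.

Let shiftE x s : size (x :: s) = size f ->
  hornerl y (Z0 :: belast x s) - zr (last x s) * hornerl y f = y * hornerl y (x :: s).
Proof.
move=> sf; rewrite [in RHS]lastI hornerl_rcons size_belast.
by rewrite /= zr0 -[hornerl y f](addrK (y ^+ size f)) fy -sf /= exprS; ring.
Qed.

Lemma hornerl_pmul a b : size b = size f ->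
  size (pmul q f a b) = size f /\ hornerl y (pmul q f a b) = hornerl y a * hornerl y b.
Proof.
move=> sb; elim: a => [|c a [s1 s2]].
  by rewrite /pmul /= size_nseq hornerl_zeros mul0r.
rewrite pmul_cons.
move: (pmul q f a b) s1 s2 => [|x s] s1 s2; first by move: f_gt0; rewrite -s1.
have sl := shift_size s1; split; first by rewrite size_map !size_zip sb sl !minnn.
by rewrite hornerl_zip3 // shiftE // s2 /=; ring.
Qed.

Lemma hornerl_pone : size (pone q f) = size f /\ hornerl y (pone q f) = 1.
Proof.
rewrite /pone /= size_nseq prednK //; split=> //.
by rewrite hornerl_zeros mulr0 addr0 zmd.
Qed.

Lemma hornerl_pmulX a : size a = size f ->
  size (pmulX q f a) = size f /\ hornerl y (pmulX q f a) = y * hornerl y a.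
Proof.
case: a => [|x s] sa; first by move: f_gt0; rewrite -sa.
have sl := shift_size sa; split; first by rewrite size_map size_zip sl minnn.
by rewrite /pmulX hornerl_zip2 // shiftE.
Qed.

Lemma hornerl_ppow a e : size a = size f ->
  size (ppow q f a e) = size f /\ hornerl y (ppow q f a e) = hornerl y a ^+ Pos.to_nat e.
Proof.
move=> sa; elim: e => [e [s1 s2]|e [s1 s2]|] /=; last by rewrite expr1.
- have [t1 t2] := hornerl_pmul (ppow q f a e) s1.
  have [u1 u2] := hornerl_pmul a t1; split=> //; rewrite u2 t2 s2.
  by rewrite Pos2Nat.inj_xI exprS -exprD addnn -mul2n.
- have [t1 t2] := hornerl_pmul (ppow q f a e) s1; split=> //; rewrite t2 s2.
  by rewrite Pos2Nat.inj_xO -exprD addnn -mul2n.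
Qed.

Lemma hornerl_ppowers b t n : size b = size f -> size t = size f ->
  size (ppowers q f b t n) = n /\
  forall i, (i < n)%N -> size (nth [::] (ppowers q f b t n) i) = size f /\
    hornerl y (nth [::] (ppowers q f b t n) i) = hornerl y t * hornerl y b ^+ i.
Proof.
move=> sb; elim: n t => [|n IH] t st //=.
have [t1 t2] := hornerl_pmul b st; have [s1 s2] := IH _ t1.
split=> [|[|i]]; first by rewrite s1.
  by rewrite mulr1.
by move=> /s2[-> ->]; rewrite t2 exprS; split=> //; ring.
Qed.

Lemma frobenius_hornerl (a : seq Z) : hornerl y a ^+ p = hornerl (y ^+ p) a.
Proof.
by rewrite -!(pFrobenius_autE charF) map_hornerl.
Qed.

Lemma hornerl_pfrob k : size (pfrob q f (ptable q f) k) = size f /\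
  hornerl y (pfrob q f (ptable q f) k) = y ^+ (p ^ k).
Proof.
have [o1 o2] := hornerl_pone; have [x1 x2] := hornerl_pmulX o1.
rewrite o2 mulr1 in x2; elim: k => [|k [s1 s2]] //.
have [w1 w2] := hornerl_ppow (Z.to_pos q) x1.
have [t1 t2] := hornerl_ppowers (size f) w1 o1.
have pE : Pos.to_nat (Z.to_pos q) = p.
  by have := prime_gt0 (pcharf_prime charF); rewrite /q; lia.
rewrite w2 o2 x2 pE in t2.
rewrite /pfrob iterS -/(pfrob q f (ptable q f) k) expnSr exprM -s2 frobenius_hornerl.
move: (pfrob q f (ptable q f) k) s1 => a sa.
rewrite /ptable; move: (ppowers _ _ _ _ _) t1 t2 => tab st h.
have h' i : (i < size a)%N -> size (nth [::] tab i) = size f /\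
    hornerl y (nth [::] tab i) = 1 * (y ^+ p) ^+ i by rewrite sa; exact: h.
rewrite -sa in st.
suff gen g : (forall i, (i < size a)%N -> size (nth [::] tab i) = size f /\
    hornerl y (nth [::] tab i) = g * (y ^+ p) ^+ i) ->
    size (foldr (fun e r => padd q (pscale q e.1 e.2) r) (pzero f) (zip a tab)) = size f /\
    hornerl y (foldr (fun e r => padd q (pscale q e.1 e.2) r) (pzero f) (zip a tab))
    = g * hornerl (y ^+ p) a.
  by have [g1 g2] := gen 1 h'; split; [exact: g1 | rewrite g2 mul1r].
move: st {h h' sa}; elim: a tab g => [|c a IH] [|t tab] g //= st h.
  by rewrite size_nseq hornerl_zeros mulr0.
have [g1 g2] := h 0%N isT; rewrite /= mulr1 in g1 g2.
have [|i1 i2] := IH tab (g * y ^+ p) (succn_inj st).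
  by move=> i ia; have [h1 h2] := h i.+1 ia; split=> //; rewrite h2 exprS; ring.
split; first by rewrite size_map size_zip size_map g1 i1 minnn.
by rewrite (hornerl_padd charF) ?size_map ?g1 ?i1 // (hornerl_pscale charF) g2 i2; ring.
Qed.

End Root.

Lemma factor_checkP (y : F) g : factor_check q g ->
  hornerl y (f_low g) + y ^+ size (f_low g) = 0 ->
  y ^+ (p ^ f_period g) = y /\
  forall e, e \in f_excluded g -> y ^+ (p ^ e) <> y.
Proof.
case/and4P=> f0 /eqP per /eqP si inv fy.
have fr k := (hornerl_pfrob f0 fy k).2.
have y1 : y ^+ (p ^ 0) = y by rewrite expn0 expr1.
split; first by rewrite -fr per fr.
move=> e ee ye; move: inv; set l := f_excluded g in ee *.
have [o1 o2] := hornerl_pone y f0.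
have sfr k := (hornerl_pfrob f0 fy k).1.
move=> /eqP /(congr1 (hornerl y)).
have [_ ->] := hornerl_pmul f0 fy (excluded_product q (f_low g) l) si; rewrite o2.
suff -> : hornerl y (excluded_product q (f_low g) l) = 0.
  by rewrite mul0r => /eqP; rewrite eq_sym oner_eq0.
have econs e' l' : excluded_product q (f_low g) (e' :: l') =
    pmul q (f_low g) (padd q (pfrob q (f_low g) (ptable q (f_low g)) e')
      (pscale q (Zneg 1) (pfrob q (f_low g) (ptable q (f_low g)) 0)))
      (excluded_product q (f_low g) l') by [].
have sl l' : size (excluded_product q (f_low g) l') = size (f_low g).
  by elim: l' => [//|e' l' IH]; rewrite econs; exact: (hornerl_pmul f0 fy _ IH).1.
elim: l ee => [//|e' l IH]; rewrite econs inE => ee'.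
have [_ ->] := hornerl_pmul f0 fy (padd q (pfrob q (f_low g) (ptable q (f_low g)) e')
  (pscale q (Zneg 1) (pfrob q (f_low g) (ptable q (f_low g)) 0))) (sl l).
case/predU1P: ee' => [<- | /IH ->]; last by rewrite mulr0.
rewrite (hornerl_padd charF); last by rewrite size_map !sfr.
rewrite (hornerl_pscale charF) !fr ye y1.
by rewrite (_ : zr (Zneg 1) = -1) // mulN1r subrr mul0r.
Qed.

End ModularSemantics.

Lemma check7 : prime_check 7 factors7. Proof. by vm_compute. Qed.
Lemma check11 : prime_check 11 factors11. Proof. by vm_compute. Qed.
Lemma check37 : prime_check 37 factors37. Proof. by vm_compute. Qed.
Lemma check47 : prime_check 47 factors47. Proof. by vm_compute. Qed.

(** * Frobenius cycles on the roots of Q *)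

Lemma card_stable_set (n m : nat) (t : {perm 'I_n}) (A : {set 'I_n}) :
  {in A, forall i, t i \in A} ->
  {in A, forall i k, (0 < k)%N -> iter k t i = i -> (m %| k)%N} -> (m %| #|A|)%N.
Proof.
move=> At Am; have tA : <[t]>%g \subset 'N(A | 'P)%g.
  rewrite cycle_subG !inE /=; apply/subsetP => i iA; rewrite !inE.
  by rewrite /aperm; exact: At.
rewrite -(acts_sum_card_orbit tA); apply: dvdn_sum => B /imsetP[i iA ->].
have -> : orbit 'P%act <[t]>%G i = porbit t i by rewrite porbitE.
apply: (Am i iA #|porbit t i|); last exact: iter_porbit.
by apply/card_gt0P; exists i; apply: porbit_id.
Qed.

Lemma root_prod (F : idomainType) n (yb : 'I_n -> F) i :
  root (\prod_i ('X - (yb i)%:P)) (yb i).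
Proof. by rewrite /root horner_prod (bigD1 i) //= hornerXsubC subrr mul0r. Qed.

Lemma algebraically_closed_char p : prime p ->
  exists F : closedFieldType, p \in [pchar F].
Proof.
move=> pp; have [K [f _]] := countable_algebraic_closure 'F_p.
by exists K; rewrite (fmorph_pchar f) pchar_Fp.
Qed.

Lemma closed_split (F : closedFieldType) n (P : {poly int}) :
  P \is monic -> size P = n.+1 ->
  exists yb : 'I_n -> F, map_poly intr P = \prod_i ('X - (yb i)%:P).
Proof.
move=> Pm Ps; have Pm' : map_poly intr P \is @monic F by exact: monic_map.
have [r rE] := closed_field_poly_normal (map_poly intr P : {poly F}).
rewrite (monicP Pm') scale1r in rE.
have sr : size r = n.
  have := congr1 (fun q : {poly F} => size q) rE; rewrite size_prod_XsubC.
  by rewrite size_map_poly_id0 ?Ps ?(monicP Pm) ?oner_neq0 // => -[].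
exists (fun i : 'I_n => nth 0 r i); rewrite rE (big_nth 0) big_mkord sr.
by [].
Qed.

Section Places.
Variables (L : splittingFieldType rat) (n : nat) (P : {poly int}) (y : 'I_n -> L).
Hypotheses (Pmonic : P \is monic) (y_inj : injective y).
Hypothesis Py : map_poly intr P = \prod_i ('X - (y i)%:P).
Local Notation G := 'Gal({:L} / 1)%g.

Lemma intr_inj_L : injective (intr : int -> L).
Proof.
have injR : injective (in_alg L) by exact: fmorph_inj.
move=> a b; rewrite -!(rmorph_int (in_alg L)) => /injR; exact: intr_inj.
Qed.

Lemma size_P : size P = n.+1.
Proof.
have := congr1 (fun q : {poly L} => size q) Py.
rewrite size_map_poly_id0 ?(monicP Pmonic) ?oner_neq0 // => ->.
have -> : \prod_i ('X - (y i)%:P) = \prod_(i <- enum 'I_n) ('X - (y i)%:P) by rewrite big_enum.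
by rewrite size_prod_XsubC size_enum_ord.
Qed.

Lemma gal_perm s : s \in G -> exists t : {perm 'I_n}, forall i, s (y i) = y (t i).
Proof.
move=> sG; have /fin_all_exists[r rP] i := gal_root Py i sG.
have r_inj : injective r.
  move=> i j rij; have e : s (y i) = s (y j) by rewrite !rP rij.
  exact: (y_inj (fmorph_inj s e)).
by exists (perm r_inj) => i; rewrite permE rP.
Qed.

Lemma place_exists (F : closedFieldType) : exists yb : 'I_n -> F,
  map_poly intr P = \prod_i ('X - (yb i)%:P) /\
  forall h : {mpoly int[n]}, evz y h = 0 -> evz yb h = 0.
Proof.
have [yb ybP] := closed_split F Pmonic size_P.
have [s sP] := specialization_exists intr_inj_L Py ybP.
exists (yb \o s); split=> //; rewrite ybP (reindex_inj (@perm_inj _ s)).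
by apply: eq_bigr.
Qed.

Lemma frobenius_perm p : prime p ->
  exists (F : closedFieldType) (yb : 'I_n -> F) (s : gal_of {:L}) (t : {perm 'I_n}),
  [/\ p \in [pchar F], map_poly intr P = \prod_i ('X - (yb i)%:P), s \in G,
      forall i, s (y i) = y (t i) & forall i, yb i ^+ p = yb (t i)].
Proof.
case/algebraically_closed_char => F charF.
have [yb [ybP yyb]] := place_exists F.
have [s sG sP] := frobenius_lift charF Py yyb.
have [t tP] := gal_perm sG.
by exists F, yb, s, t; split=> // i; apply: sP.
Qed.

End Places.

Lemma iter_frobenius (F : fieldType) n p (yb : 'I_n -> F) (t : {perm 'I_n}) :
  (forall i, yb i ^+ p = yb (t i)) -> forall k i, yb (iter k t i) = yb i ^+ (p ^ k).
Proof.
move=> h; elim=> [|k IH] i; first by rewrite expn0 expr1.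
by rewrite iterS -h IH -exprM expnSr.
Qed.

Lemma fixed_exponent_dvd (R : pzSemiRingType) p c k (x : R) :
  (c %| k)%N -> x ^+ (p ^ c) = x -> x ^+ (p ^ k) = x.
Proof.
case/dvdnP=> j -> xc; elim: j => [|j IH]; first by rewrite mul0n expn0 expr1.
by rewrite mulSn expnD exprM xc IH.
Qed.

(** Bezout in the form u a = v b + gcd(a, b) avoids inverting the Frobenius map. *)
Lemma fixed_gcd (R : pzSemiRingType) p a b (x : R) : (0 < a)%N ->
  x ^+ (p ^ a) = x -> x ^+ (p ^ b) = x -> x ^+ (p ^ gcdn a b) = x.
Proof.
move=> a0 xa xb; have [u v uv _] := egcdnP b a0.
have := fixed_exponent_dvd (dvdn_mull u (dvdnn a)) xa.
by rewrite uv expnD exprM (fixed_exponent_dvd _ xb) // dvdn_mull.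
Qed.

(** Indices are counted, not distinct values, so the argument is by divisibility: the product of the
    linear factors with B(y_i) nonzero is coprime to B, hence divides A. *)
Lemma nonroots_bound (F : fieldType) n (yb : 'I_n -> F) (A B : {poly F}) :
  A * B = \prod_i ('X - (yb i)%:P) ->
  (#|[set i | B.[yb i] != 0%R]| <= (size A).-1)%N.
Proof.
move=> AB; set E := [set i | _].
have A0 : A != 0.
  have : \prod_i ('X - (yb i)%:P) != 0 by rewrite monic_neq0 // monic_prod_XsubC.
  by rewrite -AB mulf_eq0 => /norP[].
have cop : coprimep (\prod_(i in E) ('X - (yb i)%:P)) B.
  elim/big_rec: _ => [|i C]; first exact: coprime1p.
  by rewrite inE => Bi; rewrite coprimepMl => ->; rewrite coprimep_sym coprimep_XsubC /root Bi.
have dv : \prod_(i in E) ('X - (yb i)%:P) %| A.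
  by rewrite -(Gauss_dvdpl _ cop) AB [X in _ %| X](bigID (mem E)) /= dvdp_mulr.
have := dvdp_leq A0 dv; rewrite -big_enum size_prod_XsubC -cardE.
by case: (size A) => // k; rewrite ltnS.
Qed.

(** The power of Frobenius to a divisor of an excluded exponent cannot fix a root, so every other
    divisor of the period has to be a multiple of m. *)
Definition period_multiple (m : nat) (g : factor) : bool :=
  (0 < f_period g)%N && all (fun d => (m %| d)%N || has (fun e => d %| e)%N (f_excluded g))
      (divisors (f_period g)).

Lemma period_dvd (F : fieldType) p m g (x : F) k :
  period_multiple m g -> x ^+ (p ^ f_period g) = x ->
  (forall e, e \in f_excluded g -> x ^+ (p ^ e) <> x) ->
  x ^+ (p ^ k) = x -> (m %| k)%N.
Proof.
case/andP=> N0 mg xN xe xk; have := fixed_gcd N0 xN xk.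
set d := gcdn _ _ => xd.
have dN : d \in divisors (f_period g) by rewrite -dvdn_divisors // dvdn_gcdl.
have /orP[md | /hasP[e eE de]] := allP mg d dN.
  by apply: dvdn_trans md _; apply: dvdn_gcdr.
by case: (xe e eE); apply: fixed_exponent_dvd xd.
Qed.

Lemma size_factor_poly (F : fieldType) g :
  (size (factor_eval ('X : {poly F}) g) <= (size (f_low g)).+1)%N.
Proof.
apply: leq_trans (size_polyD _ _) _; rewrite size_polyXn geq_max leqnn andbT.
suff h a : (size (hornerl ('X : {poly F}) a) <= size a)%N by apply: leq_trans (h _) _.
elim: a => [|c a IH] /=; first by rewrite size_poly0.
apply: leq_trans (size_polyD _ _) _; rewrite geq_max -(zr_rmorph polyC).
rewrite (leq_trans (size_polyC_leq1 _)) //= mulrC.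
have [-> | n0] := eqVneq (hornerl 'X a : {poly F}) 0; first by rewrite mul0r size_poly0.
by rewrite size_mulX.
Qed.

Section Orbits.
Variables (L : splittingFieldType rat) (y : 'I_120 -> L).
Hypothesis y_inj : injective y.
Hypothesis Qy : map_poly intr E8polyQ = \prod_i ('X - (y i)%:P).
Local Notation G := 'Gal({:L} / 1)%g.

(* [C g] is the set of roots of the factor [g] modulo p. *)
Lemma frobenius_classes p gs : prime p -> prime_check (Z.of_nat p) gs ->
  exists (s : gal_of {:L}) (t : {perm 'I_120}) (C : factor -> {set 'I_120}),
  [/\ s \in G /\ (forall i, s (y i) = y (t i)),
      forall g i, (t i \in C g) = (i \in C g),
      forall i, exists2 g, g \in gs & i \in C g,
      forall g m i k, g \in gs -> period_multiple m g -> i \in C g ->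
        (0 < k)%N -> iter k t i = i -> (m %| k)%N
    & forall gs0 gs1, gs = gs0 ++ gs1 ->
        (#|[set i | all (fun g => i \notin C g) gs1]|
         <= sumn [seq size (f_low g) | g <- gs0])%N].
Proof.
move=> pp chk; have [F [yb [s [t [charF Qyb sG st frob]]]]] :=
  frobenius_perm monic_E8polyQ y_inj Qy pp.
exists s, t, (fun g => [set i | factor_eval (yb i) g == 0]); split=> //.
- move=> g i; rewrite !inE -frob /factor_eval -(frobenius_hornerl charF) -exprM mulnC exprM.
  rewrite -!(pFrobenius_autE charF) -rmorphD /= fmorph_eq0.
  by [].
- move=> i; have := root_prod yb i; rewrite -Qyb /root E8Q_hornerl (prime_checkP charF chk).
  by rewrite prodf_seq_eq0 => /hasP[g gE /eqP g0]; exists g; rewrite ?inE ?g0.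
- move=> g m i k gE mg; rewrite inE => /eqP gi k0 ti.
  have gc := allP (proj1 (andP chk)) g gE.
  have [per exc] := factor_checkP charF gc gi.
  by apply: (period_dvd (p := p) mg per exc); rewrite -(iter_frobenius frob) ti.
- move=> gs0 gs1 gsE.
  pose A : {poly F} := \prod_(g <- gs0) factor_eval 'X g.
  pose B : {poly F} := \prod_(g <- gs1) factor_eval 'X g.
  have AB : A * B = \prod_i ('X - (yb i)%:P).
    rewrite -big_cat -gsE /= -Qyb -(prime_checkP (rmorph_pchar polyC charF) chk).
    rewrite -E8Q_hornerl -[RHS]comp_polyXr /comp_poly -map_poly_comp.
    by congr (_.['X]); apply: eq_map_poly => c /=; rewrite rmorph_int.
  have BE i : B.[yb i] = \prod_(g <- gs1) factor_eval (yb i) g.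
    rewrite -horner_evalE rmorph_prod; apply: eq_bigr => g _.
    by rewrite rmorphD rmorphXn /= map_hornerl /= /horner_eval hornerX.
  rewrite (eq_card (B := [set i | B.[yb i] != 0])) => [|i].
    apply: leq_trans (nonroots_bound AB) _; rewrite /A.
    elim: (gs0) => [|g l IH]; first by rewrite big_nil size_poly1.
    rewrite big_cons /=.
    have h := size_polyMleq (factor_eval ('X : {poly F}) g) (\prod_(j <- l) factor_eval 'X j).
    rewrite -subn1 leq_subLR (leq_trans h) // -subn1 leq_subLR.
    rewrite addnA addnA; apply: leq_trans (leq_add (size_factor_poly F g) (leqSpred _)) _.
    by rewrite addSn addnS !add1n addSn !ltnS leq_add2l.
  rewrite !inE BE prodf_seq_eq0 -all_predC; apply: eq_all => g /=.
  by rewrite inE.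
Qed.

Definition stable (t : {perm 'I_120}) (X : {set 'I_120}) := forall i, i \in X -> t i \in X.
Definition conjugation_stable (X : {set 'I_120}) :=
  forall (s : gal_of {:L}) (t : {perm 'I_120}), s \in G -> (forall i, s (y i) = y (t i)) ->
  stable t X.

Lemma card_classes (t : {perm 'I_120}) (C : factor -> {set 'I_120}) (gs : seq factor) m X :
  (forall g i, (t i \in C g) = (i \in C g)) ->
  (forall g m i k, g \in gs -> period_multiple m g -> i \in C g ->
        (0 < k)%N -> iter k t i = i -> (m %| k)%N) ->
  all (period_multiple m) gs -> stable t X ->
  (m %| #|[set i in X | ~~ all (fun g => i \notin C g) gs]|)%N.
Proof.
move=> tC Cm mgs tX; apply: (card_stable_set (t := t)).
  move=> i; rewrite !inE => /andP[/tX -> /=]; congr (~~ _).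
  by apply: eq_all => g; rewrite tC.
move=> i; rewrite inE => /andP[_] /allPn[g gE]; rewrite negbK => iC k.
exact: Cm gE (allP mgs g gE) iC.
Qed.

(** [gs0] holds the exceptional factors. E consists of the indices on no factor of [gs1], and all
    cycles outside E have length divisible by m. *)
Lemma frobenius_mod p gs0 gs1 m : prime p -> prime_check (Z.of_nat p) (gs0 ++ gs1) ->
  all (period_multiple m) gs1 ->
  exists (s : gal_of {:L}) (t : {perm 'I_120}) (E : {set 'I_120}),
  [/\ s \in G, forall i, s (y i) = y (t i), forall i, (t i \in E) = (i \in E),
      (#|E| <= sumn [seq size (f_low g) | g <- gs0])%N
    & forall X, stable t X -> (m %| #|X :\: E|)%N].
Proof.
move=> pp chk mgs; have [s [t [C [[sG st] tC _ Cm CE]]]] := frobenius_classes pp chk.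
exists s, t, [set i | all (fun g => i \notin C g) gs1]; split=> //.
- by move=> i; rewrite !inE; apply: eq_all => g; rewrite tC.
- exact: CE.
move=> X tX; rewrite (eq_card (B := [set i in X | ~~ all (fun g => i \notin C g) gs1])).
  by apply: (card_classes tC _ mgs tX) => g n i k gE; apply: Cm; rewrite mem_cat gE orbT.
by move=> i; rewrite !inE andbC.
Qed.

(** The size is divisible by 15 and by 4, hence is 60 or 120, and it is 0 or 1 modulo 7. Since 60 is
    4 modulo 7, only 120 remains. *)
Lemma stable_full X : conjugation_stable X -> X != set0 -> X = setT.
Proof.
move=> GX X0.
have d15 : (15 %| #|X|)%N.
  have [|s [t [E [sG st _ E0 h]]]] := frobenius_mod (p := 11) (gs0 := [::]) (m := 15) isT check11.
    by vm_compute.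
  rewrite leqn0 cards_eq0 in E0; rewrite -(setD0 X) -(eqP E0).
  exact: h (GX s t sG st).
have d4 : (4 %| #|X|)%N.
  have [|s [t [E [sG st _ E0 h]]]] := frobenius_mod (p := 7) (gs0 := [::]) (m := 4) isT check7.
    by vm_compute.
  rewrite leqn0 cards_eq0 in E0; rewrite -(setD0 X) -(eqP E0).
  exact: h (GX s t sG st).
have m7 : (#|X| %% 7 <= 1)%N.
  have [|s [t [E [sG st _ E1 h]]]] :=
    frobenius_mod (p := 37) (gs0 := [:: head (Factor [::] 0 [::] [::]) factors37])
      (gs1 := behead factors37) (m := 7) isT check37.
    by vm_compute.
  rewrite -(cardsID E) -modnDmr (eqP (h X (GX s t sG st))) addn0.
  apply: leq_trans (leq_mod _ _) _; apply: leq_trans E1.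
  by rewrite subset_leq_card // subsetIr.
apply/eqP; rewrite eqEcard subsetT cardsT card_ord.
by move: X0; rewrite -card_gt0; lia.
Qed.

(* The Frobenius element at 37 fixes one index and moves the others in cycles of length
   7, so the common size is a multiple of 7. The one at 47 fixes one index, swaps two,
   and has cycles of length 9 and 18 elsewhere, so the size is 0 or 2 modulo 9. *)
Lemma neighbours_card (N : 'I_120 -> {set 'I_120}) :
  (forall (s : gal_of {:L}) (t : {perm 'I_120}), s \in G -> (forall i, s (y i) = y (t i)) ->
    forall i j, j \in N i -> t j \in N (t i)) ->
  (forall i, i \notin N i) -> (exists i, N i != set0) ->
  (forall i, #|N i| <= 56)%N -> forall i, #|N i| = 56%N.
Proof.
move=> GN irr [i1 N1] N56.
(* The indices with at least as many neighbours as i form an invariant set containing i, hence all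
   indices: the graph is regular. *)
have le i k : (#|N i| <= #|N k|)%N.
  suff : [set k | (#|N i| <= #|N k|)%N] = setT by move=> /setP/(_ k); rewrite !inE.
  apply: stable_full; last by apply/set0Pn; exists i; rewrite inE.
  move=> s t sG st j; rewrite !inE => /leq_trans; apply.
  rewrite -(card_imset _ (@perm_inj _ t)); apply: subset_leq_card.
  by apply/subsetP => _ /imsetP[l lj ->]; apply: GN sG st _ _ lj.
have cE i k : #|N i| = #|N k| by apply/eqP; rewrite eqn_leq !le.
have fixN (t : {perm 'I_120}) s i : s \in G -> (forall i, s (y i) = y (t i)) -> t i = i ->
    stable t (N i).
  by move=> sG st ti j jN; rewrite -{1}ti; apply: GN sG st _ _ jN.
have d7 : (7 %| #|N i1|)%N.
  have [|s [t [E [sG st tE E1 h]]]] :=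
    frobenius_mod (p := 37) (gs0 := [:: head (Factor [::] 0 [::] [::]) factors37])
      (gs1 := behead factors37) (m := 7) isT check37.
    by vm_compute.
  (* 120 is 1 modulo 7, so E cannot be empty. *)
  have /cards1P[i0 Ei0] : #|E| == 1%N.
    have := h setT (fun i _ => in_setT (t i)); rewrite setTD.
    by have := cardsC E; rewrite card_ord; move: E1 => /=; lia.
  have ti : t i0 = i0 by apply/set1P; rewrite -Ei0 tE Ei0 set11.
  rewrite (cE _ i0); have := h _ (fixN t s i0 sG st ti).
  by rewrite Ei0 (setDidPl _) // disjoint_sym disjoints1 irr.
have d9 : (#|N i1| %% 9 \in [:: 0; 2])%N.
  have [s [t [C [[sG st] tC allC Cm CE]]]] := frobenius_classes (p := 47) isT check47.
  pose f1 := head (Factor [::] 0 [::] [::]) factors47.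
  pose f2 := head (Factor [::] 0 [::] [::]) (behead factors47).
  pose gs' := behead (behead factors47).
  have fE : factors47 = [:: f1, f2 & gs'] by [].
  rewrite fE in Cm CE.
  pose E1 := [set i | all (fun g => i \notin C g) (f2 :: gs')].
  pose E2 := [set i | all (fun g => i \notin C g) gs'].
  pose D (X : {set 'I_120}) := [set i in X | (i \in E2) && (i \in C f2)].
  have E1_le : (#|E1| <= 1)%N by exact: (CE [:: f1] (f2 :: gs')).
  have E2_le : (#|E2| <= 3)%N by exact: (CE [:: f1; f2] gs').
  have tE1 i : (t i \in E1) = (i \in E1) by rewrite !inE; apply: eq_all => g; rewrite tC.
  have tE2 i : (t i \in E2) = (i \in E2) by rewrite !inE; apply: eq_all => g; rewrite tC.
  have inE1 i : (i \in E1) = (i \notin C f2) && (i \in E2) by rewrite !in_set.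
  have E12 : E1 \subset E2 by apply/subsetP => i; rewrite inE1 => /andP[].
  have cardX X : stable t X ->
      [/\ #|X| = (#|X :&: E1| + #|D X| + #|X :\: E2|)%N, (2 %| #|D X|)%N,
          (9 %| #|X :\: E2|)%N & (#|D X| <= 3)%N].
    move=> tX; split.
    - rewrite -(cardsID E2 X) -(cardsID E1 (X :&: E2)) -setIA (setIidPr E12).
      congr (_ + _ + _)%N; apply: eq_card => i; rewrite in_setD in_setI [in RHS]in_set inE1.
      by case: (i \in X); case: (i \in C f2); case: (i \in E2).
    - apply: (card_stable_set (t := t)).
        by move=> i; rewrite inE => /and3P[/tX tiX iE iC]; rewrite inE tiX tE2 iE tC.
      move=> i; rewrite inE => /and3P[_ _ iC] k; apply: (Cm f2 2%N i k _ _ iC); last by vm_compute.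
      by rewrite in_cons in_cons eqxx orbT.
    - rewrite (eq_card (B := [set i in X | ~~ all (fun g => i \notin C g) gs'])).
        apply: (card_classes (t := t) tC _ _ tX); last by vm_compute.
        by move=> g m i k gE; apply: Cm; rewrite in_cons in_cons gE !orbT.
      by move=> i; rewrite !inE andbC.
    by apply: leq_trans E2_le; apply: subset_leq_card; apply/subsetP => i; rewrite inE => /and3P[].
  have [|cT dT nT bT] := cardX setT; first by move=> i; rewrite !inE.
  rewrite cardsT card_ord setTI in cT.
  (* 120 is 3 modulo 9, the part on the quadratic factor has size 0 or 2 and E1 has at most one
     element; so the sizes are 2 and 1. *)
  have /cards1P[i0 Ei0] : #|E1| == 1%N.
    move: cT dT nT bT E1_le; move: (#|E1|) (#|D setT|) (#|setT :\: E2|) => a b c; clear.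
    by lia.
  have ti : t i0 = i0 by apply/set1P; rewrite -Ei0 tE1 Ei0 set11.
  have [] := cardX _ (fixN t s i0 sG st ti).
  rewrite (cE i1 i0) Ei0; have -> : N i0 :&: [set i0] = set0.
    by apply/eqP; rewrite setI_eq0 disjoint_sym disjoints1 irr.
  rewrite cards0 !inE; move: (#|N i0|) (#|D _|) (#|_ :\: E2|) => a b c; clear.
  by lia.
(* The multiples 7, 14, ..., 56 of 7 are 7, 5, 3, 1, 8, 6, 4, 2 modulo 9: only 56 has residue 0 or
   2. *)
by move: d7 d9 N1 (N56 i1); rewrite -card_gt0 !inE => ? ? ? ? i; rewrite (cE i i1); lia.
Qed.

End Orbits.

(** * The roots of P modulo 27813337 *)

Local Open Scope Z_scope.
Definition p1 : Z := 27813337.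

(* (a, b) stands for a + b sqrt 5 in the field with p1^2 elements. *)
Definition pair_mul (x y : Z * Z) : Z * Z :=
  (Z.modulo (x.1 * y.1 + 5 * (x.2 * y.2)) p1, Z.modulo (x.1 * y.2 + x.2 * y.1) p1).
Definition pair_add (x y : Z * Z) : Z * Z :=
  (Z.modulo (x.1 + y.1) p1, Z.modulo (x.2 + y.2) p1).
Definition pair_conj (x : Z * Z) : Z * Z := (x.1, Z.modulo (Z.opp x.2) p1).
Definition pair_eqb (x y : Z * Z) : bool := Z.eqb x.1 y.1 && Z.eqb x.2 y.2.
Definition pair_nontrivial (x : Z * Z) : bool :=
  [&& Z.leb 0 x.1, Z.ltb x.1 p1, Z.leb 0 x.2, Z.ltb x.2 p1 & ~~ pair_eqb x (1, 0)].
Fixpoint pair_pow (x : Z * Z) (e : positive) : Z * Z :=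
  match e with
  | xH => x
  | xO e' => let s := pair_pow x e' in pair_mul s s
  | xI e' => let s := pair_pow x e' in pair_mul x (pair_mul s s)
  end.
Definition pair_step (y r : Z * Z) (c : Z) : Z * Z :=
  (Z.modulo (c + (y.1 * r.1 + 5 * (y.2 * r.2))) p1, Z.modulo (y.1 * r.2 + y.2 * r.1) p1).
Definition pair_horner (y : Z * Z) (cs : seq Z) : Z * Z :=
  foldr (fun c r => pair_step y r c) (0, 0) cs.

Definition Q_residues : seq Z := Eval vm_compute in [seq Z.modulo c p1 | c <- Q_coefs].

(* Discrete logarithms are taken in the subgroup of order log_order, which divides
   p1^2 - 1. *)
Definition log_order : positive := 919826821.
(** The cofactor (p1^2 - 1) / [log_order]. *)
Definition log_exponent : positive := 841008.
Definition log_base : Z * Z := (8720143, 2920592).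
Definition log_add (a b : Z) : Z :=
  let s := a + b in if s <? Zpos log_order then s else s - Zpos log_order.

Record label := Label { l_val : Z * Z; l_log : Z; l_root : seq Z }.
Definition label0 := Label (1, 0) 0 [::].
Definition label_mul (x y : label) : label :=
  Label (pair_mul (l_val x) (l_val y)) (log_add (l_log x) (l_log y))
        (addl (l_root x) (l_root y)).

(* Values of the roots of P attached to the simple roots, and their inverses. *)
Definition simple_labels : seq label :=
  [seq Label e.1.1 e.1.2 e.2 | e <- zip (zip
    [:: (19219581, 0); (23773437, 12884737); (22824564, 12411568); (3038253, 7166312);
        (5554659, 26853463); (10266342, 774482); (15909669, 23357132); (23527796, 7584725)]
    [:: 83440014; 712012049; 271596723; 172565193; 866673495; 179800031; 342446375;
        326929393]) simple2].
Definition opposite_labels : seq label :=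
  [seq Label e.1.1 e.1.2 e.2 | e <- zip (zip
    [:: (11292461, 0); (23773437, 14928600); (13662815, 9014694); (3038253, 20647025);
        (5554659, 959874); (10266342, 27038855); (15909669, 4456205); (23527796, 20228612)]
    [:: 836386807; 207814772; 648230098; 747261628; 53153326; 740026790; 577380446;
        592897428]) (map oppl simple2)].

Definition labels : seq label := Eval vm_compute in
  grow label0 label0 label_mul simple_labels simple_labels root_steps ++
  grow label0 label0 label_mul opposite_labels opposite_labels root_steps.

Definition log_key (h : Z) : positive := Z.to_pos (h + 1).
(** The 240^2 products are looked up by adding logarithms modulo [log_order]. A hit is the only way
    in which z_a z_b = z_c can hold, so it is enough to test a + b = c on the hits. *)
Definition log_tree : ptree (seq Z) :=
  foldr (fun e t => pupd [::] t (log_key (l_log e)) (fun=> l_root e)) PE labels.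

Definition log_ok (x : label) : bool :=
  [&& Z.leb 0 (l_log x), Z.ltb (l_log x) (Zpos log_order) &
   pair_eqb (pair_pow (l_val x) log_exponent)
     (if l_log x is Zpos h then pair_pow log_base h else (1, 0))].

Definition minus_reflection (d : seq Z) : seq Z :=
  addl (scalel (Z.div (dotl d (head [::] simple2)) 4) (head [::] simple2)) (oppl d).

Definition log_prime_ok (q e : positive) : bool :=
  Pos.eqb (q * e) log_order && pair_nontrivial (pair_pow log_base e).

Fixpoint eql (a b : seq Z) : bool :=
  match a, b with
  | [::], [::] => true
  | x :: a', y :: b' => Z.eqb x y && eql a' b'
  | _, _ => false
  end.

(* Only one of two conjugate roots of Q is substituted in Q. *)
Definition lower_half (y : Z * Z) : bool := Z.leb (2 * y.2) p1.
Definition traces : seq (Z * Z) :=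
  [seq pair_add (l_val e.1) (l_val e.2) | e <- zip labels (drop 120 labels)].
Definition trace_check (y : Z * Z) : bool :=
  if lower_half y then pair_eqb (pair_horner y Q_residues) (0, 0)
  else has (fun y' => lower_half y' && pair_eqb y' (pair_conj y)) traces.

Definition labels_check : bool :=
  let t := log_tree in
  [&& all2 eql [seq l_root e | e <- labels] roots2,
      all (fun e => eql (l_root e.2) (oppl (l_root e.1))
             && pair_eqb (pair_mul (l_val e.1) (l_val e.2)) (1, 0)
             && trace_check (pair_add (l_val e.1) (l_val e.2)))
          (zip labels (drop 120 labels)),
      all (fun e => eql (pget [::] t (log_key (l_log e))) (l_root e)) labels,
      all (fun e => all (fun e' =>
             if pget [::] t (log_key (log_add (l_log e) (l_log e'))) is (_ :: _) as c
             then eql (addl (l_root e) (l_root e')) c else true) labels) labels &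
      all (fun e => has (fun e' =>
             pair_eqb (l_val e') (pair_conj (l_val e))
             && eql (l_root e') (minus_reflection (l_root e))) labels) labels].

Fixpoint no_odd_divisor (fuel : nat) (n d : Z) : bool :=
  if fuel is k.+1 then ~~ Z.eqb (Z.modulo n d) 0 && no_odd_divisor k n (d + 2) else true.

Local Close Scope Z_scope.
(** Only the sixteen starting logarithms are verified by exponentiation; [logged_mul] propagates
    them to all labels. *)
Lemma log_labels_ok : all log_ok (simple_labels ++ opposite_labels).
Proof. vm_compute. reflexivity. Qed.
Lemma log_base_ok : pair_eqb (pair_pow log_base log_order) (Zpos 1, Z0).
Proof. vm_compute. reflexivity. Qed.
Lemma log_primes_ok :
  [&& log_prime_ok 463 1986667, log_prime_ok 1097 838493 & log_prime_ok 1811 507911].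
Proof. vm_compute. reflexivity. Qed.
Lemma labels_ok : labels_check. Proof. vm_compute. reflexivity. Qed.
(** The divisors tried are the odd numbers from 3 to 5281, and 5283^2 exceeds p1. *)
Lemma trial_ok : no_odd_divisor 2640 p1 3 && Z.odd p1. Proof. vm_compute. reflexivity. Qed.
(** Euler's criterion with exponent (p1 - 1) / 2: 5 is not a square modulo p1, so Frobenius changes
    the sign of sqrt 5. *)
Lemma nonresidue_ok : pair_eqb (pair_pow (Zpos 5, Z0) 13906668) (Z.sub p1 1, Z0).
Proof. vm_compute. reflexivity. Qed.

Lemma no_odd_divisorP fuel n d k : no_odd_divisor fuel n d -> (k < fuel)%N ->
  Z.modulo n (Z.add d (Z.mul 2 (Z.of_nat k))) <> Z0.
Proof.
elim: fuel d k => [|f IH] d [|k] //= /andP[nd rest]; rewrite ?ltnS.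
  by move=> _; rewrite Z.add_0_r => e; move: nd; rewrite e.
move/(IH _ _ rest); congr (~ (Z.modulo _ _ = _)); lia.
Qed.

Lemma trial_division fuel n z : Z.of_nat n = z -> (1 < n)%N ->
  (n < (2 * fuel + 3) ^ 2)%N ->
  no_odd_divisor fuel z 3 && Z.odd z -> prime n.
Proof.
move=> nz n1 nf /andP[nd oz]; apply: contraT => /primePns[|[q [pq qn /dvdnP[k nk]]]].
  by rewrite ltnNge n1.
have q2 : q <> 2%N.
  move=> q2; move: oz; rewrite -nz nk q2 Nat2Z.inj_mul Z.odd_mul andbF; by [].
have [j qj] : exists j, q = (3 + 2 * j)%N.
  have q1 := prime_gt1 pq; have [e|oq] := even_prime pq; first by case: q2.
  by exists ((q - 3)./2); move: oq q2; lia.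
have jf : (j < fuel)%N.
  rewrite ltnNge; apply/negP => fj; suff : (n < n)%N by rewrite ltnn.
  apply: leq_trans nf _; apply: leq_trans qn; rewrite leq_sqr; lia.
case: (no_odd_divisorP nd jf); rewrite -nz nk qj.
rewrite (_ : Z.add _ _ = Z.of_nat (3 + 2 * j)); last by lia.
by rewrite Nat2Z.inj_mul Z.mod_mul //; lia.
Qed.

Lemma prime_p1 n : Z.of_nat n = p1 -> prime n.
Proof.
move=> np; apply: (trial_division (fuel := 2640) np _ _ trial_ok).
  by move: np; rewrite /p1; lia.
by move: np; rewrite /p1 expnS expn1; lia.
Qed.

(** x^e has exact order q, and (x^e)^i = (x^e)^j follows from x^i = x^j. *)
Lemma prime_order_mod (F : fieldType) (x : F) (q e N : positive) i j :
  Pos.mul q e = N -> prime (Pos.to_nat q) -> x ^+ Pos.to_nat N = 1 -> x ^+ Pos.to_nat e != 1 ->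
  x ^+ i = x ^+ j -> i = j %[mod Pos.to_nat q].
Proof.
move=> <- qp xN xe xij.
have q0 := prime_gt0 qp.
have yq : (x ^+ Pos.to_nat e) ^+ Pos.to_nat q = 1.
  by rewrite -exprM -xN Pos2Nat.inj_mul; congr (_ ^+ _); exact: mulnC.
have [m ym mq] := prim_order_exists q0 yq.
have {}mq : m = Pos.to_nat q.
  case/primeP: qp mq => _ h /h/orP[/eqP m1|/eqP//].
  by move: xe; rewrite -[X in X != 1]expr1 -m1 (prim_expr_order ym) eqxx.
apply/eqP; rewrite -mq -(eq_prim_root_expr ym) -!exprM ![(Pos.to_nat e * _)%N]mulnC !exprM.
by rewrite xij.
Qed.

Lemma grow_inv (T U : Type) (P : T -> Prop) (R : U -> Prop) t0 u0 op us xs st :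
  P t0 -> R u0 -> (forall x u, P x -> R u -> P (op x u)) ->
  (forall i, R (nth u0 us i)) -> (forall i, P (nth t0 xs i)) ->
  forall i, P (nth t0 (grow t0 u0 op us xs st) i).
Proof.
move=> Pt Ru Pop Rus; elim: st xs => [|e st IH] xs //= Pxs; apply: IH => i.
rewrite nth_rcons; case: ifP => // _; case: ifP => // _.
exact: Pop.
Qed.

Lemma pair_eqbP x y : pair_eqb x y -> x = y.
Proof. by case: x y => [a b] [c d] /andP[/Z.eqb_eq /= -> /Z.eqb_eq /= ->]. Qed.

Lemma eqlP a b : eql a b -> a = b.
Proof. by elim: a b => [|x a IH] [|y b] //= /andP[/Z.eqb_eq -> /IH ->]. Qed.

(** * Arithmetic and discrete logarithms in the field with p1^2 elements *)

Section QuadraticField.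
Variables (F : fieldType) (p : nat) (w : F).
Hypotheses (np : Z.of_nat p = p1) (charF : p \in [pchar F]) (w2 : w ^+ 2 = 5%:R).

Definition ev (x : Z * Z) : F := zr x.1 + zr x.2 * w.

Lemma zr_p1 c : zr (Z.modulo c p1) = zr c :> F.
Proof. by rewrite -np; apply: zr_mod. Qed.

Lemma ev1 : ev (Zpos 1, Z0) = 1.
Proof. by rewrite /ev /= zr1 zr0 mul0r addr0. Qed.

Lemma ev_pair_mul x y : ev (pair_mul x y) = ev x * ev y.
Proof.
have w5 : zr (Zpos 5) = w ^+ 2 :> F by rewrite w2.
by rewrite /ev /pair_mul; cbn [fst snd]; rewrite !zr_p1 !zrD !zrM w5; ring.
Qed.

Lemma ev_pair_add x y : ev (pair_add x y) = ev x + ev y.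
Proof. by rewrite /ev /= !zr_p1 !zrD; ring. Qed.

Lemma ev_pair_pow x e : ev (pair_pow x e) = ev x ^+ Pos.to_nat e.
Proof.
elim: e => [e IH|e IH|] /=; last by rewrite expr1.
  by rewrite !ev_pair_mul IH Pos2Nat.inj_xI exprS -exprD addnn -mul2n.
by rewrite ev_pair_mul IH Pos2Nat.inj_xO -exprD addnn -mul2n.
Qed.

Lemma ev_pair_horner y cs : ev (pair_horner y cs) = hornerl (ev y) cs.
Proof.
have w5 : zr (Zpos 5) = w ^+ 2 :> F by rewrite w2.
elim: cs => [|c cs IH]; first by rewrite /ev zr0 mul0r addr0.
rewrite -[pair_horner _ _]/(pair_step y (pair_horner y cs) c) [RHS]/= -IH.
move: (pair_horner y cs) => r; rewrite /ev /pair_step; cbn [fst snd].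
by rewrite !zr_p1 !zrD !zrM w5; ring.
Qed.

Lemma sqrt5_frobenius : w ^+ p = - w.
Proof.
have -> : p = (1 + 2 * Pos.to_nat 13906668)%N.
  by move: np; rewrite /p1; lia.
rewrite exprD expr1 exprM w2 (_ : 5%:R = ev (Zpos 5, Z0)); last first.
  by rewrite /ev /= zr0 mul0r addr0.
rewrite -ev_pair_pow (pair_eqbP nonresidue_ok) /ev zr0 mul0r addr0 zrB zr1.
by rewrite -np zr_nat (pcharf0 charF) sub0r mulrN1.
Qed.

Lemma ev_frobenius x : ev x ^+ p = ev (pair_conj x).
Proof.
rewrite -(pFrobenius_autE charF) rmorphD rmorphM /= !zr_rmorph pFrobenius_autE.
by rewrite sqrt5_frobenius /ev /= zr_p1 zrN mulrN mulNr.
Qed.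

(** A logarithm of the projection of the value to the subgroup generated by [log_base]. Different
    logarithms separate values, and a product relation between values is a sum relation between
    logarithms. *)
Definition logged (x : label) :=
  [/\ Z.le Z0 (l_log x), Z.lt (l_log x) (Zpos log_order) &
   ev (l_val x) ^+ Pos.to_nat log_exponent = ev log_base ^+ Z.to_nat (l_log x)].

Lemma log_base_order : ev log_base ^+ Pos.to_nat log_order = 1.
Proof. by rewrite -ev_pair_pow (pair_eqbP log_base_ok) ev1. Qed.

Lemma log_okP x : log_ok x -> logged x.
Proof.
case/and3P=> /Z.leb_le l0 /Z.ltb_lt lN /pair_eqbP e; split=> //.
rewrite -ev_pair_pow e; case: (l_log x) l0 => [|h|h] l0; last by case: l0.
  by rewrite ev1.
by rewrite ev_pair_pow.
Qed.

Lemma logged1 : logged label0.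
Proof. by split=> //; rewrite ev1 expr1n. Qed.

Lemma log_addP a b : Z.le Z0 a -> Z.lt a (Zpos log_order) ->
  Z.le Z0 b -> Z.lt b (Zpos log_order) ->
  [/\ Z.le Z0 (log_add a b), Z.lt (log_add a b) (Zpos log_order) &
   ev log_base ^+ Z.to_nat (log_add a b) = ev log_base ^+ Z.to_nat a * ev log_base ^+ Z.to_nat b].
Proof.
move: log_base_order; move: (ev log_base) => x; rewrite /log_add.
move: log_order => N xN a0 aN b0 bN; rewrite -exprD.
have -> : (Z.to_nat a + Z.to_nat b)%N = Z.to_nat (Z.add a b) by lia.
have [h|h] := Z.ltb_spec (Z.add a b) (Zpos N); first by split=> //; lia.
split; [lia | lia |].
have -> : Z.to_nat (Z.add a b) = (Z.to_nat (Z.sub (Z.add a b) (Zpos N)) + Pos.to_nat N)%N by lia.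
by rewrite exprD xN mulr1.
Qed.

Lemma logged_mul x y : logged x -> logged y -> logged (label_mul x y).
Proof.
case=> x0 xN xe [y0 yN ye]; have [h0 hN he] := log_addP x0 xN y0 yN.
by split=> //=; rewrite ev_pair_mul exprMn xe ye he.
Qed.

Lemma labels_eq : labels =
  grow label0 label0 label_mul simple_labels simple_labels root_steps ++
  grow label0 label0 label_mul opposite_labels opposite_labels root_steps.
Proof. by vm_compute. Qed.

Lemma logged_nth ls i : all log_ok ls -> logged (nth label0 ls i).
Proof.
elim: ls i => [|x ls IH] [|i] //=; try by move=> _; exact: logged1.
  by case/andP=> /log_okP.
by case/andP=> _ /IH.
Qed.

Lemma logged_labels i : logged (nth label0 labels i).
Proof.
have := log_labels_ok; rewrite all_cat => /andP[s_ok o_ok].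
rewrite labels_eq nth_cat.
move: simple_labels opposite_labels s_ok o_ok root_steps => s o s_ok o_ok st.
by case: ifP => _; apply: (grow_inv (P := logged) (R := logged));
  first [exact: logged1 | exact: logged_mul | by move=> k; apply: logged_nth].
Qed.

Lemma zr_eq0 c : Z.le Z0 c -> Z.lt c p1 -> zr c = 0 :> F -> c = Z0.
Proof.
move=> c0 cp; rewrite -(Z2Nat.id _ c0) zr_nat => /eqP.
rewrite -(dvdn_pcharf charF) => pc; move: cp; rewrite -np => cp.
have [e|c1] := posnP (Z.to_nat c); first by rewrite e.
by have := dvdn_leq c1 pc; lia.
Qed.

(** If a + b w = 1, then Frobenius gives a - b w = 1, so 2 b w = 0 and the residues are those of (1,
    0). *)
Lemma pair_nontrivialP x : pair_nontrivial x -> ev x != 1.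
Proof.
case/and5P=> /Z.leb_le a0 /Z.ltb_lt aN /Z.leb_le b0 /Z.ltb_lt bN; apply: contra => /eqP e1.
have e2 : zr x.1 - zr x.2 * w = 1.
  have := ev_frobenius x; rewrite e1 expr1n /ev /= zr_p1 zrN => e2.
  by rewrite [RHS]e2; ring.
have two : (2 : F) != 0.
  rewrite -(dvdn_pcharf charF); apply/negP => /dvdn_leq; move: np; rewrite /p1; lia.
have w0 : w != 0.
  apply/eqP => w0; move: w2; rewrite w0 expr0n /= => /eqP.
  rewrite eq_sym -(dvdn_pcharf charF) => /dvdn_leq; move: np; rewrite /p1; lia.
have xb : x.2 = Z0.
  apply: zr_eq0 => //; apply: (mulIf w0); apply: (mulfI two).
  have -> : 2 * (zr x.2 * w) = ev x - (zr x.1 - zr x.2 * w) by rewrite /ev; ring.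
  by rewrite e1 e2 subrr mul0r mulr0.
have xa : Z.sub x.1 (Zpos 1) = Z0.
  have [e|a1] := Z.eq_dec x.1 Z0; last first.
    apply: zr_eq0; [lia | lia |].
    by rewrite zrB zr1 -e1 /ev xb zr0 mul0r addr0 subrr.
  by move: e1; rewrite /ev e xb !zr0 mul0r addr0 => /eqP; rewrite eq_sym oner_eq0.
by rewrite /pair_eqb xb; apply/andP; split=> //; apply/Z.eqb_eq; cbn [fst snd]; lia.
Qed.

(** [log_order] is 463 * 1097 * 1811, and each of these primes divides the order of the base; the
    three congruences combine through the least common multiple. *)
Lemma log_base_inj i j : ev log_base ^+ i = ev log_base ^+ j ->
  Z.divide (Zpos log_order) (Z.sub (Z.of_nat i) (Z.of_nat j)).
Proof.
move=> ij; have /and3P[q1 q2 q3] := log_primes_ok.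
have dv q e : log_prime_ok q e ->
    prime (Pos.to_nat q) -> Z.divide (Zpos q) (Z.sub (Z.of_nat i) (Z.of_nat j)).
  case/andP=> /Pos.eqb_eq qe /pair_nontrivialP; rewrite ev_pair_pow => be qp.
  have := prime_order_mod qe qp log_base_order be ij.
  move: (prime_gt0 qp); case: (Pos2Nat.is_succ q) => n qn q0 /eqP.
  have zq : Z.of_nat (Pos.to_nat q) = Zpos q by lia.
  move: (Pos.to_nat q) zq q0 => m <- m0; rewrite !modn_def.
  case: edivnP => a b -> /= ba; case: edivnP => c d -> /= dc /eqP bd.
  exists (Z.sub (Z.of_nat a) (Z.of_nat c)).
  move: ba dc; rewrite m0 /= => ba dc; subst d; nia.
have h1 := dv _ _ q1 isT; have h2 := dv _ _ q2 isT; have h3 := dv _ _ q3 isT.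
have -> : log_order = Pos.mul 463 (Pos.mul 1097 1811) by [].
have := Z.lcm_least _ _ _ h1 (Z.lcm_least _ _ _ h2 h3).
by [].
Qed.

Lemma log_eq x y : logged x -> logged y -> ev (l_val x) = ev (l_val y) -> l_log x = l_log y.
Proof.
case=> x0 xN xe [y0 yN ye] e; move: xe; rewrite e ye => /esym/log_base_inj.
rewrite !Z2Nat.id //; move: (l_log x) (l_log y) x0 xN y0 yN => a b; clear.
by rewrite /log_order => a0 aN b0 bN [k kE]; lia.
Qed.

End QuadraticField.

Lemma all_nth_ord (T : Type) (x0 : T) (P : T -> bool) s i : all P s -> (i < size s)%N -> P (nth x0 s i).
Proof. by elim: s i => [|x s IH] [|i] //= /andP[Px Ps]; [| apply: IH]. Qed.

Lemma has_nth_ord (T : Type) (x0 : T) (P : T -> bool) s : has P s ->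
  exists2 i, (i < size s)%N & P (nth x0 s i).
Proof. by move=> h; exists (find P s); [rewrite -has_find | apply: nth_find]. Qed.

Lemma all2_eql_nth (T : Type) (f : T -> seq Z) x0 s t i :
  all2 eql [seq f e | e <- s] t -> (i < size s)%N -> f (nth x0 s i) = nth [::] t i.
Proof.
elim: s t i => [|x s IH] [|y t] [|i] //= /andP[/eqlP xy st] //.
exact: IH.
Qed.

Lemma size_labels : size labels = 240. Proof. by vm_compute. Qed.
Lemma size_roots : size roots2 = 240. Proof. by vm_compute. Qed.
Lemma uniq_roots2 : uniq roots2. Proof. by case/andP: roots2_complete => /andP[]. Qed.
Lemma nil_roots2 i : (i < 240)%N -> nth [::] roots2 i <> [::].
Proof.
move=> i240 e; have := @size_roots2 [::]; rewrite -{1}e mem_nth ?size_roots //.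
by move/(_ isT).
Qed.

Opaque labels roots2 log_tree.

Lemma labels_checkP :
  [/\ forall i, (i < 240)%N -> l_root (nth label0 labels i) = nth [::] roots2 i,
      forall i, (i < 120)%N -> [&& eql (l_root (nth label0 labels (120 + i)))
          (oppl (l_root (nth label0 labels i))), pair_eqb (pair_mul (l_val (nth label0 labels i))
                                  (l_val (nth label0 labels (120 + i)))) (Zpos 1, Z0)
        & trace_check (pair_add (l_val (nth label0 labels i))
                        (l_val (nth label0 labels (120 + i))))],
      forall i, (i < 240)%N -> pget [::] log_tree (log_key (l_log (nth label0 labels i)))
         = nth [::] roots2 i,
      forall i j k, (i < 240)%N -> (j < 240)%N -> (k < 240)%N ->
        log_add (l_log (nth label0 labels i)) (l_log (nth label0 labels j)) =
        l_log (nth label0 labels k) ->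
        addl (nth [::] roots2 i) (nth [::] roots2 j) = nth [::] roots2 k
    & forall i, (i < 240)%N -> exists j, [/\ (j < 240)%N,
         l_val (nth label0 labels j) = pair_conj (l_val (nth label0 labels i))
       & nth [::] roots2 j = minus_reflection (nth [::] roots2 i)]].
Proof.
have := labels_ok; rewrite /labels_check; cbv zeta; move=> /and5P[].
move: labels roots2 log_tree trace_check size_labels nil_roots2.
move=> ls rs t tc size_labels nil_rs c1 c2 c3 c4 c5.
have f1 i : (i < 240)%N -> l_root (nth label0 ls i) = nth [::] rs i.
  by move=> i240; apply: (all2_eql_nth label0 c1); rewrite size_labels.
have f3 i : (i < 240)%N -> pget [::] t (log_key (l_log (nth label0 ls i)))
         = nth [::] rs i.
  move=> i240; rewrite -f1 //; apply: eqlP.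
  by apply: (all_nth_ord label0 c3); rewrite size_labels.
split=> //.
- move=> i i120; have iz : (i < size (zip ls (drop 120 ls)))%N.
    by rewrite size_zip size_drop size_labels.
  have := all_nth_ord (label0, label0) c2 iz.
  by rewrite nth_zip_cond iz nth_drop -andbA.
- move=> i j k i240 j240 k240 h.
  have iz : (i < size ls)%N by rewrite size_labels.
  have jz : (j < size ls)%N by rewrite size_labels.
  have := all_nth_ord label0 (all_nth_ord label0 c4 iz) jz.
  rewrite h f3 // !f1 //; have := nil_rs k k240.
  by case: (nth [::] rs k) => // a l _ /eqlP.
- move=> i i240; have iz : (i < size ls)%N by rewrite size_labels.
  have /(has_nth_ord label0)[j] := all_nth_ord label0 c5 iz; rewrite size_labels => j240.
  by rewrite !f1 // => /andP[/pair_eqbP e /eqlP e']; exists j.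
Qed.

Lemma trace_checkP y : trace_check y ->
  exists y', (y' = y \/ y' = pair_conj y) /\ pair_horner y' Q_residues = (Z0, Z0).
Proof.
have lower y' : lower_half y' -> trace_check y' -> pair_horner y' Q_residues = (Z0, Z0).
  by rewrite /trace_check => -> /pair_eqbP.
have ok : all trace_check traces.
  have := labels_ok; rewrite /labels_check; cbv zeta; move=> /and5P[_ c2 _ _ _].
  rewrite all_map; apply: sub_all c2 => e /=.
  by case/andP.
case yl : (lower_half y) => yt.
  by exists y; split; [left | apply: lower].
move: yt; rewrite {1}/trace_check yl => /(has_nth_ord (Z0, Z0))[i it /andP[l /pair_eqbP e]].
exists (pair_conj y); split; first by right.
by rewrite -e; apply: (lower _ l); apply: (all_nth_ord (Z0, Z0) ok it).
Qed.

Lemma roots2_opposite k : (k < 120)%N ->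
  nth [::] roots2 (120 + k) = oppl (nth [::] roots2 k).
Proof.
move=> k120; have [f1 f2 _ _ _] := labels_checkP.
rewrite -(f1 (120 + k)%N) ?ltn_add2l // -(f1 k) ?(ltn_trans k120) //.
by have /and3P[/eqlP] := f2 k k120.
Qed.

Section Place.
Variables (F : closedFieldType) (p : nat).
Hypotheses (np : Z.of_nat p = p1) (charF : p \in [pchar F]).

Lemma p1_place : exists zb : 'I_240 -> F,
  [/\ map_poly intr E8polyP = \prod_i ('X - (zb i)%:P),
      injective zb,
      forall a b, zb a * zb b = 1 -> nth [::] roots2 b = oppl (nth [::] roots2 a),
      forall a b c, zb a * zb b = zb c ->
        addl (nth [::] roots2 a) (nth [::] roots2 b) = nth [::] roots2 c
    & forall a b, zb a ^+ p = zb b ->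
        nth [::] roots2 b = minus_reflection (nth [::] roots2 a)].
Proof.
have [w w2] : exists w : F, w ^+ 2 = 5%:R.
  have [w ww] := solve_monicpoly (fun i : nat => if i == 0%N then 5%:R else 0 : F) (isT : (0 < 2)%N).
  by exists w; rewrite ww !big_ord_recl big_ord0 /= expr0 mulr1 mul0r !addr0.
have [f1 f2 f3 f4 f5] := labels_checkP.
pose lb i := nth label0 labels i; pose z i := ev w (l_val (lb i)).
have lg i : logged w (lb i) := logged_labels np charF w2 i.
(* The table recovers the E8 root from the logarithm, and the 240 roots are distinct. *)
have z_inj i j : (i < 240)%N -> (j < 240)%N -> z i = z j -> i = j.
  move=> i240 j240 /(log_eq np charF w2 (lg i) (lg j)) e.
  have := f3 _ i240; rewrite [l_log _]e f3 // => /eqP.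
  by rewrite nth_uniq ?size_roots ?uniq_roots2 // => /eqP.
have zz k : (k < 120)%N -> z k * z (120 + k)%N = 1.
  by move=> /f2 /and3P[_ /pair_eqbP e _]; rewrite -(ev_pair_mul np charF w2) [pair_mul _ _]e ev1.
have opp := roots2_opposite.
have zroot i : (i < 240)%N -> root (map_poly intr E8polyP) (z i).
  have lo k : (k < 120)%N -> root (map_poly intr E8polyP) (z k) /\ z (120 + k)%N = (z k)^-1.
    move=> k120; have /and3P[_ _ /trace_checkP[y [yE e2]]] := f2 k k120; have {}zz := zz k k120.
    have zk : z k != 0 by apply/eqP => zk; move/eqP: zz; rewrite zk mul0r eq_sym oner_eq0.
    have zV : z (120 + k)%N = (z k)^-1 by rewrite -[RHS]mulr1 -zz mulKf.
    split=> //; rewrite E8P_root zk -zV /root E8Q_hornerl -(ev_pair_add w np charF).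
    have : hornerl (ev w y) Q_coefs = 0.
      rewrite -(hornerl_md charF) np -[map _ _]/Q_residues -(ev_pair_horner np charF w2) e2.
      by rewrite /ev zr0 mul0r addr0.
    case: yE => -> h; first by rewrite h eqxx.
    (* If the conjugate was the one substituted in Q, the value found is the image under Frobenius
       of the value wanted. *)
    move: h; rewrite -(ev_frobenius np charF w2) -(frobenius_hornerl charF) => /eqP.
    by rewrite expf_eq0 => /andP[].
  move=> i240; have [i120|i120] := ltnP i 120; first by case: (lo i i120).
  have i120' : (i - 120 < 120)%N by lia.
  have [rt zV] := lo _ i120'; rewrite (subnKC i120) in zV; rewrite zV.
  exact: E8P_rootV.
have oppK k : (k < 120)%N -> oppl (nth [::] roots2 (120 + k)) = nth [::] roots2 k.
  by move=> /opp ->; apply: mapK; exact: Z.opp_involutive.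
exists (fun i => z i); split.
- pose rs := [seq z (i : 'I_240) | i <- enum 'I_240].
  have rsu : uniq_roots rs.
    rewrite uniq_rootsE map_inj_uniq ?enum_uniq // => a b /(z_inj _ _ (ltn_ord a) (ltn_ord b)).
    exact: val_inj.
  have mP : map_poly intr E8polyP \is @monic F by apply: monic_map; case: E8polyP_lead.
  have sP : size (map_poly intr E8polyP : {poly F}) = (size rs).+1.
    rewrite size_map size_enum_ord size_map_poly_id0; first by case: E8polyP_lead.
    by case: E8polyP_lead => _ /monicP ->; rewrite oner_neq0.
  have rsr : all (root (map_poly intr E8polyP)) rs.
    by apply/allP => _ /mapP[i _ ->]; apply: zroot.
  rewrite (all_roots_prod_XsubC sP rsr rsu) (monicP mP) scale1r /rs big_map.
  by rewrite big_enum.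
- by move=> a b /(z_inj _ _ (ltn_ord a) (ltn_ord b)) /val_inj.
- move=> a b ab; have [a120|a120] := ltnP a 120.
    have a240 : (120 + a < 240)%N by rewrite (ltn_add2l 120 a 120).
    rewrite -(opp _ a120); congr (nth _ _ _); apply: (z_inj _ _ (ltn_ord b) a240).
    apply: (mulfI (x := z a)); last by rewrite ab zz.
    by apply/eqP => z0; move/eqP: ab; rewrite z0 mul0r eq_sym oner_eq0.
  have a120' : (a - 120 < 120)%N by have := ltn_ord a; lia.
  have a240 : (a - 120 < 240)%N by apply: ltn_trans a120' _.
  have := oppK _ a120'; rewrite (subnKC a120) => ->; congr (nth _ _ _).
  apply: (z_inj _ _ (ltn_ord b) a240); apply: (mulfI (x := z a)).
    by apply/eqP => z0; move/eqP: ab; rewrite z0 mul0r eq_sym oner_eq0.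
  by rewrite ab mulrC -[X in _ * z X](subnKC a120) zz.
- move=> a b c abc; apply: f4 => //.
  apply: (log_eq np charF w2 (logged_mul np charF w2 (lg a) (lg b)) (lg c)).
  by rewrite /= (ev_pair_mul np charF w2).
- move=> a b; rewrite (ev_frobenius np charF w2) => e.
  have [j [j240 ej <-]] := f5 a (ltn_ord a).
  by congr (nth _ _ _); apply: (z_inj _ _ (ltn_ord b) j240); rewrite -e /z -ej.
Qed.
End Place.

(** * Half systems and orthogonal frames *)

Lemma root_index : exists r : 'I_240 -> E8_root,
  bijective r /\ forall k, val (r k) = vec2 (nth [::] roots2 k).
Proof.
have mem (k : 'I_240) : nth [::] roots2 k \in roots2 by rewrite mem_nth ?size_roots.
have /fin_all_exists[r rE] (k : 'I_240) : exists a : E8_root, val a = vec2 (nth [::] roots2 k).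
  exact: roots2_root.
exists r; split=> //.
have /fin_all_exists[g gE] (a : E8_root) : exists k : 'I_240, r k = a.
  have [d dr da] := root_roots2 a; have ir := dr; rewrite -index_mem size_roots in ir.
  by exists (Ordinal ir); apply: val_inj; rewrite rE /= nth_index // da.
exists g => // k; apply: ord_inj; apply/eqP.
rewrite -(nth_uniq [::] (s := roots2)) ?size_roots ?uniq_roots2 //; apply/eqP.
by apply: vec2_inj; rewrite ?size_roots2 ?mem // -!rE gE.
Qed.

(** A root of E8 has inner product 1 with 56 roots and -1 with their opposites, hence is related to
    56 of the 120 pairs. The value 4 is 1 in doubled coordinates. *)
Definition neighbour_check : bool :=
  let half := take 120 roots2 in
  all (fun d => leq (count (fun e => Z.eqb (Z.abs (dotl d e)) 4) half) 56%N) half.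
Lemma neighbour_ok : neighbour_check. Proof. by vm_compute. Qed.

(* The roots e1 + e2, e1 - e2, e3 + e4, ..., with doubled coordinates. *)
Definition orthogonal_frame : seq (seq Z) := Eval vm_compute in
  flatten [seq [:: [seq if (i == k.*2) || (i == k.*2.+1) then Zpos 2 else Z0 | i <- iota 0 8];
                   [seq if i == k.*2 then Zpos 2 else if i == k.*2.+1 then Zneg 2 else Z0
                   | i <- iota 0 8]] | k <- iota 0 4].

Definition reflectl (a d : seq Z) : seq Z :=
  addl d (scalel (Z.opp (Z.div (dotl a d) 4)) a).

Definition frame_check : bool :=
  all (fun a => has (eql a) roots2) orthogonal_frame
  && all (fun d => eql (foldl (fun d a => reflectl a d) d orthogonal_frame) (oppl d)) roots2.
Lemma frame_ok : frame_check. Proof. by vm_compute. Qed.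

Lemma card_related (T : Type) (x0 : T) n (s : seq T) (P : T -> T -> bool) m :
  size s = n -> all (fun d => leq (count (P d) s) m) s ->
  forall i : 'I_n, (#|[set j : 'I_n | P (nth x0 s i) (nth x0 s j)]| <= m)%N.
Proof.
move=> <- h i; apply: leq_trans (all_nth_ord x0 h (ltn_ord i)).
have -> : count (P (nth x0 s i)) s = count (fun j => P (nth x0 s i) (nth x0 s j)) (iota 0 (size s)).
  have := congr1 (count (P (nth x0 s i))) (map_nth_iota0 x0 (leqnn (size s))).
  by rewrite count_map take_size.
rewrite -val_enum_ord count_map cardE -size_filter.
apply: uniq_leq_size (enum_uniq _) _ => j.
by rewrite mem_enum mem_filter mem_enum !inE andbT.
Qed.

Lemma half_system : exists pos : 'I_120 -> E8_root,
  [/\ injective pos, forall i j, val (pos i) <> - val (pos j),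
      forall a, exists i, a = pos i \/ val a = - val (pos i)
    & forall i, (#|[set j | `|dotv (val (pos i)) (val (pos j))|%R == 1%R]| <= 56)%N].
Proof.
have [r [[g rK gK] rE]] := root_index.
have r_inj := can_inj rK.
have le240 : (120 <= 240)%N by [].
pose pos (i : 'I_120) := r (widen_ord le240 i).
have sz (k : 'I_240) : size (nth [::] roots2 k) = 8%N.
  by apply: size_roots2; rewrite mem_nth ?size_roots.
have opp (i : 'I_120) : exists k : 'I_240, val (r k) = - val (pos i) /\ k = (120 + i)%N :> nat.
  have i240 : (120 + i < 240)%N by rewrite (ltn_add2l 120 i 120).
  exists (Ordinal i240); split; last by [].
  rewrite !rE -[nat_of_ord (Ordinal i240)]/(120 + i)%N (roots2_opposite (ltn_ord i)) vec2N.
    by [].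
  exact: sz (widen_ord le240 i).
exists pos; split.
- by move=> i j /r_inj/(congr1 val)/= /val_inj.
- move=> i j; have [k [<- kj]] := opp j; move/val_inj/r_inj/(congr1 val) => /=.
  by rewrite kj => e; have := ltn_ord i; rewrite e ltnNge leq_addr.
- move=> a; rewrite -(gK a); move: (g a) => k; have [k120|k120] := ltnP k 120.
    by exists (Ordinal k120); left; congr (r _); apply: val_inj.
  have k120' : (k - 120 < 120)%N by have := ltn_ord k; lia.
  have [l [lE lk]] := opp (Ordinal k120'); exists (Ordinal k120'); right; rewrite -lE.
  by congr (val (r _)); apply: ord_inj; rewrite lk /= subnKC.
- move=> i; have := neighbour_ok; rewrite /neighbour_check; cbv zeta.
  have s120 : size (take 120 roots2) = 120%N by rewrite size_takel // size_roots.
  move=> h; have {h} := @card_related _ [::] _ _ (fun d e => Z.eqb (Z.abs (dotl d e)) 4) _ s120 h i.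
  apply: leq_trans.
  apply: subset_leq_card; apply/subsetP => j; rewrite !inE !nth_take //.
  rewrite !rE dotv_vec2; [| exact: sz | exact: sz].
  move: (dotl _ _) => c; rewrite eqr_norml => /andP[/orP[] /eqP/(canRL (divfK _)) -/(_ isT) c4 _].
    have -> : c = Zpos 4 by apply: zr_rat_inj; rewrite c4 mul1r.
    by [].
  have -> : c = Zneg 4 by apply: zr_rat_inj; rewrite c4 mulN1r.
  by [].
Qed.

Lemma vec2_scale c d : size d = 8%N -> vec2 (scalel c d) = zr c *: vec2 d.
Proof.
by move=> sd; apply/rowP => j; rewrite !mxE (nth_map Z0) ?sd // zrM mulrA.
Qed.

Lemma reflection_vec2 (a b : E8_root) d e : size d = 8%N -> size e = 8%N ->
  val a = vec2 d -> val b = vec2 e -> val (reflection a b) = vec2 (reflectl d e).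
Proof.
move=> sd se va vb; rewrite reflectE /reflectl vec2D ?size_map // vec2_scale // -va -vb.
rewrite zrN scaleNr; congr (_ - _ *: _).
have /andP[La _] := E8_rootP a; have /andP[Lb _] := E8_rootP b.
have [c] := int_zrP (dotv_int La Lb); rewrite {1}va {1}vb dotv_vec2 // => cE.
have -> : dotl d e = Z.mul c (Zpos 4).
  by apply: zr_rat_inj; rewrite zrM -cE; field.
by rewrite Z.div_mul // va vb (dotv_vec2 sd se).
Qed.

(** Reflections in an orthogonal basis multiply to -1. The parity of their number is recorded
    because -1 is later recovered from the product of the elements -s_b. *)
Lemma frame_product : exists2 bs : seq E8_root, ~~ odd (size bs) & forall a : E8_root,
  val ((\prod_(b <- bs) reflection b)%g a) = - val a.
Proof.
have /andP[/allP fr /allP fd] := frame_ok.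
have {}fr d : d \in orthogonal_frame -> d \in roots2.
  by move=> /fr /hasP[e er /eqlP ->].
suff [bs sbs bsE] : exists2 bs : seq E8_root, size bs = size orthogonal_frame &
    forall (a : E8_root) d, size d = 8%N -> val a = vec2 d ->
    val ((\prod_(b <- bs) reflection b)%g a)
    = vec2 (foldl (fun d a => reflectl a d) d orthogonal_frame).
  exists bs => [|a]; first by rewrite sbs.
  have [d dr da] := root_roots2 a.
  by rewrite (bsE a d) ?size_roots2 // (eqlP (fd d dr)) vec2N ?size_roots2 // da.
elim: orthogonal_frame fr {fd} => [|e l IH] fr; first by exists [::] => // a d; rewrite big_nil perm1.
have er : e \in roots2 by apply: fr; rewrite mem_head.
have [b be] := roots2_root er.
have [bs sbs bsE] := IH (fun d dl => fr d (mem_behead (s := e :: l) dl)).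
exists (b :: bs) => [|a d sd da]; first by rewrite /= sbs.
 rewrite big_cons permM /=; apply: bsE.
  by rewrite size_map size_zip size_map sd (size_roots2 er).
exact: (reflection_vec2 (size_roots2 er) sd be da).
Qed.

Lemma alpha1_root2 : head [::] simple2 \in roots2. Proof. by vm_compute. Qed.

Lemma minus_reflectionP (a b : E8_root) d : size d = 8%N ->
  val a = vec2 (head [::] simple2) -> val b = vec2 d ->
  vec2 (minus_reflection d) = - val (reflection a b).
Proof.
have s8 := size_roots2 alpha1_root2.
move=> sd va vb; rewrite (reflection_vec2 s8 sd va vb) /reflectl /minus_reflection.
move: (head [::] simple2) s8 va => e s8 va.
have sz c : size (scalel c e) = 8%N by rewrite size_map.
have so : size (oppl d) = 8%N by rewrite size_map.
rewrite !vec2D // !vec2_scale // vec2N // zrN scaleNr opprB.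
congr (zr (Z.div _ _) *: _ - _).
have := dotvC (vec2 d) (vec2 e); rewrite !dotv_vec2 // => /(congr1 ( *%R^~ 4)).
by rewrite !divfK // => /zr_rat_inj.
Qed.

(** A specialization at p1 transports the explicit labels to the roots in L: an integral relation
    between the [zeta a] survives modulo p1, where its consequence for the labels is known. *)
Lemma labelled_roots (L : splittingFieldType rat)
    (splitL : splittingFieldFor 1 (map_poly (intr : int -> L) E8polyP) {:L}) :
  exists zeta : E8_root -> L,
  [/\ map_poly intr E8polyP = \prod_a ('X - (zeta a)%:P),
      injective zeta /\ <<1 & [seq zeta a | a <- enum E8_root]>>%VS = {:L}%VS,
      forall a b, zeta a * zeta b = 1 -> val b = - val a,
      forall a b c, zeta a * zeta b = zeta c -> val a + val b = val c
    & exists (s : gal_of {:L}) (alpha : E8_root), s \in 'Gal({:L} / 1)%g /\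
        forall a b, s (zeta a) = zeta b -> val b = - val (reflection alpha a)].
Proof.
have [rs Prs genL] := splitL.
have Pm : map_poly (intr : int -> L) E8polyP \is monic by apply: monic_map; case: E8polyP_lead.
have {}Prs : map_poly (intr : int -> L) E8polyP = \prod_(x <- rs) ('X - x%:P).
  by apply/eqP; rewrite -eqp_monic // monic_prod_XsubC.
have srs : size rs = 240%N.
  have := congr1 (fun q : {poly L} => size q) Prs; rewrite size_prod_XsubC.
  rewrite size_map_poly_id0; first by case: E8polyP_lead => -> _ [].
  by case: E8polyP_lead => _ /monicP ->; rewrite oner_neq0.
pose z0 (i : 'I_240) : L := nth 0 rs i.
have rsE : rs = [seq z0 i | i <- enum 'I_240].
  rewrite (map_comp (nth 0 rs) val) val_enum_ord map_nth_iota0 ?srs //.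
  by rewrite -srs take_size.
have Pz : map_poly (intr : int -> L) E8polyP = \prod_i ('X - (z0 i)%:P).
  by rewrite Prs rsE big_map big_enum.
have [p np] : exists p, Z.of_nat p = p1.
  by exists (Z.to_nat p1); rewrite Z2Nat.id.
have [F charF] := algebraically_closed_char (prime_p1 np).
have [zb [Pzb zb_inj zbV zbM zbF]] := p1_place np charF.
have [s sP] := specialization_exists (@intr_inj_L L) Pz Pzb.
have [r [[g rK gK] rE]] := root_index.
pose lab i := r (s i); pose ix a := (s^-1)%g (g a).
have ixK a : lab (ix a) = a by rewrite /lab /ix permKV gK.
have labK i : ix (lab i) = i by rewrite /lab /ix rK permK.
have vlab i : val (lab i) = vec2 (nth [::] roots2 (s i)) by rewrite rE.
have sz (k : 'I_240) : size (nth [::] roots2 k) = 8%N.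
  by apply: size_roots2; rewrite mem_nth ?size_roots.
pose zeta a := z0 (ix a).
exists zeta; split.
- rewrite Pz (reindex ix) //; exists lab => i _ //.
- split.
    move=> a b ab; rewrite -[a]ixK -[b]ixK; congr (r _); apply: zb_inj.
    have h := sP ('X_(ix a) - 'X_(ix b)); rewrite !rmorphB /= !evzX in h.
    by apply/eqP; rewrite -subr_eq0; apply/eqP/h; rewrite [z0 _]ab subrr.
  apply/eqP; rewrite eqEsubv subvf /= -{1}genL; apply: adjoin_seqSr => x.
  rewrite rsE => /mapP[i _ ->]; apply/mapP; exists (lab i); first by rewrite mem_enum.
  by rewrite /zeta labK.
- move=> a b ab; rewrite -[a]ixK -[b]ixK !vlab -vec2N ?sz //.
  congr vec2; apply: zbV.
  have h := sP ('X_(ix a) * 'X_(ix b) - 1); rewrite !rmorphB !rmorphM !rmorph1 /= !evzX in h.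
  by apply/eqP; rewrite -subr_eq0; apply/eqP/h; rewrite [z0 _ * z0 _]ab subrr.
- move=> a b c abc; rewrite -[a]ixK -[b]ixK -[c]ixK !vlab -vec2D //; congr vec2; apply: zbM.
  have h := sP ('X_(ix a) * 'X_(ix b) - 'X_(ix c)); rewrite !rmorphB !rmorphM /= !evzX in h.
  by apply/eqP; rewrite -subr_eq0; apply/eqP/h; rewrite [z0 _ * z0 _]abc subrr.
- have [t tG tP] := frobenius_lift charF Pz sP.
  have [alpha alphaE] := roots2_root alpha1_root2.
  exists t, alpha; split=> // a b /tP /= /zbF bE.
  rewrite -[b]ixK vlab bE; apply: (minus_reflectionP _ alphaE) => //.
  by rewrite -vlab ixK.
Qed.

(** * Multiplicative relations between the roots of P *)

Lemma addV_inj (F : fieldType) (x y : F) : x != 0 -> y != 0 ->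
  x + x^-1 = y + y^-1 -> x = y \/ x * y = 1.
Proof.
move=> x0 y0 e; have : (x - y) * (x * y - 1) = 0.
  have -> : (x - y) * (x * y - 1) = x * y * ((x + x^-1) - (y + y^-1)).
    by field; rewrite x0 y0.
  by rewrite e subrr mulr0.
by move/eqP; rewrite mulf_eq0 !subr_eq0 => /orP[] /eqP; [left | right].
Qed.

Lemma root_dot_cases (a b : E8_root) (d := dotv (val a) (val b)) :
  [\/ d \in [:: 0; 1; -1], val a = val b | val a = - val b].
Proof.
have /andP[La _] := E8_rootP a; have /andP[Lb _] := E8_rootP b.
have [c] := int_zrP (dotv_int La Lb); rewrite -/d => dc.
have sq u : 0 <= dotv u u by apply: sumr_ge0 => i _; rewrite -expr2 sqr_ge0.
have nB u v : dotv (u - v) (u - v) = dotv u u + dotv v v - 2 * dotv u v.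
  rewrite dotvBl ![dotv _ (_ - _)]dotvC !dotvBl (dotvC v u); ring.
have dN u v : dotv u (- v) = - dotv u v by rewrite dotvC dotvNl dotvC.
have d2 : d = 2 -> val a = val b.
  move=> e; apply/eqP; rewrite -subr_eq0; apply/eqP/dotvv_eq0.
  by rewrite nB !root_norm -/d e.
have dm2 : d = -2 -> val a = - val b.
  move=> e; apply/eqP; rewrite -subr_eq0; apply/eqP/dotvv_eq0.
  rewrite nB dN dotvNl dN opprK !root_norm -/d e; ring.
have h1 : 0 <= 4 - 2 * d.
  by have := sq (val a - val b); rewrite nB !root_norm -/d; lra.
have h2 : 0 <= 4 + 2 * d.
  by have := sq (val a - - val b); rewrite nB dN dotvNl dN opprK !root_norm -/d; lra.
have {dc} [m dm] : exists m : int, d = m%:~R by exists (int_of_Z c).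
have m1 : m <= 2 by rewrite -(ler_int rat) -dm; lra.
have m2 : -2 <= m by rewrite -(ler_int rat) -dm; lra.
have : m \in [:: 0; 1; -1; 2; -2] by rewrite !inE; lia.
rewrite !inE => /or4P[/eqP e|/eqP e|/eqP e|/orP[]/eqP e].
- by constructor 1; rewrite dm e.
- by constructor 1; rewrite dm e.
- by constructor 1; rewrite dm e.
- by constructor 2; apply: d2; rewrite dm e.
- by constructor 3; apply: dm2; rewrite dm e.
Qed.

Section Main.
Variables (L : splittingFieldType rat) (zeta : E8_root -> L).
Local Notation P := (map_poly (intr : int -> L) E8polyP).
Local Notation G := 'Gal({:L} / 1)%g.
Hypotheses (Pz : P = \prod_a ('X - (zeta a)%:P)) (z_inj : injective zeta).
Hypothesis genL : <<1 & [seq zeta a | a <- enum E8_root]>>%VS = {:L}%VS.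
Hypothesis zV : forall a b, zeta a * zeta b = 1 -> val b = - val a.
Hypothesis zM : forall a b c, zeta a * zeta b = zeta c -> val a + val b = val c.

Lemma rootPz x : reflect (exists a, x = zeta a) (root P x).
Proof.
rewrite /root Pz horner_prod; apply: (iffP idP) => [|[a ->]].
  by rewrite prodf_seq_eq0 => /hasP[a _ /=]; rewrite hornerXsubC subr_eq0 => /eqP; exists a.
by rewrite (bigD1 a) //= hornerXsubC subrr mul0r.
Qed.

Lemma root_zeta a : root P (zeta a). Proof. by apply/rootPz; exists a. Qed.

Lemma zeta_neq0 a : zeta a != 0.
Proof. by have := root_zeta a; rewrite E8P_root => /andP[]. Qed.

Lemma zeta_opp a b : val b = - val a <-> zeta b = (zeta a)^-1.
Proof.
have [c cE] : exists c, (zeta a)^-1 = zeta c by apply/rootPz/E8P_rootV/root_zeta.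
have ac : val c = - val a by apply: zV; rewrite -cE divff ?zeta_neq0.
rewrite cE; split=> [e|/z_inj ->//]; congr zeta; apply: val_inj; by rewrite e ac.
Qed.

Lemma zeta_product a b : root P (zeta a * zeta b) -> dotv (val a) (val b) = -1.
Proof.
case/rootPz=> c /zM abc; have := root_norm c; rewrite -abc.
by rewrite dotvDl ![dotv _ (_ + _)]dotvC !dotvDl !root_norm (dotvC (val b)); lra.
Qed.

Lemma gal_root_P (s : gal_of {:L}) x : root P (s x) = root P x.
Proof.
have e : map_poly s P = P.
  by rewrite -map_poly_comp; apply: eq_map_poly => c /=; rewrite rmorph_int.
by rewrite -{1}e fmorph_root.
Qed.

Section Half.
Variable pos : 'I_120 -> E8_root.
Hypotheses (pos_inj : injective pos) (pos_neg : forall i j, val (pos i) <> - val (pos j)).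
Hypothesis posP : forall a, exists i, a = pos i \/ val a = - val (pos i).
Hypothesis pos56 : forall i,
  (#|[set j | `|dotv (val (pos i)) (val (pos j))|%R == 1%R]| <= 56)%N.

Definition trace a := zeta a + (zeta a)^-1.
Let y i := trace (pos i).

Lemma trace_eq a b : trace a = trace b -> a = b \/ val a = - val b.
Proof.
move/(addV_inj (zeta_neq0 a) (zeta_neq0 b)) => [/z_inj|]; first by left.
by rewrite mulrC => /zV; right.
Qed.

Lemma y_inj : injective y.
Proof. by move=> i j /trace_eq[/pos_inj // | /pos_neg]. Qed.

Lemma root_trace a : root (map_poly intr E8polyQ) (trace a).
Proof. by have := root_zeta a; rewrite E8P_root => /andP[]. Qed.

Lemma Qy : map_poly intr E8polyQ = \prod_i ('X - (y i)%:P).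
Proof.
pose rs := [seq y i | i <- enum 'I_120].
have Qm : map_poly intr E8polyQ \is @monic L by apply: monic_map; exact: monic_E8polyQ.
have sQ : size (map_poly intr E8polyQ : {poly L}) = (size rs).+1.
  rewrite size_map size_enum_ord size_map_poly_id0 ?size_E8polyQ //.
  by rewrite (monicP monic_E8polyQ) oner_neq0.
have rsr : all (root (map_poly intr E8polyQ)) rs by apply/allP => _ /mapP[i _ ->]; exact: root_trace.
have rsu : uniq_roots rs by rewrite uniq_rootsE (map_inj_uniq y_inj) enum_uniq.
by rewrite (all_roots_prod_XsubC sQ rsr rsu) (monicP Qm) scale1r big_map big_enum.
Qed.

(** An index stands for a pair {z, 1/z}, recognized by its trace. Two pairs are adjacent when some
    choice of representatives has its product among the roots of P, a condition that Galois elements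
    respect. *)
Definition neighbours i : {set 'I_120} :=
  [set j | [exists a, exists b, [&& trace a == y i, trace b == y j & root P (zeta a * zeta b)]]].

Lemma neighboursP i j : reflect
  (exists a b, [/\ trace a = y i, trace b = y j & root P (zeta a * zeta b)]) (j \in neighbours i).
Proof.
rewrite inE; apply: (iffP existsP) => [[a /existsP[b /and3P[/eqP ? /eqP ? ?]]]|[a [b [e1 e2 r]]]].
  by exists a, b.
by exists a; apply/existsP; exists b; rewrite e1 e2 !eqxx.
Qed.

Lemma neighbours_sub i : neighbours i \subset [set j | `|dotv (val (pos i)) (val (pos j))|%R == 1%R].
Proof.
apply/subsetP => j /neighboursP[a [b [/trace_eq ai /trace_eq bj /zeta_product ab]]].
have dN u v : dotv u (- v) = - dotv u v by rewrite dotvC dotvNl dotvC.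
rewrite inE -(normrN (dotv _ _)).
by case: ai bj ab => -> [] ->; rewrite ?dotvNl ?dN ?opprK => ->; rewrite ?opprK ?normrN normr1.
Qed.

Lemma gal_trace (s : gal_of {:L}) (t : {perm 'I_120}) a i :
  (forall k, s (y k) = y (t k)) -> trace a = y i ->
  exists b, s (zeta a) = zeta b /\ trace b = y (t i).
Proof.
move=> st ai; have /rootPz[b ab] : root P (s (zeta a)) by rewrite gal_root_P root_zeta.
by exists b; split=> //; rewrite /trace -ab -fmorphV -rmorphD -st -ai.
Qed.

Lemma trace_half a : exists i, trace a = y i.
Proof.
have [k [->|ck]] := posP a; exists k => //.
by move/zeta_opp: ck => e; rewrite /y /trace e invrK addrC.
Qed.

Lemma neighbours_nonempty : exists i, neighbours i != set0.
Proof.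
have charL : [pchar L] =i pred0.
  move=> p; rewrite (pchar_lalg L) [RHS]inE; apply/negbTE/negP.
  by case/andP=> /prime_gt0; case: p => // p _; rewrite pnatr_eq0.
have [F charF] := algebraically_closed_char (isT : prime 61).
have Pz' : P = \prod_(i < #|E8_root|) ('X - (zeta (enum_val i))%:P).
  by rewrite Pz (reindex _ (onW_bij _ (@enum_val_bij _))).
have [zb [Pzb zzb]] := place_exists (proj2 E8polyP_lead) Pz' F.
have [i [j]] := one_relation charL charF Pz' Pzb zzb.
move: (enum_val i) (enum_val j) => a b ab.
have [k ak] := trace_half a; have [l bl] := trace_half b.
by exists k; apply/set0Pn; exists l; apply/neighboursP; exists a, b.
Qed.

Lemma neighbours_eq i : neighbours i = [set j | `|dotv (val (pos i)) (val (pos j))|%R == 1%R].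
Proof.
suff c56 : forall i, #|neighbours i| = 56%N.
  by apply/eqP; rewrite eqEcard neighbours_sub c56 pos56.
apply: (neighbours_card y_inj Qy).
- move=> s t sG st k l /neighboursP[a [b [ak bl ab]]].
  have [a' [sa ta]] := gal_trace st ak; have [b' [sb tb]] := gal_trace st bl.
  apply/neighboursP; exists a', b'; split=> //.
  by rewrite -sa -sb -rmorphM gal_root_P.
- move=> k; apply/negP => /(subsetP (neighbours_sub k)); rewrite inE root_norm.
  by rewrite ger0_norm.
- exact: neighbours_nonempty.
- by move=> k; apply: leq_trans (subset_leq_card (neighbours_sub k)) (pos56 k).
Qed.

(** Adjacency provides a' and b', equal to a and b up to sign, with (a', b') = -1. As (a, b) = -1
    too, the two signs agree; a common minus sign is removed by inversion, which preserves the roots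
    of P. *)
Lemma product_root a b : dotv (val a) (val b) = -1 -> root P (zeta a * zeta b).
Proof.
move=> ab; have dN u v : dotv u (- v) = - dotv u v by rewrite dotvC dotvNl dotvC.
have [i ai] := posP a; have [j bj] := posP b.
have : j \in neighbours i.
  rewrite neighbours_eq inE; apply/eqP.
  have -> : `|dotv (val (pos i)) (val (pos j))| = `|dotv (val a) (val b)|.
    by case: ai => ->; case: bj => ->; rewrite ?dotvNl ?dN ?normrN.
  by rewrite ab normrN normr1.
have tr c k : c = pos k \/ val c = - val (pos k) -> y k = trace c.
  by case=> [-> //|/zeta_opp e]; rewrite /y /trace e invrK addrC.
move=> /neighboursP[a' [b' []]]; rewrite (tr a i ai) (tr b j bj).
move=> /trace_eq a'a /trace_eq b'b r; have := zeta_product r.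
case: a'a b'b r => [-> [-> //|b'b]|a'a [->|b'b]] r.
- by rewrite b'b dN ab opprK => /eqP; rewrite -subr_eq0.
- by rewrite a'a dotvNl ab opprK => /eqP; rewrite -subr_eq0.
move/zeta_opp: a'a r => ->; move/zeta_opp: b'b => -> r _.
by have := E8P_rootV r; rewrite invfM !invrK.
Qed.

Lemma half_transitive i j : exists2 s : gal_of {:L}, s \in G & s (y i) = y j.
Proof.
pose X := [set k | [exists s : gal_of {:L}, (s \in G) && (s (y i) == y k)]].
suff /setP/(_ j) : X = setT.
  by rewrite !inE => /existsP[s /andP[sG /eqP]]; exists s.
apply: (stable_full y_inj Qy) => [s t sG st k|].
  rewrite !inE => /existsP[u /andP[uG /eqP uk]]; apply/existsP; exists (u * s)%g.
  by rewrite groupM //= galM ?memvf // uk st.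
apply/set0Pn; exists i; rewrite inE; apply/existsP; exists 1%g.
by rewrite group1 gal_id eqxx.
Qed.

Lemma gal_transitive a b : exists2 s : gal_of {:L}, s \in G &
  s (zeta a) = zeta b \/ s (zeta a) = (zeta b)^-1.
Proof.
have [i ai] := trace_half a; have [j bj] := trace_half b.
have [s sG] := half_transitive i j; rewrite -ai -bj /trace rmorphD fmorphV /=.
have /rootPz[c sc] : root P (s (zeta a)) by rewrite gal_root_P root_zeta.
rewrite sc => cb; exists s => //; rewrite sc.
by case: (trace_eq cb) => [-> | /zeta_opp ->]; [left | right].
Qed.

End Half.
End Main.

(** * The Galois group as a group of isometries *)

Lemma isometry_opp (f : {perm E8_root}) a b : f \in isometries ->
  val b = - val a -> val (f b) = - val (f a).
Proof.
move=> /isometryP hf e; apply/eqP; rewrite -subr_eq0 opprK; apply/eqP/dotvv_eq0.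
rewrite dotvDl ![dotv _ (_ + _)]dotvC !dotvDl !hf (dotvC (val b)) !root_norm e.
by rewrite [dotv (val a) _]dotvC dotvNl root_norm; ring.
Qed.

Lemma reflection_opp a b : val b = - val a -> reflection b = reflection a.
Proof.
move=> e; apply/permP => c; apply: val_inj; rewrite !reflectE e dotvNl.
by rewrite scalerN scaleNr opprK.
Qed.

Section Galois.
Variables (L : splittingFieldType rat) (zeta : E8_root -> L).
Local Notation P := (map_poly (intr : int -> L) E8polyP).
Local Notation G := 'Gal({:L} / 1)%g.
Hypotheses (Pz : P = \prod_a ('X - (zeta a)%:P)) (z_inj : injective zeta).
Hypothesis genL : <<1 & [seq zeta a | a <- enum E8_root]>>%VS = {:L}%VS.
Hypothesis zV : forall a b, zeta a * zeta b = 1 -> val b = - val a.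
Hypothesis zM : forall a b, root P (zeta a * zeta b) = (dotv (val a) (val b) == -1).

(** Inner product -1 is detected by the product being a root of P, and opposite roots by inversion.
    So the values -1, 1, 2 and -2 are preserved, and 0 is the only other value. *)
Lemma gal_isometry (s : gal_of {:L}) : exists f : {perm E8_root},
  (forall a, s (zeta a) = zeta (f a)) /\ f \in isometries.
Proof.
have /fin_all_exists[h hE] a : exists b, s (zeta a) = zeta b.
  by apply/(rootPz Pz); rewrite gal_root_P (root_zeta Pz).
have h_inj : injective h.
  by move=> a b ab; apply/z_inj/(fmorph_inj s); rewrite /= !hE ab.
exists (perm h_inj); split=> [a|]; first by rewrite permE.
apply/isometryP => a b; rewrite !permE.
have dN u v : dotv u (- v) = - dotv u v by rewrite dotvC dotvNl dotvC.
have hopp c d : (val (h d) = - val (h c)) <-> (val d = - val c).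
  rewrite !(zeta_opp Pz z_inj zV) -!hE -fmorphV; split=> [|->//].
  exact: fmorph_inj.
have m1 c d : (dotv (val (h c)) (val (h d)) == -1) = (dotv (val c) (val d) == -1).
  by rewrite -!zM -!hE -rmorphM gal_root_P.
have [b' b'E] : exists b' : E8_root, val b' = - val b.
  by exists (reflection b b); rewrite reflectE root_norm scaler_nat mulr2n opprD addNKr.
have one : (dotv (val (h a)) (val (h b)) == 1) = (dotv (val a) (val b) == 1).
  by have := m1 a b'; rewrite (proj2 (hopp b b') b'E) b'E !dN !eqr_opp.
have [d3|/val_inj <-|e] := root_dot_cases a b; first last.
- by rewrite (proj2 (hopp b a) e) e !dotvNl !root_norm.
- by rewrite !root_norm.
have [d3'|/val_inj/h_inj <-|/hopp e] := root_dot_cases (h a) (h b); first last.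
- by rewrite (proj2 (hopp b a) e) e !dotvNl !root_norm.
- by rewrite !root_norm.
move: (m1 a b) one d3 d3'; rewrite !inE; set d := dotv (val a) _; set d' := dotv _ _.
case: (altP (d =P 1)) => [->|_]; case: (altP (d' =P 1)) => [->|_] //.
case: (altP (d =P -1)) => [->|_]; case: (altP (d' =P -1)) => [->|_] //=.
by rewrite !orbF => _ _ /eqP -> /eqP ->.
Qed.

Hypothesis transitive : forall a b, exists2 s : gal_of {:L}, s \in G &
  s (zeta a) = zeta b \/ s (zeta a) = (zeta b)^-1.
Hypothesis frobenius : exists (s : gal_of {:L}) (alpha : E8_root), s \in G /\
  forall a b, s (zeta a) = zeta b -> val b = - val (reflection alpha a).

Lemma galois_group_WE8 : (G \isog WE8)%g.
Proof.
have [f fP] : exists f : gal_of {:L} -> {perm E8_root}, forall s : gal_of {:L},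
    (forall a, s (zeta a) = zeta (f s a)) /\ f s \in isometries.
  exact: fin_all_exists gal_isometry.
have fz (s : gal_of {:L}) a : s (zeta a) = zeta (f s a) by case: (fP s).
have fiso (s : gal_of {:L}) : f s \in isometries by case: (fP s).
have fM : {in G &, {morph f : s t / (s * t)%g >-> (s * t)%g}}.
  move=> s t _ _; apply/permP => a; apply: z_inj.
  by rewrite permM -!fz galM ?memvf.
pose phi := Morphism fM.
have phiE : phi = f :> (_ -> _) by [].
have injphi : ('injm phi)%g.
  apply/subsetP => u /mker fu; rewrite inE; apply/gal_eqP => x _.
  have : (<<1 & [seq zeta a | a <- enum E8_root]>> <= fixedField [set u])%VS.
    apply/Fadjoin_seqP; split; first exact: sub1v.
    move=> _ /mapP[a _ ->]; apply/fixedFieldP; first exact: memvf.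
    by move=> v /set1P ->; rewrite fz -phiE fu perm1.
  rewrite genL => /subvP/(_ x (memvf x))/fixedFieldP => /(_ (memvf x))/(_ u (set11 u)) ->.
  by rewrite gal_id.
apply/isogP; exists phi => //; apply/eqP; rewrite eqEsubset; apply/andP; split.
  apply/subsetP => _ /morphimP[s _ _ ->]; apply: (subsetP isometries_WE8); exact: fiso.
pose H := (phi @* G)%G.
have fH s : s \in G -> f s \in H by move=> sG; apply: (mem_morphim phi).
have [bs odd_bs bsE] := frame_product.
pose n := (\prod_(b <- bs) reflection b)%g.
have nE a : val (n a) = - val a by exact: bsE.
have nC (g : {perm E8_root}) : g \in isometries -> commute n g.
  move=> gi; apply/permP => a; rewrite !permM; apply: val_inj.
  by rewrite nE (isometry_opp gi (nE a)).
have nn : (n * n = 1)%g.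
  by apply/permP => a; rewrite permM perm1; apply: val_inj; rewrite !nE opprK.
have [s [alpha [sG sE]]] := frobenius.
have alphaH : (reflection alpha * n)%g \in H.
  suff -> : (reflection alpha * n)%g = f s by exact: fH.
  by apply/permP => a; rewrite permM; apply: val_inj; rewrite nE (sE a (f s a)).
have betaH b : (reflection b * n)%g \in H.
  have [t tG tb] := transitive alpha b.
  (* Transitivity up to inversion is enough, since opposite roots have the same reflection. *)
  have -> : reflection b = (reflection alpha ^ f t)%g.
    rewrite isometry_reflection //; case: tb; rewrite fz; first by move/z_inj=> ->.
    by move/(zeta_opp Pz z_inj zV)/reflection_opp.
  have -> : (reflection alpha ^ f t * n)%g = ((reflection alpha * n) ^ f t)%g.
    by rewrite conjMg; congr (_ * _)%g; rewrite /conjg nC // mulKg.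
  by rewrite groupJ // fH.
have nH : n \in H.
  have : (\prod_(b <- bs) (reflection b * n))%g \in H by apply: group_prod.
  (* n = -1 is a central involution and the number of factors is even, so the elements -s_b of the
     frame multiply to n again. *)
  suff -> : (\prod_(b <- bs) (reflection b * n) = n * n ^+ (size bs))%g.
    by rewrite -[size bs]odd_double_half (negbTE odd_bs) -mul2n expgM expgS expg1 nn expg1n mulg1.
  rewrite {2}/n; elim: (bs) => [|b l IH]; first by rewrite !big_nil mul1g.
  rewrite !big_cons IH /= expgS -!mulgA; congr (_ * _)%g; rewrite !mulgA; congr (_ * _)%g.
  by apply: nC; apply: group_prod => c _; exact: reflection_isometry.
rewrite gen_subG; apply/subsetP => _ /imsetP[b _ ->].
by rewrite -[reflection b]mulg1 -nn mulgA groupM.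
Qed.

End Galois.

Theorem theorem1p1 (L : splittingFieldType rat)
    (splitL : splittingFieldFor 1 (map_poly (intr : int -> L) E8polyP) {:L}) :
  ('Gal({:L} / 1) \isog WE8)%g.
Proof.
have [zeta [Pz [z_inj genL] zV zM frob]] := labelled_roots splitL.
have [pos [pos_inj pos_neg posP pos56]] := half_system.
apply: (galois_group_WE8 Pz z_inj genL zV _ _ frob).
  move=> a b; apply/idP/eqP; first exact: (zeta_product Pz zM).
  exact: (product_root Pz z_inj zV zM pos_inj pos_neg posP pos56).
exact: (gal_transitive Pz z_inj zV pos_inj pos_neg posP).
Qed.
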